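(* Consider the magnetic geodesic flow on the 2-torus with Riemannian metric $ds^2=\Lambda(x,y)(dx^2+dy^2)$ and a non-zero magnetic field $\Omega$ (i.e. $\Omega\not\equiv 0$). Suppose that this flow admits an additional polynomial in momenta first integral $F$ of degree 4 with (real-)analytic periodic coefficients on 3 different energy levels $\{H=E_1\}$, $\{H=E_2\}$, $\{H=E_3\}$ ($E_1,E_2,E_3$ pairwise distinct). Then the magnetic field and the metric are functions of one variable, there exists a linear in momenta first integral $F_1$ of this flow on all energy levels, and $F$ can be expressed as a function of $F_1$ and the Hamiltonian $H$.
   Context: The 2-torus is $\mathbb{T}^2=\mathbb{R}^2/\Gamma$ ($\Gamma$ a lattice) with global conformal coordinates $(x,y)=(x^1,x^2)$ in which the metric is $ds^2=\Lambda(x,y)(dx^2+dy^2)$, $\Lambda>0$; $p_1,p_2$ are the conjugate momenta; $\Omega(x,y)$ is the magnetic field. ''Periodic'' means $\Gamma$-periodic; $\Lambda,\Omega$ are smooth, real-valued and periodic. The Hamiltonian is $H=\frac{p_1^2+p_2^2}{2\Lambda}$ and the magnetic Poisson bracket is $$\{F,H\}_{mg}=\sum_{i=1}^2\left(\frac{\partial F}{\partial x^i}\frac{\partial H}{\partial p_i}-\frac{\partial F}{\partial p_i}\frac{\partial H}{\partial x^i}\right)+\Omega(x^1,x^2)\left(\frac{\partial F}{\partial p_1}\frac{\partial H}{\partial p_2}-\frac{\partial F}{\partial p_2}\frac{\partial H}{\partial p_1}\right).$$ The magnetic geodesic flow is the flow of $\dot x^j=\{x^j,H\}_{mg}$, $\dot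 p_j=\{p_j,H\}_{mg}$, $j=1,2$. A function $F(x,y,p_1,p_2)$ is a first integral on the energy level $\{H=E\}$ ($E>0$) if $\{F,H\}_{mg}=0$ at every point with $H=E$; it is a first integral on all energy levels if $\{F,H\}_{mg}\equiv 0$. A polynomial in momenta of degree $N$ is $F=\sum_{s=0}^N\sum_{k=0}^s a_{s,k}(x,y)p_1^{s-k}p_2^k$ with real-valued periodic coefficients, not all $a_{N,k}$ identically zero; linear in momenta means degree 1. ''Additional'' means independent of $H$: $F$ is not constant on the energy levels under consideration. ''The magnetic field and metric are functions of one variable'' means that there is a nonzero $(\alpha,\beta)\in\mathbb{R}^2$ such that both $\Omega$ and $\Lambda$ depend only on $\alpha x+\beta y$ (equivalently, after a rotation of the coordinates $(x,y)$, both depend only on $y$). *)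

(* Defs.v *)
From Stdlib Require Import Reals ZArith.
From Coquelicot Require Import Coquelicot.

Open Scope R_scope.

(** Functions on the torus are lattice-periodic functions [R -> R -> R] of
    [(x, y)]; functions on its cotangent bundle are functions
    [R -> R -> R -> R -> R] of [(x, y, p1, p2)]. *)

Definition is_lattice (G : R -> R -> Prop) : Prop :=
  exists a1 a2 b1 b2 : R,
    a1 * b2 - a2 * b1 <> 0 /\
    forall u v : R,
      G u v <->
      exists m n : Z, u = IZR m * a1 + IZR n * b1 /\ v = IZR m * a2 + IZR n * b2.

Definition periodic (G : R -> R -> Prop) (f : R -> R -> R) : Prop :=
  forall u v : R, G u v -> forall x y : R, f (x + u) (y + v) = f x y.

(** [ex_diff_n f n x y] bundles existence and continuity at [(x, y)] of all
    iterated partial derivatives of order at most [n]; imposed at every point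
    and for every [n] it says that [f] is C^infinity. *)
Definition smooth (f : R -> R -> R) : Prop :=
  forall (n : nat) (x y : R), ex_diff_n f n x y.

(** The double power series is summed by total degree; since absolute
    convergence is required, the order of summation is immaterial. *)
Definition analytic_at (f : R -> R -> R) (x0 y0 : R) : Prop :=
  exists (c : nat -> nat -> R) (r : posreal),
    forall h k : R, Rabs h < r -> Rabs k < r ->
      ex_series (fun n =>
        sum_f_R0 (fun i => Rabs (c i (n - i)%nat * h ^ i * k ^ (n - i))) n) /\
      is_series (fun n =>
        sum_f_R0 (fun i => c i (n - i)%nat * h ^ i * k ^ (n - i)) n)
        (f (x0 + h) (y0 + k)).

Definition analytic (f : R -> R -> R) : Prop :=
  forall x y : R, analytic_at f x y.

Definition hamiltonian (Lam : R -> R -> R) (x y p1 p2 : R) : R :=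
  (p1 ^ 2 + p2 ^ 2) / (2 * Lam x y).

Definition d_x (F : R -> R -> R -> R -> R) (x y p1 p2 : R) : R :=
  Derive (fun t => F t y p1 p2) x.
Definition d_y (F : R -> R -> R -> R -> R) (x y p1 p2 : R) : R :=
  Derive (fun t => F x t p1 p2) y.
Definition d_p1 (F : R -> R -> R -> R -> R) (x y p1 p2 : R) : R :=
  Derive (fun t => F x y t p2) p1.
Definition d_p2 (F : R -> R -> R -> R -> R) (x y p1 p2 : R) : R :=
  Derive (fun t => F x y p1 t) p2.

Definition magnetic_bracket (Om : R -> R -> R) (F H : R -> R -> R -> R -> R)
    (x y p1 p2 : R) : R :=
  (d_x F x y p1 p2 * d_p1 H x y p1 p2 - d_p1 F x y p1 p2 * d_x H x y p1 p2)
  + (d_y F x y p1 p2 * d_p2 H x y p1 p2 - d_p2 F x y p1 p2 * d_y H x y p1 p2)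
  + Om x y * (d_p1 F x y p1 p2 * d_p2 H x y p1 p2
              - d_p2 F x y p1 p2 * d_p1 H x y p1 p2).

Definition first_integral_on_level (Lam Om : R -> R -> R) (E : R)
    (F : R -> R -> R -> R -> R) : Prop :=
  forall x y p1 p2 : R, hamiltonian Lam x y p1 p2 = E ->
    magnetic_bracket Om F (hamiltonian Lam) x y p1 p2 = 0.

Definition first_integral (Lam Om : R -> R -> R)
    (F : R -> R -> R -> R -> R) : Prop :=
  forall x y p1 p2 : R,
    magnetic_bracket Om F (hamiltonian Lam) x y p1 p2 = 0.

Definition constant_on_level (Lam : R -> R -> R) (E : R)
    (F : R -> R -> R -> R -> R) : Prop :=
  exists c : R, forall x y p1 p2 : R,
    hamiltonian Lam x y p1 p2 = E -> F x y p1 p2 = c.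

(** Polynomial in momenta of degree exactly [N], with [G]-periodic
    coefficients of regularity class [C]. *)
Definition polynomial_in_momenta (G : R -> R -> Prop)
    (C : (R -> R -> R) -> Prop) (N : nat) (F : R -> R -> R -> R -> R) : Prop :=
  exists a : nat -> nat -> R -> R -> R,
    (forall s k : nat, (k <= s <= N)%nat -> periodic G (a s k) /\ C (a s k)) /\
    (exists k : nat, (k <= N)%nat /\ exists x y : R, a N k x y <> 0) /\
    (forall x y p1 p2 : R,
       F x y p1 p2 =
       sum_f_R0 (fun s =>
         sum_f_R0 (fun k => a s k x y * p1 ^ (s - k) * p2 ^ k) s) N).

Definition depends_only_on (al be : R) (f : R -> R -> R) : Prop :=
  exists g : R -> R, forall x y : R, f x y = g (al * x + be * y).

(* Main.v *)
Require Import Defs.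
From Stdlib Require Import Reals.
From Coquelicot Require Import Coquelicot.
From Stdlib Require Import Ranalysis5 PSeries_reg Lra Lia Psatz Arith.
From Stdlib Require Import Classical ClassicalEpsilon FunctionalExtensionality.

(** [Lam * {F, H}] is a polynomial of degree 5 in the momenta without constant
    term; vanishing on three circles [|p| ^ 2 = 2 Lam E] it vanishes identically,
    so [F] is an integral on all energy levels.

    At the null momenta [p = z (1, - i)], where [H = 0], the bracket reduces to
    the chain [2 d/dz g_(k-1) = i k Om g_k] for [F = sum_k z ^ k g_k]. If all
    [g_k] with [k >= 1] vanish, [F - const] is divisible by [H] and the quotient
    is an integral of degree 2. Otherwise the top nonzero [g_m] is constant,
    [u = g_(m-1) / (m g_m)] solves [2 du/dz = i Om], and by Liouville's theorem
    [g_k = P^(k)(u) / k!] for a polynomial [P]. As [g_0] is real, the vector field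
    [T] formed by the coefficients of the linear part of [F] annihilates [u], hence
    is parallel along itself; on a torus this forces [div T = 0], so the direction
    [e] of [T] is locally constant, and constant by analyticity. Then [Lam], [u]
    and [Om] are invariant along [e], and [F1 = e . p + A] with [A] a component of
    [u] is a periodic linear integral. Subtracting a polynomial in [F1] from [F]
    kills its values at null momenta; dividing by [H] and repeating expresses [F]
    through [F1] and [H]. *)

(** * Smooth functions of two variables *)

(** Every term of the bracket with a derivative of [Lam] carries the factor [p1 ^ 2 + p2 ^ 2], so at
    null momenta the metric disappears and only [Om] is left in the chain. The metric returns
    through one further equation, the sum of the coefficients of [p1 ^ 2] and [p2 ^ 2] in the
    bracket, which says [div (Lam T) = 0]; together with [div T = 0] it makes [Lam] constant along
    [T].

    The obstacle is that [T] may have zeros, across which a smooth direction field could turn.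
    Analyticity excludes this, but only the coefficients of [F] are analytic: [Lam] and [Om] are
    merely smooth, and dividing by [H] multiplies coefficients by [2 Lam]. The statements on
    directions therefore assume [T = w (al, be)] with [al], [be] analytic and [w] positive. Both
    Liouville's theorem and the vanishing of [div T] rest on one integral fact about smooth fields:
    a periodic field with nonnegative divergence has divergence zero. *)

Definition D1 (f : R -> R -> R) (x y : R) : R := Derive (fun t => f t y) x.
Definition D2 (f : R -> R -> R) (x y : R) : R := Derive (fun t => f x t) y.

Lemma fun2_ext (f g : R -> R -> R) : (forall x y, f x y = g x y) -> f = g.
Proof.
  intros E. apply functional_extensionality; intros x.
  apply functional_extensionality; intros y. apply E.
Qed.

Lemma smooth_continuous f : smooth f -> forall x y, continuity_2d_pt f x y.
Proof. intros Hf x y. exact (proj1 (Hf 1%nat x y)). Qed.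

Lemma smooth_ex1 f : smooth f -> forall x y, ex_derive (fun t => f t y) x.
Proof. intros Hf x y. exact (proj1 (proj2 (Hf 1%nat x y))). Qed.

Lemma smooth_ex2 f : smooth f -> forall x y, ex_derive (fun t => f x t) y.
Proof. intros Hf x y. exact (proj1 (proj2 (proj2 (Hf 1%nat x y)))). Qed.

Lemma smooth_D1 f : smooth f -> smooth (D1 f).
Proof. intros Hf n x y. exact (proj1 (proj2 (proj2 (proj2 (Hf (S n) x y))))). Qed.

Lemma smooth_D2 f : smooth f -> smooth (D2 f).
Proof. intros Hf n x y. exact (proj2 (proj2 (proj2 (proj2 (Hf (S n) x y))))). Qed.

Lemma D1_const c : D1 (fun _ _ => c) = fun _ _ => 0.
Proof. apply fun2_ext; intros x y. exact (Derive_const c _). Qed.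

Lemma D2_const c : D2 (fun _ _ => c) = fun _ _ => 0.
Proof. apply fun2_ext; intros x y. exact (Derive_const c _). Qed.

Lemma smooth_const c : smooth (fun _ _ => c).
Proof.
  intros n; revert c; induction n as [|n IH]; intros c x y; simpl.
  - split; [apply continuity_2d_pt_const | exact I].
  - repeat split.
    + apply continuity_2d_pt_const.
    + apply ex_derive_const.
    + apply ex_derive_const.
    + change (ex_diff_n (D1 (fun _ _ => c)) n x y). rewrite D1_const. apply IH.
    + change (ex_diff_n (D2 (fun _ _ => c)) n x y). rewrite D2_const. apply IH.
Qed.

Lemma D1_plus f g : smooth f -> smooth g ->
  D1 (fun x y => f x y + g x y) = fun x y => D1 f x y + D1 g x y.
Proof.
  intros Hf Hg; apply fun2_ext; intros x y.
  apply (Derive_plus (fun t => f t y) (fun t => g t y));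
    apply smooth_ex1; assumption.
Qed.

Lemma D2_plus f g : smooth f -> smooth g ->
  D2 (fun x y => f x y + g x y) = fun x y => D2 f x y + D2 g x y.
Proof.
  intros Hf Hg; apply fun2_ext; intros x y.
  apply (Derive_plus (fun t => f x t) (fun t => g x t));
    apply smooth_ex2; assumption.
Qed.

Lemma D1_mult f g : smooth f -> smooth g ->
  D1 (fun x y => f x y * g x y)
  = fun x y => D1 f x y * g x y + f x y * D1 g x y.
Proof.
  intros Hf Hg; apply fun2_ext; intros x y.
  apply (Derive_mult (fun t => f t y) (fun t => g t y));
    apply smooth_ex1; assumption.
Qed.

Lemma D2_mult f g : smooth f -> smooth g ->
  D2 (fun x y => f x y * g x y)
  = fun x y => D2 f x y * g x y + f x y * D2 g x y.
Proof.
  intros Hf Hg; apply fun2_ext; intros x y.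
  apply (Derive_mult (fun t => f x t) (fun t => g x t));
    apply smooth_ex2; assumption.
Qed.

(** Stated at a fixed order [n]: in the induction for products, the two summands given by the
    product rule are known to be regular only up to order [n]. *)
Lemma ex_diff_n_plus n : forall f g,
  (forall x y, ex_diff_n f n x y) -> (forall x y, ex_diff_n g n x y) ->
  forall x y, ex_diff_n (fun x y => f x y + g x y) n x y.
Proof.
  induction n as [|n IH]; intros f g Hf Hg x y.
  - split; [|exact I].
    apply continuity_2d_pt_plus; [exact (proj1 (Hf x y)) | exact (proj1 (Hg x y))].
  - assert (F1 : forall x y, ex_derive (fun t => f t y) x)
      by (intros u v; exact (proj1 (proj2 (Hf u v)))).
    assert (G1 : forall x y, ex_derive (fun t => g t y) x)
      by (intros u v; exact (proj1 (proj2 (Hg u v)))).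
    assert (F2 : forall x y, ex_derive (fun t => f x t) y)
      by (intros u v; exact (proj1 (proj2 (proj2 (Hf u v))))).
    assert (G2 : forall x y, ex_derive (fun t => g x t) y)
      by (intros u v; exact (proj1 (proj2 (proj2 (Hg u v))))).
    split; [|split; [|split; [|split]]].
    + apply continuity_2d_pt_plus; [exact (proj1 (Hf x y)) | exact (proj1 (Hg x y))].
    + exact (ex_derive_plus (fun t => f t y) (fun t => g t y) x (F1 x y) (G1 x y)).
    + exact (ex_derive_plus (fun t => f x t) (fun t => g x t) y (F2 x y) (G2 x y)).
    + replace (fun u v => Derive (fun z => f z v + g z v) u)
        with (fun u v => D1 f u v + D1 g u v).
      * apply IH; intros u v.
        -- exact (proj1 (proj2 (proj2 (proj2 (Hf u v))))).
        -- exact (proj1 (proj2 (proj2 (proj2 (Hg u v))))).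
      * apply fun2_ext; intros u v. symmetry.
        exact (Derive_plus (fun t => f t v) (fun t => g t v) u (F1 u v) (G1 u v)).
    + replace (fun u v => Derive (fun z => f u z + g u z) v)
        with (fun u v => D2 f u v + D2 g u v).
      * apply IH; intros u v.
        -- exact (proj2 (proj2 (proj2 (proj2 (Hf u v))))).
        -- exact (proj2 (proj2 (proj2 (proj2 (Hg u v))))).
      * apply fun2_ext; intros u v. symmetry.
        exact (Derive_plus (fun t => f u t) (fun t => g u t) v (F2 u v) (G2 u v)).
Qed.

Lemma smooth_plus f g : smooth f -> smooth g -> smooth (fun x y => f x y + g x y).
Proof. intros Hf Hg n. apply ex_diff_n_plus; intros; auto. Qed.

Lemma smooth_mult f g : smooth f -> smooth g -> smooth (fun x y => f x y * g x y).
Proof.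
  intros Hf Hg n; revert f g Hf Hg; induction n as [|n IH]; intros f g Hf Hg x y.
  - split; [|exact I]. apply continuity_2d_pt_mult; apply smooth_continuous; assumption.
  - repeat split.
    + apply continuity_2d_pt_mult; apply smooth_continuous; assumption.
    + apply ex_derive_mult; apply smooth_ex1; assumption.
    + apply ex_derive_mult; apply smooth_ex2; assumption.
    + change (ex_diff_n (D1 (fun x y => f x y * g x y)) n x y).
      rewrite D1_mult by assumption.
      apply ex_diff_n_plus; apply IH; try apply smooth_D1; assumption.
    + change (ex_diff_n (D2 (fun x y => f x y * g x y)) n x y).
      rewrite D2_mult by assumption.
      apply ex_diff_n_plus; apply IH; try apply smooth_D2; assumption.
Qed.

Lemma smooth_scal c f : smooth f -> smooth (fun x y => c * f x y).
Proof. intros Hf. apply smooth_mult; [apply smooth_const | exact Hf]. Qed.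

Lemma D1_scal c f : D1 (fun x y => c * f x y) = fun x y => c * D1 f x y.
Proof. apply fun2_ext; intros x y. unfold D1, D2. apply Derive_scal. Qed.

Lemma D2_scal c f : D2 (fun x y => c * f x y) = fun x y => c * D2 f x y.
Proof. apply fun2_ext; intros x y. unfold D1, D2. apply Derive_scal. Qed.

Lemma D1_opp f : D1 (fun x y => - f x y) = fun x y => - D1 f x y.
Proof. apply fun2_ext; intros x y. unfold D1, D2. apply Derive_opp. Qed.

Lemma D2_opp f : D2 (fun x y => - f x y) = fun x y => - D2 f x y.
Proof. apply fun2_ext; intros x y. unfold D1, D2. apply Derive_opp. Qed.

Lemma smooth_opp f : smooth f -> smooth (fun x y => - f x y).
Proof.
  intros Hf. replace (fun x y => - f x y) with (fun x y => -1 * f x y)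
    by (apply fun2_ext; intros; ring).
  apply smooth_scal, Hf.
Qed.

Lemma smooth_minus f g : smooth f -> smooth g -> smooth (fun x y => f x y - g x y).
Proof. intros Hf Hg. apply smooth_plus; [exact Hf | apply smooth_opp, Hg]. Qed.

Lemma D1_minus f g : smooth f -> smooth g ->
  D1 (fun x y => f x y - g x y) = fun x y => D1 f x y - D1 g x y.
Proof.
  intros Hf Hg. unfold Rminus.
  rewrite D1_plus by (auto using smooth_opp). rewrite D1_opp. reflexivity.
Qed.

Lemma D2_minus f g : smooth f -> smooth g ->
  D2 (fun x y => f x y - g x y) = fun x y => D2 f x y - D2 g x y.
Proof.
  intros Hf Hg. unfold Rminus.
  rewrite D2_plus by (auto using smooth_opp). rewrite D2_opp. reflexivity.
Qed.

Lemma smooth_pow f n : smooth f -> smooth (fun x y => f x y ^ n).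
Proof.
  intros Hf; induction n as [|n IH]; simpl.
  - apply smooth_const.
  - apply smooth_mult; assumption.
Qed.

Create HintDb smooth.
Global Hint Resolve smooth_const smooth_plus smooth_mult smooth_opp smooth_minus
  smooth_D1 smooth_D2 smooth_scal smooth_pow : smooth.

Lemma D1_D2 f : smooth f -> forall x y, D1 (D2 f) x y = D2 (D1 f) x y.
Proof.
  intros Hf x y. apply (Schwarz f x y).
  - exists (mkposreal 1 Rlt_0_1); intros u v _ _. repeat split.
    + apply smooth_ex1, Hf.
    + apply smooth_ex2, Hf.
    + apply (smooth_ex1 (D2 f)); auto with smooth.
    + apply (smooth_ex2 (D1 f)); auto with smooth.
  - apply (smooth_continuous (D1 (D2 f))); auto with smooth.
  - apply (smooth_continuous (D2 (D1 f))); auto with smooth.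
Qed.

Lemma is_derive_D1 f x y : smooth f -> is_derive (fun t => f t y) x (D1 f x y).
Proof. intros Hf. apply Derive_correct, smooth_ex1, Hf. Qed.

Lemma is_derive_D2 f x y : smooth f -> is_derive (fun t => f x t) y (D2 f x y).
Proof. intros Hf. apply Derive_correct, smooth_ex2, Hf. Qed.

(** Restriction to lines is the means by which questions in two variables are reduced below to
    one-variable calculus. *)
Lemma is_derive_line f x y h k t : smooth f ->
  is_derive (fun s => f (x + s * h) (y + s * k)) t
    (h * D1 f (x + t * h) (y + t * k) + k * D2 f (x + t * h) (y + t * k)).
Proof.
  intros Hf.
  replace (h * D1 f (x + t * h) (y + t * k) + k * D2 f (x + t * h) (y + t * k))
    with (D1 f (x + t * h) (y + t * k) * h + D2 f (x + t * h) (y + t * k) * k) by ring.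
  apply is_derive_Reals.
  apply (derivable_pt_lim_comp_2d f (fun s => x + s * h) (fun s => y + s * k)).
  (* Total differentiability comes from the existence of both partial derivatives and the continuity
     of the first. *)
  - apply filterdiff_differentiable_pt_lim.
    apply (is_derive_filterdiff f (x + t * h) (y + t * k) (D1 f)).
    + apply filter_forall; intros u. apply is_derive_D1, Hf.
    + apply is_derive_D2, Hf.
    + apply (proj1 (continuity_2d_pt_filterlim (D1 f) _ _)).
      apply smooth_continuous; auto with smooth.
  - apply is_derive_Reals. auto_derive; [exact I | ring].
  - apply is_derive_Reals. auto_derive; [exact I | ring].
Qed.

Lemma continuous_line f x y h k t : smooth f ->
  continuous (fun s => f (x + s * h) (y + s * k)) t.
Proof.
  intros Hf. apply (ex_derive_continuous (fun s => f (x + s * h) (y + s * k))).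
  eexists. apply is_derive_line, Hf.
Qed.

Lemma zero_derive_const (g : R -> R) :
  (forall t, is_derive g t 0) -> forall s t, g s = g t.
Proof.
  intros H s t. destruct (Rtotal_order s t) as [L | [-> | L]].
  - exact (eq_is_derive g s t (fun r _ => H r) L).
  - reflexivity.
  - exact (eq_sym (eq_is_derive g t s (fun r _ => H r) L)).
Qed.

Lemma line_const f h k : smooth f ->
  (forall x y, h * D1 f x y + k * D2 f x y = 0) ->
  forall x y t, f (x + t * h) (y + t * k) = f x y.
Proof.
  intros Hf H x y t.
  replace (f x y) with (f (x + 0 * h) (y + 0 * k)) by (f_equal; ring).
  apply (zero_derive_const (fun s => f (x + s * h) (y + s * k))).
  intros s. rewrite <- (H (x + s * h) (y + s * k)). apply is_derive_line, Hf.
Qed.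

Lemma grad_zero_const f : smooth f ->
  (forall x y, D1 f x y = 0) -> (forall x y, D2 f x y = 0) ->
  forall x y, f x y = f 0 0.
Proof.
  intros Hf H1 H2 x y.
  rewrite <- (line_const f x y Hf) with (t := 1) (x := 0) (y := 0).
  - f_equal; ring.
  - intros u v. rewrite H1, H2. ring.
Qed.

Lemma invariant_depends_only f h k : smooth f -> (h <> 0 \/ k <> 0) ->
  (forall x y, h * D1 f x y + k * D2 f x y = 0) ->
  depends_only_on (- k) h f.
Proof.
  intros Hf Hne H.
  assert (N : h * h + k * k <> 0) by nra.
  (* The argument of [f] is the foot of the perpendicular from the origin to the line
     [- k x + h y = s]; [(x, y)] slides to it along [(h, k)]. *)
  exists (fun s => f (- k * s / (h * h + k * k)) (h * s / (h * h + k * k))).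
  intros x y.
  rewrite <- (line_const f h k Hf H x y (- (h * x + k * y) / (h * h + k * k))).
  f_equal; field; exact N.
Qed.

(** * Divergences on the torus *)

Lemma continuity_2d_pt_linear f a1 a2 b1 b2 x y :
  (forall x y, continuity_2d_pt f x y) ->
  continuity_2d_pt (fun s t => f (s * a1 + t * b1) (s * a2 + t * b2)) x y.
Proof.
  intros Hf.
  apply (proj2 (continuity_2d_pt_filterlim
    (fun s t => f (s * a1 + t * b1) (s * a2 + t * b2)) x y)).
  apply (continuous_comp_2 (fun z : R * R => fst z * a1 + snd z * b1)
    (fun z : R * R => fst z * a2 + snd z * b2) f (x, y)).
  - apply (continuous_plus (fun z : R * R => fst z * a1) (fun z => snd z * b1));
      apply (continuous_mult (K := R_AbsRing)); first
        [apply continuous_fst | apply continuous_snd | apply continuous_const].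
  - apply (continuous_plus (fun z : R * R => fst z * a2) (fun z => snd z * b2));
      apply (continuous_mult (K := R_AbsRing)); first
        [apply continuous_fst | apply continuous_snd | apply continuous_const].
  - apply (proj1 (continuity_2d_pt_filterlim f _ _)), Hf.
Qed.

Lemma is_derive_linear1 f a1 a2 b1 b2 x y : smooth f ->
  is_derive (fun s => f (s * a1 + y * b1) (s * a2 + y * b2)) x
    (a1 * D1 f (x * a1 + y * b1) (x * a2 + y * b2)
     + a2 * D2 f (x * a1 + y * b1) (x * a2 + y * b2)).
Proof.
  intros Hf.
  apply (is_derive_ext (fun s => f (y * b1 + s * a1) (y * b2 + s * a2))).
  { intros s. f_equal; ring. }
  rewrite (Rplus_comm (x * a1)), (Rplus_comm (x * a2)).
  apply is_derive_line, Hf.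
Qed.

Lemma is_derive_linear2 f a1 a2 b1 b2 x y : smooth f ->
  is_derive (fun t => f (x * a1 + t * b1) (x * a2 + t * b2)) y
    (b1 * D1 f (x * a1 + y * b1) (x * a2 + y * b2)
     + b2 * D2 f (x * a1 + y * b1) (x * a2 + y * b2)).
Proof. intros Hf. apply is_derive_line, Hf. Qed.

Lemma D1_linear f a1 a2 b1 b2 : smooth f ->
  D1 (fun s t => f (s * a1 + t * b1) (s * a2 + t * b2))
  = fun s t => (fun u v => a1 * D1 f u v + a2 * D2 f u v)
                 (s * a1 + t * b1) (s * a2 + t * b2).
Proof.
  intros Hf. apply fun2_ext; intros x y.
  apply is_derive_unique, is_derive_linear1, Hf.
Qed.

Lemma D2_linear f a1 a2 b1 b2 : smooth f ->
  D2 (fun s t => f (s * a1 + t * b1) (s * a2 + t * b2))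
  = fun s t => (fun u v => b1 * D1 f u v + b2 * D2 f u v)
                 (s * a1 + t * b1) (s * a2 + t * b2).
Proof.
  intros Hf. apply fun2_ext; intros x y.
  apply is_derive_unique, is_derive_linear2, Hf.
Qed.

Lemma smooth_linear f a1 a2 b1 b2 : smooth f ->
  smooth (fun s t => f (s * a1 + t * b1) (s * a2 + t * b2)).
Proof.
  intros Hf n; revert f Hf; induction n as [|n IH]; intros f Hf x y.
  - split; [|exact I]. apply continuity_2d_pt_linear, smooth_continuous, Hf.
  - split; [|split; [|split; [|split]]].
    + apply continuity_2d_pt_linear, smooth_continuous, Hf.
    + eexists; apply is_derive_linear1, Hf.
    + eexists; apply is_derive_linear2, Hf.
    + change (ex_diff_n (D1 (fun s t => f (s * a1 + t * b1) (s * a2 + t * b2))) n x y).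
      rewrite D1_linear by exact Hf.
      apply (IH (fun u v => a1 * D1 f u v + a2 * D2 f u v)). auto with smooth.
    + change (ex_diff_n (D2 (fun s t => f (s * a1 + t * b1) (s * a2 + t * b2))) n x y).
      rewrite D2_linear by exact Hf.
      apply (IH (fun u v => b1 * D1 f u v + b2 * D2 f u v)). auto with smooth.
Qed.

Lemma continuous_section1 f x y : smooth f -> continuous (fun s => f s y) x.
Proof. intros Hf. apply (ex_derive_continuous (fun s => f s y)), smooth_ex1, Hf. Qed.

Lemma ex_RInt_section1 f a b y : smooth f -> ex_RInt (fun s => f s y) a b.
Proof.
  intros Hf. apply (ex_RInt_continuous (V := R_CompleteNormedModule)).
  intros; apply continuous_section1, Hf.
Qed.

(** Claimed at the left endpoint only, since the interval of integration will be made to start at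
    the point of interest. *)
Lemma RInt_zero_nonneg (g : R -> R) a :
  (forall x, continuous g x) -> (forall x, 0 <= g x) ->
  RInt g a (a + 1) = 0 -> g a = 0.
Proof.
  intros Hc Hg H. destruct (Hg a) as [P | P]; [exfalso | lra].
  destruct (proj1 (filterlim_locally g (g a)) (Hc a) (mkposreal _ P)) as [d Hd].
  assert (Hd0 := cond_pos d).
  set (e := Rmin 1 (d / 2)).
  assert (E0 : 0 < e) by (apply Rmin_glb_lt; lra).
  assert (E1 : e <= 1) by apply Rmin_l.
  assert (E2 : e <= d / 2) by apply Rmin_r.
  assert (I : forall u v, ex_RInt g u v).
  { intros u v. apply (ex_RInt_continuous (V := R_CompleteNormedModule)); auto. }
  rewrite <- (RInt_Chasles g a (a + e) (a + 1)) in H by auto.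
  assert (H1 : 0 < RInt g a (a + e)).
  { apply RInt_gt_0; auto; [lra|]. intros x Hx.
    assert (B : ball (g a) (mkposreal _ P) (g x)).
    { apply Hd. change (Rabs (x - a) < d). rewrite Rabs_right; lra. }
    change (Rabs (g x - g a) < g a) in B. apply Rabs_def2 in B. lra. }
  assert (H2 : 0 <= RInt g (a + e) (a + 1)).
  { apply RInt_ge_0; auto. lra. }
  unfold plus in H; simpl in H. lra.
Qed.

(** A monotone periodic function is squeezed between its equal values at [t - 1], [t] and [t + 1],
    hence is constant near [t]. *)
Lemma nondecreasing_periodic_derive (g g' : R -> R) :
  (forall t, is_derive g t (g' t)) -> (forall t, 0 <= g' t) ->
  (forall t, g (t + 1) = g t) -> forall t, g' t = 0.
Proof.
  intros Hd Hp Hper t.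
  assert (M : forall u v, u <= v -> g u <= g v).
  { intros u v L. destruct (MVT_gen g u v g') as [c [_ Hc]].
    - intros; apply Hd.
    - intros. apply derivable_continuous_pt. eexists. apply is_derive_Reals, Hd.
    - assert (0 <= g' c * (v - u)) by (apply Rmult_le_pos; [apply Hp | lra]). lra. }
  assert (Z : is_derive g t 0).
  { apply (is_derive_ext_loc (fun _ => g t)).
    - exists (mkposreal 1 Rlt_0_1). intros s Hs.
      change (Rabs (s - t) < 1) in Hs. apply Rabs_def2 in Hs.
      destruct (Rle_dec t s).
      + assert (g t <= g s) by (apply M; lra).
        assert (g s <= g (t + 1)) by (apply M; lra). rewrite Hper in *. lra.
      + assert (g s <= g t) by (apply M; lra).
        assert (g (t - 1) <= g s) by (apply M; lra).
        assert (Q := Hper (t - 1)). replace (t - 1 + 1) with t in Q by ring. lra.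
    - apply (is_derive_const (V := R_NormedModule)). }
  rewrite <- (is_derive_unique _ _ _ (Hd t)). apply is_derive_unique, Z.
Qed.

(** The divergence theorem with one-dimensional integrals only. Over one period in [x] the term
    [D1 W1] integrates to zero, so the integral of the divergence is the [y]-derivative of the flux
    of [W2]. The flux is thus nondecreasing and periodic, its derivative is zero, and a nonnegative
    continuous integrand with zero integral vanishes. *)
Lemma div_nonneg_unit_periodic W1 W2 :
  smooth W1 -> smooth W2 ->
  (forall x y, W1 (x + 1) y = W1 x y) -> (forall x y, W2 x (y + 1) = W2 x y) ->
  (forall x y, 0 <= D1 W1 x y + D2 W2 x y) ->
  forall x y, D1 W1 x y + D2 W2 x y = 0.
Proof.
  intros S1 S2 P1 P2 H x y.
  assert (Sd : smooth (fun u v => D1 W1 u v + D2 W2 u v)) by auto with smooth.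
  apply (RInt_zero_nonneg (fun s => D1 W1 s y + D2 W2 s y) x).
  { intros s. apply (continuous_section1 _ s y Sd). }
  { intros s; apply H. }
  apply (nondecreasing_periodic_derive (fun t => RInt (fun s => W2 s t) x (x + 1))
           (fun t => RInt (fun s => D1 W1 s t + D2 W2 s t) x (x + 1))).
  - intros t.
    replace (RInt (fun s => D1 W1 s t + D2 W2 s t) x (x + 1))
      with (RInt (fun s => D2 W2 s t) x (x + 1)).
    + apply (is_derive_RInt_param (fun v u => W2 u v) x (x + 1) t).
      * apply filter_forall; intros v s _. apply smooth_ex2, S2.
      * intros s _.
        assert (C := smooth_continuous (D2 W2) (smooth_D2 _ S2) s t).
        intros eps; destruct (C eps) as [d Hd]; exists d; intros u v Hu Hv.
        apply Hd; assumption.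
      * apply filter_forall; intros v. apply ex_RInt_section1, S2.
    + rewrite (RInt_plus (V := R_CompleteNormedModule) (fun s => D1 W1 s t)
        (fun s => D2 W2 s t)) by (apply ex_RInt_section1; auto with smooth).
      assert (E : RInt (fun s => D1 W1 s t) x (x + 1) = 0).
      { apply is_RInt_unique.
        replace 0 with (minus (W1 (x + 1) t) (W1 x t))
          by (rewrite P1; unfold minus, plus, opp; simpl; ring).
        apply (is_RInt_derive (fun s => W1 s t) (fun s => D1 W1 s t)).
        - intros; apply is_derive_D1, S1.
        - intros; apply continuous_section1; auto with smooth. }
      rewrite E. exact (eq_sym (Rplus_0_l _)).
  - intros t. apply RInt_ge_0; [lra | | intros; apply H].
    apply (ex_RInt_section1 _ x (x + 1) t Sd).
  - intros t. apply RInt_ext; intros; apply P2.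
Qed.

Lemma div_nonneg_periodic G V1 V2 :
  is_lattice G -> smooth V1 -> smooth V2 -> periodic G V1 -> periodic G V2 ->
  (forall x y, 0 <= D1 V1 x y + D2 V2 x y) ->
  forall x y, D1 V1 x y + D2 V2 x y = 0.
Proof.
  intros [a1 [a2 [b1 [b2 [Hd HG]]]]] S1 S2 P1 P2 H x y.
  assert (Ga : G a1 a2).
  { apply HG. exists 1%Z, 0%Z. split; simpl; ring. }
  assert (Gb : G b1 b2).
  { apply HG. exists 0%Z, 1%Z. split; simpl; ring. }
  set (d := a1 * b2 - a2 * b1) in *.
  (* The pullback of [V] to lattice coordinates, scaled by [d ^ 2] so that its
     divergence is nonnegative for either orientation of the basis. *)
  set (U1 := fun u v => d * (b2 * V1 u v - b1 * V2 u v)).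
  set (U2 := fun u v => d * (a1 * V2 u v - a2 * V1 u v)).
  assert (SU1 : smooth U1) by (unfold U1; auto with smooth).
  assert (SU2 : smooth U2) by (unfold U2; auto with smooth).
  assert (E : forall u v,
    (a1 * D1 U1 u v + a2 * D2 U1 u v) + (b1 * D1 U2 u v + b2 * D2 U2 u v)
    = d * d * (D1 V1 u v + D2 V2 u v)).
  { intros u v. unfold U1, U2.
    rewrite !D1_scal, !D2_scal.
    rewrite !D1_minus, !D2_minus by auto with smooth.
    rewrite !D1_scal, !D2_scal. unfold d; ring. }
  assert (Z := div_nonneg_unit_periodic
    (fun s t => U1 (s * a1 + t * b1) (s * a2 + t * b2))
    (fun s t => U2 (s * a1 + t * b1) (s * a2 + t * b2))
    (smooth_linear _ a1 a2 b1 b2 SU1) (smooth_linear _ a1 a2 b1 b2 SU2)).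
  rewrite D1_linear, D2_linear in Z by assumption. cbv beta in Z.
  (* The lattice coordinates of [(x, y)], by Cramer's rule. *)
  specialize (fun p q r => Z p q r ((x * b2 - y * b1) / d) ((y * a1 - x * a2) / d)).
  rewrite E in Z.
  replace ((x * b2 - y * b1) / d * a1 + (y * a1 - x * a2) / d * b1) with x in Z
    by (unfold d in *; field; exact Hd).
  replace ((x * b2 - y * b1) / d * a2 + (y * a1 - x * a2) / d * b2) with y in Z
    by (unfold d in *; field; exact Hd).
  apply (Rmult_eq_reg_l (d * d)); [rewrite Rmult_0_r; apply Z | nra].
  - intros s t.
    replace ((s + 1) * a1 + t * b1) with (s * a1 + t * b1 + a1) by ring.
    replace ((s + 1) * a2 + t * b2) with (s * a2 + t * b2 + a2) by ring.
    unfold U1. rewrite (P1 _ _ Ga), (P2 _ _ Ga). reflexivity.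
  - intros s t.
    replace (s * a1 + (t + 1) * b1) with (s * a1 + t * b1 + b1) by ring.
    replace (s * a2 + (t + 1) * b2) with (s * a2 + t * b2 + b2) by ring.
    unfold U2. rewrite (P1 _ _ Gb), (P2 _ _ Gb). reflexivity.
  - intros s t. rewrite E. apply Rmult_le_pos; [nra | apply H].
Qed.

(** * Closure properties of periodic functions *)

Lemma periodic_D1 G f : smooth f -> periodic G f -> periodic G (D1 f).
Proof.
  intros Hf Hp u v Huv x y.
  assert (H1 := is_derive_line f (x + u) (y + v) 1 0 0 Hf).
  assert (H2 := is_derive_line f x y 1 0 0 Hf).
  apply is_derive_unique in H1. apply is_derive_unique in H2.
  assert (E := Derive_ext (fun s => f (x + u + s * 1) (y + v + s * 0))
    (fun s => f (x + s * 1) (y + s * 0)) 0).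
  lapply E; clear E; [intros E |].
  - assert (Q := eq_trans (eq_sym H1) (eq_trans E H2)).
    rewrite !Rmult_0_l, !Rplus_0_r in Q. lra.
  - intros s. rewrite <- (Hp u v Huv (x + s * 1)). f_equal; ring.
Qed.

Lemma periodic_D2 G f : smooth f -> periodic G f -> periodic G (D2 f).
Proof.
  intros Hf Hp u v Huv x y.
  assert (H1 := is_derive_line f (x + u) (y + v) 0 1 0 Hf).
  assert (H2 := is_derive_line f x y 0 1 0 Hf).
  apply is_derive_unique in H1. apply is_derive_unique in H2.
  assert (E := Derive_ext (fun s => f (x + u + s * 0) (y + v + s * 1))
    (fun s => f (x + s * 0) (y + s * 1)) 0).
  lapply E; clear E; [intros E |].
  - assert (Q := eq_trans (eq_sym H1) (eq_trans E H2)).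
    rewrite !Rmult_0_l, !Rplus_0_r in Q. lra.
  - intros s. rewrite <- (Hp u v Huv (x + s * 0)). f_equal; ring.
Qed.

Lemma periodic_const G c : periodic G (fun _ _ => c).
Proof. intros u v _ x y; reflexivity. Qed.

Lemma periodic_plus G f g : periodic G f -> periodic G g ->
  periodic G (fun x y => f x y + g x y).
Proof. intros Hf Hg u v H x y. rewrite (Hf u v H), (Hg u v H). reflexivity. Qed.

Lemma periodic_mult G f g : periodic G f -> periodic G g ->
  periodic G (fun x y => f x y * g x y).
Proof. intros Hf Hg u v H x y. rewrite (Hf u v H), (Hg u v H). reflexivity. Qed.

Lemma periodic_opp G f : periodic G f -> periodic G (fun x y => - f x y).
Proof. intros Hf u v H x y. rewrite (Hf u v H). reflexivity. Qed.

Lemma periodic_minus G f g : periodic G f -> periodic G g ->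
  periodic G (fun x y => f x y - g x y).
Proof. intros Hf Hg u v H x y. rewrite (Hf u v H), (Hg u v H). reflexivity. Qed.

Lemma periodic_scal G c f : periodic G f -> periodic G (fun x y => c * f x y).
Proof. intros Hf u v H x y. rewrite (Hf u v H). reflexivity. Qed.

Lemma periodic_pow G f n : periodic G f -> periodic G (fun x y => f x y ^ n).
Proof. intros Hf u v H x y. rewrite (Hf u v H). reflexivity. Qed.

Global Hint Resolve periodic_D1 periodic_D2 periodic_const periodic_plus
  periodic_mult periodic_opp periodic_minus periodic_scal periodic_pow : smooth.

(* [r s_y, - r s_x] has divergence [-|grad s| ^ 2] by the Cauchy-Riemann
   equations. *)
Lemma cauchy_riemann_periodic_const G r s :
  is_lattice G -> smooth r -> smooth s -> periodic G r -> periodic G s ->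
  (forall x y, D1 r x y + D2 s x y = 0) -> (forall x y, D1 s x y - D2 r x y = 0) ->
  forall x y, r x y = r 0 0 /\ s x y = s 0 0.
Proof.
  intros HG Sr Ss Pr Ps H1 H2.
  set (V1 := fun x y => - (r x y * D2 s x y)).
  set (V2 := fun x y => r x y * D1 s x y).
  assert (E : forall x y, D1 V1 x y + D2 V2 x y = D1 s x y ^ 2 + D2 s x y ^ 2).
  { intros x y. unfold V1, V2.
    rewrite D1_opp, D1_mult, D2_mult by auto with smooth.
    rewrite (D1_D2 s Ss). specialize (H1 x y); specialize (H2 x y).
    replace (D1 r x y) with (- D2 s x y) by lra.
    replace (D2 r x y) with (D1 s x y) by lra. ring. }
  assert (Z := div_nonneg_periodic G V1 V2 HG).
  unfold V1, V2 in Z.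
  specialize (Z ltac:(auto with smooth) ltac:(auto with smooth)
    ltac:(auto with smooth) ltac:(auto with smooth)).
  fold V1 V2 in Z.
  assert (Z' : forall x y, D1 s x y ^ 2 + D2 s x y ^ 2 = 0).
  { intros x y. rewrite <- E. apply Z. intros u v. rewrite E.
    generalize (pow2_ge_0 (D1 s u v)), (pow2_ge_0 (D2 s u v)); lra. }
  assert (A1 : forall x y, D1 s x y = 0) by (intros x y; specialize (Z' x y); nra).
  assert (A2 : forall x y, D2 s x y = 0) by (intros x y; specialize (Z' x y); nra).
  intros x y; split; apply grad_zero_const; auto; intros u v.
  - rewrite <- (H1 u v), A2. ring.
  - generalize (H2 u v); rewrite A1. lra.
Qed.

(* The divergence [d] of a field [T = (a, b)] that is parallel along its own
   trajectories obeys the Riccati equation [T d = - d ^ 2 + 2 det DT], and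
   [det DT] vanishes where [T] does not; hence
   [div (|T| ^ 2 d ^ 3 T) = - 2 |T| ^ 2 d ^ 4]. *)
Lemma self_parallel_field_div_zero G a b :
  is_lattice G -> smooth a -> smooth b -> periodic G a -> periodic G b ->
  (forall x y, a x y * D1 a x y + b x y * D2 a x y = 0) ->
  (forall x y, a x y * D1 b x y + b x y * D2 b x y = 0) ->
  forall x y, (a x y = 0 /\ b x y = 0) \/ D1 a x y + D2 b x y = 0.
Proof.
  intros HG Sa Sb Pa Pb Ta Tb.
  set (d := fun x y => D1 a x y + D2 b x y).
  assert (Sd : smooth d) by (unfold d; auto with smooth).
  assert (Pd : periodic G d) by (unfold d; auto with smooth).
  set (n := fun x y => a x y * a x y + b x y * b x y).
  assert (Sn : smooth n) by (unfold n; auto with smooth).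
  assert (Pn : periodic G n) by (unfold n; auto with smooth).
  set (det := fun x y => D1 a x y * D2 b x y - D2 a x y * D1 b x y).
  assert (Ndet : forall x y, n x y * det x y = 0).
  { intros x y. specialize (Ta x y); specialize (Tb x y). unfold n, det.
    set (a0 := a x y) in *; set (b0 := b x y) in *.
    set (ax := D1 a x y) in *; set (ay := D2 a x y) in *.
    set (bx := D1 b x y) in *; set (b_y := D2 b x y) in *.
    assert (U : a0 * (ax * b_y - ay * bx)
      = (a0 * ax + b0 * ay) * b_y - (a0 * bx + b0 * b_y) * ay) by ring.
    assert (V : b0 * (ax * b_y - ay * bx)
      = (a0 * bx + b0 * b_y) * ax - (a0 * ax + b0 * ay) * bx) by ring.
    rewrite Ta, Tb in U, V.
    replace ((a0 * a0 + b0 * b0) * (ax * b_y - ay * bx))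
      with (a0 * (a0 * (ax * b_y - ay * bx)) + b0 * (b0 * (ax * b_y - ay * bx))) by ring.
    rewrite U, V. ring. }
  assert (Tn : forall x y, a x y * D1 n x y + b x y * D2 n x y = 0).
  { intros x y. unfold n.
    rewrite D1_plus, D2_plus by auto with smooth.
    rewrite !D1_mult, !D2_mult by auto with smooth.
    specialize (Ta x y); specialize (Tb x y).
    replace (a x y * _ + b x y * _) with
      (2 * a x y * (a x y * D1 a x y + b x y * D2 a x y)
       + 2 * b x y * (a x y * D1 b x y + b x y * D2 b x y)) by ring.
    rewrite Ta, Tb. ring. }
  assert (Td : forall x y,
    a x y * D1 d x y + b x y * D2 d x y = - (d x y * d x y) + 2 * det x y).
  { intros x y.
    (* The Riccati equation is the sum of the [x]-derivative of the first hypothesis and the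
       [y]-derivative of the second. *)
    assert (EX : (fun x y => a x y * D1 a x y + b x y * D2 a x y) = fun _ _ => 0)
      by (apply fun2_ext; apply Ta).
    assert (EY : (fun x y => a x y * D1 b x y + b x y * D2 b x y) = fun _ _ => 0)
      by (apply fun2_ext; apply Tb).
    assert (QX := f_equal (fun f => D1 f x y) EX).
    assert (QY := f_equal (fun f => D2 f x y) EY). cbv beta in QX, QY.
    rewrite D1_const, D1_plus, !D1_mult in QX by auto with smooth.
    rewrite D2_const, D2_plus, !D2_mult in QY by auto with smooth.
    unfold d, det. rewrite D1_plus, D2_plus by auto with smooth.
    rewrite (D1_D2 a Sa) in QX. rewrite <- (D1_D2 b Sb) in QY.
    assert (S1 := D1_D2 a Sa x y). assert (S2 := D1_D2 b Sb x y).
    nra. }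
  (* With [d ^ m] in place of [d ^ 3] the divergence of the unsigned field is
     [(1 - m) |T| ^ 2 d ^ (m + 1)], and 3 is the least natural [m] for which this has a fixed sign
     without being identically zero. The factor [n] is constant along [T] and removes the
     determinant. *)
  set (V1 := fun x y => - (n x y * (d x y * (d x y * d x y)) * a x y)).
  set (V2 := fun x y => - (n x y * (d x y * (d x y * d x y)) * b x y)).
  assert (E : forall x y, D1 V1 x y + D2 V2 x y = 2 * n x y * (d x y * d x y) ^ 2).
  { intros x y. unfold V1, V2.
    rewrite D1_opp, D2_opp.
    rewrite !D1_mult, !D2_mult by auto with smooth.
    specialize (Td x y); specialize (Tn x y); specialize (Ndet x y).
    transitivity (- (d x y) ^ 3 * (a x y * D1 n x y + b x y * D2 n x y)
      - n x y * (d x y) ^ 3 * (D1 a x y + D2 b x y)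
      - 3 * n x y * d x y ^ 2 * (a x y * D1 d x y + b x y * D2 d x y)); [ring |].
    rewrite Td, Tn.
    transitivity (2 * n x y * (d x y * d x y) ^ 2 - 6 * d x y ^ 2 * (n x y * det x y)).
    - change (D1 a x y + D2 b x y) with (d x y). ring.
    - rewrite Ndet. ring. }
  intros x y.
  assert (Z : D1 V1 x y + D2 V2 x y = 0).
  { apply (div_nonneg_periodic G); try (unfold V1, V2; auto 10 with smooth; fail); auto.
    intros u v. rewrite E. apply Rmult_le_pos; [unfold n; nra | apply pow2_ge_0]. }
  rewrite E in Z.
  destruct (Req_dec (d x y) 0) as [D | D]; [right; exact D | left].
  assert (N : n x y = 0).
  { apply Rmult_integral in Z. destruct Z as [Z | Z]; [lra |].
    exfalso. apply (pow_nonzero (d x y * d x y) 2); [nra | exact Z]. }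
  unfold n in N. split; nra.
Qed.

(** * Real analytic functions *)

Definition analytic1 (g : R -> R) : Prop :=
  forall t, exists (a : nat -> R) (r : posreal),
    forall h, Rabs h < r -> is_pseries a h (g (t + h)).

Lemma ex_series_bounded (u : nat -> R) :
  ex_series u -> exists M, 0 < M /\ forall n, Rabs (u n) <= M.
Proof.
  intros H. apply ex_series_lim_0 in H. apply is_lim_seq_Reals in H.
  destruct (maj_by_pos u (exist _ 0 H)) as [M HM]. exists M; exact HM.
Qed.

Lemma least_nonzero (a : nat -> R) :
  (exists n, a n <> 0) -> exists k, a k <> 0 /\ forall j, (j < k)%nat -> a j = 0.
Proof.
  intros [n Hn]. revert Hn. induction n as [n IH] using (well_founded_induction Nat.lt_wf_0).
  intros Hn. destruct (classic (exists j, (j < n)%nat /\ a j <> 0)) as [[j [Hj Hne]] | N].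
  - exact (IH j Hj Hne).
  - exists n; split; [exact Hn|]. intros j Hj.
    destruct (Req_dec (a j) 0) as [E | E]; [exact E | exfalso; apply N; exists j; auto].
Qed.

(** If [k] is the least index with a nonzero coefficient, the series is [h ^ k] times a power series
    [b] that does not vanish at 0. The terms at [r / 2] are bounded, so [b] has positive radius of
    convergence, is continuous at 0 and stays nonzero nearby. *)
Lemma analytic1_isolated_zeros g t : analytic1 g ->
  locally t (fun s => g s = 0) \/
  (exists e : posreal, forall s, s <> t -> Rabs (s - t) < e -> g s <> 0).
Proof.
  intros Hg. destruct (Hg t) as [a [r Hr]].
  destruct (classic (exists n, a n <> 0)) as [N | N].
  - right. destruct (least_nonzero a N) as [k [Hk Hz]].
    set (b := PS_decr_n a k).
    assert (Hr0 := cond_pos r).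
    assert (Rr : Rabs (r / 2) < r) by (rewrite Rabs_right; lra).
    destruct (ex_series_bounded (fun n => a n * (r / 2) ^ n)) as [M [M0 HM]].
    { exists (g (t + r / 2)). apply is_pseries_R, Hr, Rr. }
    assert (C : continuity_pt (PSeries b) 0).
    { apply PSeries_continuity. apply Rbar_lt_le_trans with (r / 2).
      - simpl. rewrite Rabs_R0. lra.
      - apply (proj1 (CV_radius_bounded b)). exists (M / (r / 2) ^ k). intros n.
        assert (P : 0 < (r / 2) ^ k) by (apply pow_lt; lra).
        apply (Rmult_le_reg_r ((r / 2) ^ k)); [exact P|].
        unfold Rdiv at 3. rewrite Rmult_assoc, Rinv_l, Rmult_1_r by lra.
        rewrite <- (Rabs_right ((r / 2) ^ k)) at 1 by lra. rewrite <- Rabs_mult.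
        specialize (HM (k + n)%nat). rewrite pow_add in HM.
        unfold b, PS_decr_n.
        replace (a (k + n)%nat * (r / 2) ^ n * (r / 2) ^ k)
          with (a (k + n)%nat * ((r / 2) ^ k * (r / 2) ^ n)) by ring. exact HM. }
    assert (B0 : PSeries b 0 <> 0).
    { rewrite PSeries_0. unfold b, PS_decr_n. rewrite Nat.add_0_r. exact Hk. }
    destruct (C (Rabs (PSeries b 0)) (Rabs_pos_lt _ B0)) as [e [He Hc]].
    exists (mkposreal (Rmin e r) (Rmin_glb_lt _ _ _ He Hr0)). simpl.
    intros s Hs Hd.
    assert (D1 : Rabs (s - t) < e) by (eapply Rlt_le_trans; [exact Hd | apply Rmin_l]).
    assert (D2 : Rabs (s - t) < r) by (eapply Rlt_le_trans; [exact Hd | apply Rmin_r]).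
    assert (Q := is_pseries_unique _ _ _ (Hr _ D2)).
    rewrite (PSeries_decr_n_aux a k _ Hz) in Q. fold b in Q.
    assert (Ets : t + (s - t) = s) by ring. rewrite Ets in Q. rewrite <- Q.
    apply Rmult_integral_contrapositive_currified.
    + apply pow_nonzero. lra.
    + intros Z. specialize (Hc (s - t)). simpl in Hc. unfold Rdist in Hc.
      rewrite Z in Hc. rewrite Rminus_0_l, Rabs_Ropp in Hc.
      apply (Rlt_irrefl (Rabs (PSeries b 0))). apply Hc. split.
      * unfold D_x, no_cond. split; [exact I | lra].
      * rewrite Rminus_0_r. exact D1.
  - left. exists r. intros s Hs. change (Rabs (s - t) < r) in Hs.
    assert (Q := is_pseries_unique _ _ _ (Hr _ Hs)).
    assert (Ets : t + (s - t) = s) by ring. rewrite Ets in Q. rewrite <- Q.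
    rewrite (PSeries_ext a (fun _ => 0)); [apply PSeries_const_0 |].
    intros n; apply NNPP; intros Z; apply N; exists n; exact Z.
Qed.

(* The set of points near which [g] vanishes is open and closed: its indicator
   function has zero derivative. *)
Lemma analytic1_locally_zero g s t : analytic1 g ->
  locally s (fun r => g r = 0) -> locally t (fun r => g r = 0).
Proof.
  intros Hg.
  set (Z := fun x => locally x (fun r => g r = 0)).
  set (ind := fun x => if excluded_middle_informative (Z x) then 1 else 0).
  assert (H : forall x, is_derive ind x 0).
  { intros x. apply (is_derive_ext_loc (fun _ => ind x)).
    2: apply (is_derive_const (V := R_NormedModule)).
    destruct (analytic1_isolated_zeros g x Hg) as [L | [e He]].
    - assert (L' := locally_locally x _ L).
      revert L'. apply filter_imp. intros y Hy. unfold ind.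
      destruct (excluded_middle_informative (Z x)) as [_ | N]; [|contradiction].
      destruct (excluded_middle_informative (Z y)) as [_ | N]; [reflexivity | contradiction].
    - assert (N : forall y, Rabs (y - x) < e -> ~ Z y).
      { intros y Hy [d Hd].
        assert (P1 := cond_pos d).
        set (m := Rmin d (e - Rabs (y - x))).
        assert (M0 : 0 < m) by (apply Rmin_glb_lt; lra).
        assert (M1 : m <= d) by apply Rmin_l.
        assert (M2 : m <= e - Rabs (y - x)) by apply Rmin_r.
        (* A point near [y] other than [x]: of two candidates at most one is equal to [x]. *)
        assert (W : exists w, w <> x /\ Rabs (w - y) < m).
        { destruct (Req_dec (y + m / 2) x) as [E | E].
          - exists (y + m / 4). split; [lra |].
            replace (y + m / 4 - y) with (m / 4) by ring. rewrite Rabs_right; lra.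
          - exists (y + m / 2). split; [exact E |].
            replace (y + m / 2 - y) with (m / 2) by ring. rewrite Rabs_right; lra. }
        destruct W as [w [W1 W2]].
        apply (He w W1).
        - replace (w - x) with ((w - y) + (y - x)) by ring.
          eapply Rle_lt_trans; [apply Rabs_triang |]. lra.
        - apply Hd. change (Rabs (w - y) < d). lra. }
      exists e. intros y Hy. change (Rabs (y - x) < e) in Hy. unfold ind.
      destruct (excluded_middle_informative (Z x)) as [Q | _].
      + exfalso. apply (N x); [|exact Q].
        rewrite Rminus_diag, Rabs_R0. apply cond_pos.
      + destruct (excluded_middle_informative (Z y)) as [Q | _]; [|reflexivity].
        exfalso. exact (N y Hy Q). }
  intros Hs. apply NNPP; intros Ht.
  assert (E := zero_derive_const ind H s t). unfold ind in E.
  destruct (excluded_middle_informative (Z s)) as [_ | N]; [|contradiction].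
  destruct (excluded_middle_informative (Z t)) as [N | _]; [contradiction|].
  lra.
Qed.

Lemma analytic1_locally_zero_eq g s : analytic1 g ->
  locally s (fun r => g r = 0) -> forall t, g t = 0.
Proof. intros Hg Hs t. exact (locally_singleton _ _ (analytic1_locally_zero g s t Hg Hs)). Qed.

(** Where [h] is nonzero it stays so nearby, which would make [g] vanish on an interval and then
    everywhere. Only continuity is asked of [h], because it will be formed from derivatives of
    functions that are merely smooth. *)
Lemma analytic1_cancel g h s : analytic1 g -> g s <> 0 ->
  (forall t, continuous h t) -> (forall t, g t * h t = 0) -> forall t, h t = 0.
Proof.
  intros Hg Hs Hc H t. apply NNPP; intros Ht. apply Hs.
  apply (analytic1_locally_zero_eq g t Hg).
  destruct (proj1 (filterlim_locally h (h t)) (Hc t)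
    (mkposreal _ (Rabs_pos_lt _ Ht))) as [d Hd].
  exists d. intros r Hr. specialize (Hd r Hr).
  change (Rabs (h r - h t) < Rabs (h t)) in Hd.
  destruct (Rmult_integral _ _ (H r)) as [E | E]; [exact E | exfalso].
  rewrite E, Rminus_0_l, Rabs_Ropp in Hd. lra.
Qed.

Lemma analytic1_comb g1 g2 c1 c2 : analytic1 g1 -> analytic1 g2 ->
  analytic1 (fun t => c1 * g1 t + c2 * g2 t).
Proof.
  intros H1 H2 t. destruct (H1 t) as [a [r Hr]]. destruct (H2 t) as [b [q Hq]].
  exists (PS_plus (PS_scal c1 a) (PS_scal c2 b)).
  exists (mkposreal (Rmin r q) (Rmin_glb_lt _ _ _ (cond_pos r) (cond_pos q))).
  simpl; intros h Hh.
  apply (is_pseries_plus (PS_scal c1 a) (PS_scal c2 b) h);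
    (apply (is_pseries_scal (V := R_NormedModule)); [apply Rmult_comm |]).
  - apply Hr. eapply Rlt_le_trans; [exact Hh | apply Rmin_l].
  - apply Hq. eapply Rlt_le_trans; [exact Hh | apply Rmin_r].
Qed.

(** Summation by total degree turns the double series at [(s h, s k)] into a power series in [s].
    The radius is divided by a bound [m] for [|h|] and [|k|], made positive by adding 1. *)
Lemma analytic_line f x y h k : analytic f ->
  analytic1 (fun t => f (x + t * h) (y + t * k)).
Proof.
  intros Hf t. destruct (Hf (x + t * h) (y + t * k)) as [c [r Hc]].
  set (m := 1 + Rabs h + Rabs k).
  assert (Ph := Rabs_pos h). assert (Pk := Rabs_pos k).
  assert (M0 : 0 < m) by (unfold m; lra).
  assert (R0 := cond_pos r).
  exists (fun n => sum_f_R0 (fun i => c i (n - i)%nat * h ^ i * k ^ (n - i)) n).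
  exists (mkposreal (r / m) (Rdiv_lt_0_compat _ _ R0 M0)). simpl; intros s Hs.
  assert (Hs' : Rabs s * m < r).
  { apply (Rmult_lt_compat_r m) in Hs; [|exact M0].
    unfold Rdiv in Hs. rewrite Rmult_assoc, Rinv_l, Rmult_1_r in Hs by lra. exact Hs. }
  assert (Ps := Rabs_pos s).
  assert (B1 : Rabs (s * h) < r) by (rewrite Rabs_mult; unfold m in Hs'; nra).
  assert (B2 : Rabs (s * k) < r) by (rewrite Rabs_mult; unfold m in Hs'; nra).
  destruct (Hc _ _ B1 B2) as [_ Q].
  replace (x + (t + s) * h) with (x + t * h + s * h) by ring.
  replace (y + (t + s) * k) with (y + t * k + s * k) by ring.
  apply is_pseries_R. revert Q. apply is_series_ext. intros n.
  rewrite (Rmult_comm _ (s ^ n)), scal_sum. apply sum_eq. intros i Hi.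
  rewrite !Rpow_mult_distr.
  replace (s ^ n) with (s ^ i * s ^ (n - i)) by (rewrite <- pow_add; f_equal; lia).
  ring.
Qed.

(** * Coefficient bounds and termwise differentiation of double power series *)

Definition homog (c : nat -> nat -> R) (h k : R) (n : nat) : R :=
  sum_f_R0 (fun i => c i (n - i)%nat * h ^ i * k ^ (n - i)) n.

(** Absorbs the number [n + 1] of monomials of degree [n], or the factor produced by a derivative,
    into a doubled geometric ratio. *)
Lemma INR_S_le_pow2 n : INR (S n) <= 2 ^ n.
Proof.
  induction n as [|n IH]; [simpl; lra|].
  rewrite S_INR. change (2 ^ S n) with (2 * 2 ^ n). assert (1 <= 2 ^ n) by (apply pow_R1_Rle; lra). lra.
Qed.

Lemma homog_abs_le c B K t h k n :
  (forall i j, Rabs (c i j) <= B * K ^ (i + j)) -> 0 <= K ->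
  Rabs h <= t -> Rabs k <= t ->
  sum_f_R0 (fun i => Rabs (c i (n - i)%nat * h ^ i * k ^ (n - i))) n
  <= B * (2 * K * t) ^ n.
Proof.
  intros Hc K0 Hh Hk.
  assert (t0 : 0 <= t) by (generalize (Rabs_pos h); lra).
  assert (B0 : 0 <= B).
  { generalize (Rabs_pos (c 0%nat 0%nat)) (Hc 0%nat 0%nat). simpl. lra. }
  apply Rle_trans with (sum_f_R0 (fun _ => B * (K * t) ^ n) n).
  - apply sum_Rle. intros i Hi.
    rewrite !Rabs_mult, <- !RPow_abs.
    apply Rle_trans with (B * K ^ n * t ^ i * t ^ (n - i)).
    + apply Rmult_le_compat; try apply pow_le; try apply Rabs_pos.
      * apply Rmult_le_pos; [apply Rabs_pos | apply pow_le, Rabs_pos].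
      * apply Rmult_le_compat; try apply pow_le; try apply Rabs_pos.
        -- replace n with (i + (n - i))%nat at 2 by lia. apply Hc.
        -- apply pow_incr. split; [apply Rabs_pos | exact Hh].
      * apply pow_incr. split; [apply Rabs_pos | exact Hk].
    + apply Req_le. rewrite Rpow_mult_distr.
      replace (t ^ n) with (t ^ i * t ^ (n - i)) by (rewrite <- pow_add; f_equal; lia).
      ring.
  - rewrite sum_cte. replace (2 * K * t) with (2 * (K * t)) by ring.
    rewrite (Rpow_mult_distr 2).
    assert (P := INR_S_le_pow2 n).
    assert (Q : 0 <= B * (K * t) ^ n).
    { apply Rmult_le_pos; [exact B0 | apply pow_le, Rmult_le_pos; assumption]. }
    replace (B * (2 ^ n * (K * t) ^ n)) with (B * (K * t) ^ n * 2 ^ n) by ring.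
    apply Rmult_le_compat_l; assumption.
Qed.

Lemma homog_le c B K t h k n :
  (forall i j, Rabs (c i j) <= B * K ^ (i + j)) -> 0 <= K ->
  Rabs h <= t -> Rabs k <= t -> Rabs (homog c h k n) <= B * (2 * K * t) ^ n.
Proof.
  intros Hc K0 Hh Hk. unfold homog.
  eapply Rle_trans; [apply Rsum_abs | apply homog_abs_le; assumption].
Qed.

(** The increments telescope: partial sums at [N] and [N + m] differ by at most
    [C / 2 ^ N - C / 2 ^ (N + m)]. *)
Lemma series_tail_le (u : nat -> R) l C N : is_series u l ->
  (forall n, (N < n)%nat -> Rabs (u n) <= C / 2 ^ n) ->
  Rabs (l - sum_f_R0 u N) <= C / 2 ^ N.
Proof.
  intros Hl Hu.
  assert (C0 : 0 <= C).
  { assert (H := Hu (S N) (Nat.lt_succ_diag_r N)).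
    assert (P := Rabs_pos (u (S N))). assert (Q : 0 < 2 ^ S N) by (apply pow_lt; lra).
    apply (Rmult_le_reg_r (/ 2 ^ S N)); [apply Rinv_0_lt_compat, Q |].
    rewrite Rmult_0_l. unfold Rdiv in H. lra. }
  assert (S : forall m, Rabs (sum_f_R0 u (N + m) - sum_f_R0 u N)
                         <= C / 2 ^ N - C / 2 ^ (N + m)).
  { induction m as [|m IH].
    - rewrite Nat.add_0_r, !Rminus_diag, Rabs_R0. lra.
    - rewrite Nat.add_succ_r. simpl sum_f_R0.
      assert (Hm := Hu (S (N + m)) ltac:(lia)).
      replace (sum_f_R0 u (N + m) + u (S (N + m)) - sum_f_R0 u N)
        with ((sum_f_R0 u (N + m) - sum_f_R0 u N) + u (S (N + m))) by ring.
      eapply Rle_trans; [apply Rabs_triang |].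
      assert (Q : C / 2 ^ (N + m) = 2 * (C / 2 ^ S (N + m))).
      { simpl. field. apply pow_nonzero; lra. }
      lra. }
  apply le_epsilon. intros eps He.
  apply is_series_Reals in Hl. destruct (Hl eps He) as [M HM].
  specialize (HM (N + M)%nat ltac:(lia)). unfold Rdist in HM.
  specialize (S M).
  assert (0 <= C / 2 ^ (N + M)).
  { apply Rmult_le_pos; [exact C0 | apply Rlt_le, Rinv_0_lt_compat, pow_lt; lra]. }
  replace (l - sum_f_R0 u N) with
    (- (sum_f_R0 u (N + M) - l) + (sum_f_R0 u (N + M) - sum_f_R0 u N)) by ring.
  eapply Rle_trans; [apply Rabs_triang |]. rewrite Rabs_Ropp. lra.
Qed.

Lemma pow_half_eq n : (1 / 2) ^ n = 1 / 2 ^ n.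
Proof. unfold Rdiv. rewrite !Rmult_1_l. apply pow_inv. Qed.

(** Keeps one factor [q] apart from the geometric decay, so that the tail of the series is small
    together with the increment. *)
Lemma pow_small_le q n : 0 <= q <= 1 / 2 -> (0 < n)%nat -> q ^ n <= 2 * q / 2 ^ n.
Proof.
  intros Hq Hn. destruct n as [|n]; [lia|]. simpl.
  replace (2 * q / (2 * 2 ^ n)) with (q * (1 / 2 ^ n)) by (field; apply pow_nonzero; lra).
  rewrite <- pow_half_eq.
  apply Rmult_le_compat_l; [lra | apply pow_incr; lra].
Qed.

(** Cauchy estimates: each coefficient occurs in a homogeneous part of the absolutely convergent
    series at [h = k = r / 2], whose terms are bounded, hence [K = 2 / r]. Such bounds replace
    absolute convergence below because they are stable under differentiation. *)
Lemma analytic_at_coef_bound f x0 y0 : analytic_at f x0 y0 ->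
  exists (c : nat -> nat -> R) (B K : R) (r : posreal),
    0 < B /\ 0 < K /\ (forall i j, Rabs (c i j) <= B * K ^ (i + j)) /\
    forall h k, Rabs h < r -> Rabs k < r ->
      is_series (homog c h k) (f (x0 + h) (y0 + k)).
Proof.
  intros [c [r Hr]]. assert (R0 := cond_pos r).
  assert (A : Rabs (r / 2) < r) by (rewrite Rabs_right; lra).
  destruct (ex_series_bounded _ (proj1 (Hr _ _ A A))) as [M [M0 HM]].
  exists c, M, (2 / r), r. split; [exact M0|]. split; [apply Rdiv_lt_0_compat; lra|].
  split; [|intros h k Hh Hk; exact (proj2 (Hr h k Hh Hk))].
  intros i j. specialize (HM (i + j)%nat).
  set (w := fun p => Rabs (c p (i + j - p)%nat * (r / 2) ^ p * (r / 2) ^ (i + j - p))) in *.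
  assert (T : w i <= sum_f_R0 w (i + j)).
  { assert (G : forall n, (i <= n)%nat -> w i <= sum_f_R0 w n).
    { induction n as [|n IH]; intros Hi.
      - replace i with 0%nat by lia. simpl. lra.
      - simpl. destruct (Nat.eq_dec i (S n)) as [-> | Ne].
        + assert (0 <= sum_f_R0 w n) by (apply cond_pos_sum; intros; apply Rabs_pos). lra.
        + assert (0 <= w (S n)) by apply Rabs_pos. specialize (IH ltac:(lia)). lra. }
    apply G; lia. }
  assert (T' := Rle_trans _ _ _ T (Rle_trans _ _ _ (Rle_abs _) HM)).
  unfold w in T'. replace (i + j - i)%nat with j in T' by lia.
  assert (P : 0 < (r / 2) ^ (i + j)) by (apply pow_lt; lra).
  apply (Rmult_le_reg_r ((r / 2) ^ (i + j))); [exact P|].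
  replace (M * (2 / r) ^ (i + j) * (r / 2) ^ (i + j)) with M.
  - rewrite <- (Rabs_right ((r / 2) ^ (i + j))) at 1 by lra. rewrite <- Rabs_mult.
    rewrite pow_add, <- Rmult_assoc. exact T'.
  - rewrite Rmult_assoc, <- Rpow_mult_distr.
    replace (2 / r * (r / 2)) with 1 by (field; lra). rewrite pow1. ring.
Qed.

(** For increments below [1 / (4 K)] the absolute homogeneous parts are at most [B / 2 ^ n], which
    restores absolute convergence. *)
Lemma analytic_at_intro f x0 y0 c B K (r : posreal) :
  0 < K -> (forall i j, Rabs (c i j) <= B * K ^ (i + j)) ->
  (forall h k, Rabs h < r -> Rabs k < r ->
      is_series (homog c h k) (f (x0 + h) (y0 + k))) ->
  analytic_at f x0 y0.
Proof.
  intros K0 Hc Hs.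
  assert (Q0 : 0 < 1 / (4 * K)) by (apply Rdiv_lt_0_compat; lra).
  exists c, (mkposreal _ (Rmin_glb_lt _ _ _ (cond_pos r) Q0)). simpl. intros h k Hh Hk.
  assert (h1 := Rlt_le_trans _ _ _ Hh (Rmin_l _ _)).
  assert (h2 := Rlt_le_trans _ _ _ Hh (Rmin_r _ _)).
  assert (k1 := Rlt_le_trans _ _ _ Hk (Rmin_l _ _)).
  assert (k2 := Rlt_le_trans _ _ _ Hk (Rmin_r _ _)).
  split; [|exact (Hs h k h1 k1)].
  apply (ex_series_le (V := R_CompleteNormedModule)) with (b := fun n => B * (1 / 2) ^ n).
  - intros n. unfold norm; simpl. unfold abs; simpl.
    rewrite Rabs_right.
    + eapply Rle_trans;
        [apply (homog_abs_le c B K (1 / (4 * K))); try assumption; lra |].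
      replace (2 * K * (1 / (4 * K))) with (1 / 2) by (field; lra). lra.
    + apply Rle_ge, cond_pos_sum. intros; apply Rabs_pos.
  - apply (ex_series_scal (V := R_NormedModule) B (fun n => (1 / 2) ^ n)), ex_series_geom.
    rewrite Rabs_right; lra.
Qed.

(** All terms but the constant coefficient add up to at most [4 B K t] when both increments are
    bounded by [t <= 1 / (4 K)]. *)
Lemma analytic_continuous f : analytic f -> forall x y, continuity_2d_pt f x y.
Proof.
  intros Hf x y.
  destruct (analytic_at_coef_bound f x y (Hf x y)) as [c [B [K [r [B0 [K0 [Hc Hs]]]]]]].
  assert (Q0 : 0 < 1 / (4 * K)) by (apply Rdiv_lt_0_compat; lra).
  assert (E : forall t h k, 0 <= t -> t <= 1 / (4 * K) -> Rabs h <= t -> Rabs k <= t ->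
    Rabs h < r -> Rabs k < r ->
    Rabs (f (x + h) (y + k) - c 0%nat 0%nat) <= 4 * B * K * t).
  { intros t h k t0 t1 h0 k0 h1 k1.
    assert (T := series_tail_le _ _ (4 * B * K * t) 0 (Hs h k h1 k1)).
    assert (Z : sum_f_R0 (homog c h k) 0 = c 0%nat 0%nat)
      by (unfold homog; simpl; ring).
    rewrite Z in T. simpl in T. rewrite Rdiv_1_r in T.
    apply T. intros n Hn. eapply Rle_trans; [apply (homog_le c B K t); auto; lra |].
    replace (4 * B * K * t / 2 ^ n) with (B * (2 * (2 * K * t) / 2 ^ n))
      by (unfold Rdiv; ring).
    apply Rmult_le_compat_l; [lra|]. apply pow_small_le; [|exact Hn].
    split; [apply Rmult_le_pos; nra |].
    apply (Rmult_le_compat_l (2 * K)) in t1; [|lra].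
    replace (2 * K * (1 / (4 * K))) with (1 / 2) in t1 by (field; lra). exact t1. }
  assert (E0 : f x y = c 0%nat 0%nat).
  { specialize (E 0 0 0). rewrite Rabs_R0, !Rplus_0_r in E.
    assert (R0 := cond_pos r).
    assert (L : Rabs (f x y - c 0%nat 0%nat) <= 4 * B * K * 0) by (apply E; lra).
    rewrite Rmult_0_r in L. assert (P := Rabs_pos (f x y - c 0%nat 0%nat)).
    apply Rminus_diag_uniq. apply NNPP; intros Ne. apply Rabs_pos_lt in Ne. lra. }
  intros eps. assert (P := cond_pos eps).
  assert (BK : 0 < 4 * B * K) by (apply Rmult_lt_0_compat; lra).
  set (m := Rmin r (Rmin (1 / (4 * K)) (eps / (2 * (4 * B * K))))).
  assert (M0 : 0 < m).
  { apply Rmin_glb_lt; [apply cond_pos|]. apply Rmin_glb_lt; [exact Q0|].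
    apply Rdiv_lt_0_compat; lra. }
  assert (M1 : m <= r) by apply Rmin_l.
  assert (M2 : m <= 1 / (4 * K)) by (eapply Rle_trans; [apply Rmin_r | apply Rmin_l]).
  assert (M3 : m <= eps / (2 * (4 * B * K)))
    by (eapply Rle_trans; [apply Rmin_r | apply Rmin_r]).
  exists (mkposreal m M0). simpl. intros u v Hu Hv.
  specialize (E m (u - x) (v - y)).
  replace (x + (u - x)) with u in E by ring. replace (y + (v - y)) with v in E by ring.
  rewrite E0. eapply Rle_lt_trans; [apply E; lra |].
  apply (Rmult_le_compat_l (4 * B * K)) in M3; [|lra].
  replace (4 * B * K * (eps / (2 * (4 * B * K)))) with (eps / 2) in M3 by (field; lra).
  lra.
Qed.

(** The coefficients of the partial derivative in the first variable. *)
Definition shift_coef (c : nat -> nat -> R) (i j : nat) : R := INR (S i) * c (S i) j.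

(** The index shift costs one factor [K], and the factor [i + 1 <= 2 ^ (i + j)] doubles the
    ratio. *)
Lemma shift_coef_bound c B K : 0 < B -> 0 < K ->
  (forall i j, Rabs (c i j) <= B * K ^ (i + j)) ->
  forall i j, Rabs (shift_coef c i j) <= B * K * (2 * K) ^ (i + j).
Proof.
  intros B0 K0 Hc i j. unfold shift_coef. rewrite Rabs_mult.
  rewrite (Rabs_right (INR (S i))) by (apply Rle_ge, pos_INR).
  specialize (Hc (S i) j). simpl in Hc. rewrite Rpow_mult_distr.
  assert (P : 0 < K ^ (i + j)) by (apply pow_lt; exact K0).
  assert (I : INR (S i) <= 2 ^ (i + j)).
  { eapply Rle_trans; [apply INR_S_le_pow2 | apply Rle_pow; [lra | lia]]. }
  replace (B * K * (2 ^ (i + j) * K ^ (i + j)))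
    with (2 ^ (i + j) * (B * (K * K ^ (i + j)))) by ring.
  apply Rmult_le_compat; auto; [apply pos_INR | apply Rabs_pos].
Qed.

Lemma derivable_homog c k n h :
  derivable_pt_lim (fun h => homog c h k (S n)) h (homog (shift_coef c) h k n).
Proof.
  apply is_derive_Reals.
  apply (is_derive_ext (fun h => c 0%nat (S n) * k ^ S n
    + sum_f_R0 (fun i => c (S i) (n - i)%nat * h ^ S i * k ^ (n - i)) n)).
  { intros t. unfold homog. rewrite (decomp_sum _ (S n)) by lia. simpl pred.
    simpl Nat.sub. simpl (t ^ 0). ring_simplify. f_equal. }
  replace (homog (shift_coef c) h k n) with (0 + homog (shift_coef c) h k n) by ring.
  apply (is_derive_plus (V := R_NormedModule)); [apply (is_derive_const (V := R_NormedModule))|].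
  unfold homog.
  assert (G : forall m, is_derive
    (fun h => sum_f_R0 (fun i => c (S i) (n - i)%nat * h ^ S i * k ^ (n - i)) m) h
    (sum_f_R0 (fun i => shift_coef c i (n - i) * h ^ i * k ^ (n - i)) m)).
  { assert (T : forall i, is_derive (fun h => c (S i) (n - i)%nat * h ^ S i * k ^ (n - i)) h
      (shift_coef c i (n - i) * h ^ i * k ^ (n - i))).
    { intros i.
      replace (shift_coef c i (n - i) * h ^ i * k ^ (n - i))
        with (c (S i) (n - i)%nat * (INR (S i) * h ^ i) * k ^ (n - i))
        by (unfold shift_coef; ring).
      apply is_derive_Reals.
      apply (derivable_pt_lim_scal_right (fun t => c (S i) (n - i)%nat * t ^ S i)).
      apply (derivable_pt_lim_scal (fun t => t ^ S i)), derivable_pt_lim_pow. }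
    induction m as [|m IH]; simpl sum_f_R0.
    - apply T.
    - apply (is_derive_plus (V := R_NormedModule) _ _ h _ _ IH (T (S m))). }
  apply G.
Qed.

(** The differentiated partial sums converge uniformly, so the limit may be differentiated termwise.
    One statement yields both the existence of the derivative and its expansion, and it keeps the
    coefficient bounds needed for analyticity of [D1 f]. *)
Lemma analytic_derivative1 f x0 y0 : analytic_at f x0 y0 ->
  exists (c : nat -> nat -> R) (B K : R) (r : posreal),
    0 < K /\ (forall i j, Rabs (c i j) <= B * K ^ (i + j)) /\
    forall h k, Rabs h < r -> Rabs k < r ->
      exists l, is_series (homog c h k) l /\
        is_derive (fun t => f t (y0 + k)) (x0 + h) l.
Proof.
  intros Hf.
  destruct (analytic_at_coef_bound f x0 y0 Hf) as [c [B [K [r [B0 [K0 [Hc Hs]]]]]]].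
  set (c' := shift_coef c).
  assert (Hc' := shift_coef_bound c B K B0 K0 Hc). fold c' in Hc'.
  (* The derived coefficients grow with ratio [2 K], and [2 (2 K) / (8 K) = 1 / 2]. *)
  assert (Q0 : 0 < 1 / (8 * K)) by (apply Rdiv_lt_0_compat; lra).
  set (rho := mkposreal _ (Rmin_glb_lt _ _ _ (cond_pos r) Q0)).
  assert (R1 : rho <= r) by apply Rmin_l.
  assert (R2 : rho <= 1 / (8 * K)) by apply Rmin_r.
  exists c', (B * K), (2 * K), rho. split; [lra|]. split; [exact Hc'|].
  intros h k Hh Hk.
  assert (Bd : forall u n, Rabs u < rho -> Rabs (homog c' u k n) <= B * K / 2 ^ n).
  { intros u n Hu. eapply Rle_trans.
    - apply (homog_le c' (B * K) (2 * K) (1 / (8 * K))); try exact Hc'; lra.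
    - replace (2 * (2 * K) * (1 / (8 * K))) with (1 / 2) by (field; lra).
      rewrite pow_half_eq. unfold Rdiv. rewrite Rmult_1_l. apply Rle_refl. }
  assert (Ex : forall u, Rabs u < rho -> is_series (homog c' u k) (Series (homog c' u k))).
  { intros u Hu. apply Series_correct.
    apply (ex_series_le (V := R_CompleteNormedModule)) with (b := fun n => B * K * (1 / 2) ^ n).
    - intros n. rewrite pow_half_eq. unfold Rdiv. rewrite Rmult_1_l. apply (Bd u n Hu).
    - apply (ex_series_scal (V := R_NormedModule) (B * K) (fun n => (1 / 2) ^ n)), ex_series_geom.
      rewrite Rabs_right; lra. }
  exists (Series (homog c' h k)). split; [exact (Ex h Hh)|].
  assert (Bo : forall u, Boule 0 rho u -> Rabs u < rho).
  { intros u Hu. unfold Boule in Hu. rewrite Rminus_0_r in Hu. exact Hu. }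
  assert (CV : CVU (fun N u => sum_f_R0 (homog c' u k) N) (fun u => Series (homog c' u k)) 0 rho).
  { intros eps He.
    assert (BK : 0 < B * K) by (apply Rmult_lt_0_compat; lra).
    destruct (pow_lt_1_zero (1 / 2) ltac:(rewrite Rabs_right; lra) (eps / (B * K))
      (Rdiv_lt_0_compat _ _ He BK)) as [N HN].
    exists N. intros n u Hn Hu.
    eapply Rle_lt_trans;
      [apply (series_tail_le _ _ (B * K) n (Ex u (Bo u Hu))); intros; apply Bd, Bo, Hu |].
    specialize (HN n Hn). rewrite pow_half_eq in HN.
    apply Rabs_def2 in HN. destruct HN as [HN _].
    apply (Rmult_lt_compat_l (B * K)) in HN; [|exact BK].
    replace (B * K * (eps / (B * K))) with eps in HN by (field; lra).
    unfold Rdiv in *. rewrite Rmult_1_l in HN. exact HN. }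
  (* Differentiation lowers the degree by one, so the sum up to degree [S m] is paired with the
     derived sum up to [m]. *)
  assert (Dh : forall d m u, derivable_pt_lim (fun u => sum_f_R0 (homog d u k) (S m)) u
    (sum_f_R0 (homog (shift_coef d) u k) m)).
  { intros d m u. induction m as [|m IH].
    - simpl. replace (homog (shift_coef d) u k 0) with (0 + homog (shift_coef d) u k 0) by ring.
      apply (derivable_pt_lim_plus (fun u => homog d u k 0) (fun u => homog d u k 1)).
      + apply is_derive_Reals, (is_derive_ext (fun _ => d 0%nat 0%nat)).
        * intros t. unfold homog. simpl. symmetry. ring.
        * apply (is_derive_const (V := R_NormedModule)).
      + apply derivable_homog.
    - apply (derivable_pt_lim_plus (fun u => sum_f_R0 (homog d u k) (S m))
        (fun u => homog d u k (S (S m)))); [exact IH | apply derivable_homog]. }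
  assert (L : derivable_pt_lim (fun u => f (x0 + u) (y0 + k)) h (Series (homog c' h k))).
  { apply (derivable_pt_lim_CVU (fun N u => sum_f_R0 (homog c u k) (S N))
      (fun N u => sum_f_R0 (homog c' u k) N) (fun u => f (x0 + u) (y0 + k))
      (fun u => Series (homog c' u k)) h 0 rho).
    - unfold Boule. rewrite Rminus_0_r. exact Hh.
    - intros u n _. apply Dh.
    - intros u Hu. apply Bo in Hu.
      assert (S := Hs u k ltac:(lra) ltac:(lra)). apply is_series_Reals in S.
      intros eps He. destruct (S eps He) as [N HN]. exists N. intros n Hn.
      apply HN. lia.
    - exact CV.
    - intros u Hu. apply (CVU_continuity _ _ _ _ CV); [|exact Hu].
      intros n v _. destruct n as [|n].
      + apply (continuity_pt_ext (fun _ => c' 0%nat 0%nat)).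
        * intros t. unfold homog. simpl. ring.
        * apply continuity_pt_const. intros ? ?; reflexivity.
      + apply derivable_continuous_pt. eexists. apply (Dh c' n v). }
  apply is_derive_Reals in L.
  apply (is_derive_ext (fun t => (fun u => f (x0 + u) (y0 + k)) (t - x0))).
  { intros t. simpl. f_equal. ring. }
  replace (Series (homog c' h k)) with (1 * Series (homog c' h k)) by ring.
  apply (is_derive_comp (fun u => f (x0 + u) (y0 + k)) (fun t => t - x0)).
  - replace (x0 + h - x0) with h by ring. exact L.
  - auto_derive; [exact I | ring].
Qed.

Lemma analytic_ex1 f : analytic f -> forall x y, ex_derive (fun t => f t y) x.
Proof.
  intros Hf x y.
  destruct (analytic_derivative1 f x y (Hf x y)) as [c [B [K [r [K0 [Hc H]]]]]].
  destruct (H 0 0) as [l [_ Hl]]; try (rewrite Rabs_R0; apply cond_pos).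
  rewrite !Rplus_0_r in Hl. exists l; exact Hl.
Qed.

Lemma analytic_D1 f : analytic f -> analytic (D1 f).
Proof.
  intros Hf x y.
  destruct (analytic_derivative1 f x y (Hf x y)) as [c [B [K [r [K0 [Hc H]]]]]].
  apply (analytic_at_intro (D1 f) x y c B K r K0 Hc).
  intros h k Hh Hk. destruct (H h k Hh Hk) as [l [Hl Hd]].
  replace (D1 f (x + h) (y + k)) with l; [exact Hl|].
  symmetry. exact (is_derive_unique _ _ _ Hd).
Qed.

Lemma sum_f_R0_rev (g : nat -> R) n :
  sum_f_R0 (fun i => g (n - i)%nat) n = sum_f_R0 g n.
Proof.
  induction n as [|n IH]; [reflexivity|].
  rewrite decomp_sum by lia. simpl pred. simpl Nat.sub.
  change (sum_f_R0 g (S n)) with (sum_f_R0 g n + g (S n)).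
  rewrite <- IH. ring.
Qed.

(** Carries what was proved for the first partial derivative over to the second. *)
Lemma analytic_swap f : analytic f -> analytic (fun x y => f y x).
Proof.
  intros Hf x y. destruct (Hf y x) as [c [r H]].
  exists (fun i j => c j i), r. intros h k Hh Hk. destruct (H k h Hk Hh) as [H1 H2].
  split.
  - revert H1. apply ex_series_ext. intros n.
    rewrite <- sum_f_R0_rev. apply sum_eq. intros i Hi.
    replace (n - (n - i))%nat with i by lia. f_equal. ring.
  - revert H2. apply is_series_ext. intros n.
    rewrite <- sum_f_R0_rev. apply sum_eq. intros i Hi.
    replace (n - (n - i))%nat with i by lia. ring.
Qed.

Lemma analytic_ex2 f : analytic f -> forall x y, ex_derive (fun t => f x t) y.
Proof. intros Hf x y. exact (analytic_ex1 _ (analytic_swap f Hf) y x). Qed.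

Lemma analytic_D2 f : analytic f -> analytic (D2 f).
Proof. intros Hf. exact (analytic_swap _ (analytic_D1 _ (analytic_swap f Hf))). Qed.

Lemma analytic_smooth f : analytic f -> smooth f.
Proof.
  intros Hf n; revert f Hf; induction n as [|n IH]; intros f Hf x y.
  - split; [apply analytic_continuous, Hf | exact I].
  - split; [apply analytic_continuous, Hf|].
    split; [apply analytic_ex1, Hf|]. split; [apply analytic_ex2, Hf|].
    split; [exact (IH _ (analytic_D1 f Hf) x y) | exact (IH _ (analytic_D2 f Hf) x y)].
Qed.

(** * The chain of equations at null momenta *)

Definition csmooth (g : R -> R -> C) : Prop :=
  smooth (fun x y => fst (g x y)) /\ smooth (fun x y => snd (g x y)).
Definition cperiodic (G : R -> R -> Prop) (g : R -> R -> C) : Prop :=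
  periodic G (fun x y => fst (g x y)) /\ periodic G (fun x y => snd (g x y)).
Definition CD1 (g : R -> R -> C) (x y : R) : C :=
  (D1 (fun x y => fst (g x y)) x y, D1 (fun x y => snd (g x y)) x y).
Definition CD2 (g : R -> R -> C) (x y : R) : C :=
  (D2 (fun x y => fst (g x y)) x y, D2 (fun x y => snd (g x y)) x y).
(** Twice the Wirtinger derivative [d/dz]. *)
Definition DZ (g : R -> R -> C) (x y : R) : C := (CD1 g x y - Ci * CD2 g x y)%C.

Lemma csmooth_const c : csmooth (fun _ _ => c).
Proof. split; apply smooth_const. Qed.

Lemma csmooth_RtoC f : smooth f -> csmooth (fun x y => RtoC (f x y)).
Proof. intros Hf; split; [exact Hf | exact (smooth_const 0)]. Qed.

Lemma csmooth_plus g h : csmooth g -> csmooth h ->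
  csmooth (fun x y => (g x y + h x y)%C).
Proof. intros [] []; split; simpl; auto with smooth. Qed.

Lemma csmooth_minus g h : csmooth g -> csmooth h ->
  csmooth (fun x y => (g x y - h x y)%C).
Proof. intros [] []; split; simpl; auto with smooth. Qed.

Lemma csmooth_mult g h : csmooth g -> csmooth h ->
  csmooth (fun x y => (g x y * h x y)%C).
Proof. intros [] []; split; simpl; auto with smooth. Qed.

Lemma cperiodic_const G c : cperiodic G (fun _ _ => c).
Proof. split; apply periodic_const. Qed.

Lemma cperiodic_RtoC G f : periodic G f -> cperiodic G (fun x y => RtoC (f x y)).
Proof. intros Hf; split; [exact Hf | exact (periodic_const G 0)]. Qed.

Lemma cperiodic_plus G g h : cperiodic G g -> cperiodic G h ->
  cperiodic G (fun x y => (g x y + h x y)%C).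
Proof. intros [] []; split; simpl; auto with smooth. Qed.

Lemma cperiodic_minus G g h : cperiodic G g -> cperiodic G h ->
  cperiodic G (fun x y => (g x y - h x y)%C).
Proof. intros [] []; split; simpl; auto with smooth. Qed.

Lemma cperiodic_mult G g h : cperiodic G g -> cperiodic G h ->
  cperiodic G (fun x y => (g x y * h x y)%C).
Proof. intros [] []; split; simpl; auto with smooth. Qed.

Global Hint Resolve csmooth_const csmooth_RtoC csmooth_plus csmooth_minus csmooth_mult
  cperiodic_const cperiodic_RtoC cperiodic_plus cperiodic_minus cperiodic_mult : smooth.

Lemma CD1_const c x y : CD1 (fun _ _ => c) x y = 0%C.
Proof. unfold CD1. rewrite !D1_const. reflexivity. Qed.

Lemma CD2_const c x y : CD2 (fun _ _ => c) x y = 0%C.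
Proof. unfold CD2. rewrite !D2_const. reflexivity. Qed.

Lemma CD1_RtoC f x y : CD1 (fun x y => RtoC (f x y)) x y = RtoC (D1 f x y).
Proof. unfold CD1; simpl. rewrite D1_const. reflexivity. Qed.

Lemma CD2_RtoC f x y : CD2 (fun x y => RtoC (f x y)) x y = RtoC (D2 f x y).
Proof. unfold CD2; simpl. rewrite D2_const. reflexivity. Qed.

Lemma CD1_plus g h x y : csmooth g -> csmooth h ->
  CD1 (fun x y => (g x y + h x y)%C) x y = (CD1 g x y + CD1 h x y)%C.
Proof. intros [] []. unfold CD1; simpl. rewrite !D1_plus by assumption. reflexivity. Qed.

Lemma CD2_plus g h x y : csmooth g -> csmooth h ->
  CD2 (fun x y => (g x y + h x y)%C) x y = (CD2 g x y + CD2 h x y)%C.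
Proof. intros [] []. unfold CD2; simpl. rewrite !D2_plus by assumption. reflexivity. Qed.

Lemma CD1_minus g h x y : csmooth g -> csmooth h ->
  CD1 (fun x y => (g x y - h x y)%C) x y = (CD1 g x y - CD1 h x y)%C.
Proof.
  intros [] []. unfold CD1; simpl.
  rewrite !D1_plus, !D1_opp by auto with smooth. reflexivity.
Qed.

Lemma CD2_minus g h x y : csmooth g -> csmooth h ->
  CD2 (fun x y => (g x y - h x y)%C) x y = (CD2 g x y - CD2 h x y)%C.
Proof.
  intros [] []. unfold CD2; simpl.
  rewrite !D2_plus, !D2_opp by auto with smooth. reflexivity.
Qed.

Lemma CD1_mult g h x y : csmooth g -> csmooth h ->
  CD1 (fun x y => (g x y * h x y)%C) x y
  = (CD1 g x y * h x y + g x y * CD1 h x y)%C.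
Proof.
  intros [] []. unfold CD1; simpl.
  rewrite D1_minus, D1_plus by auto with smooth.
  rewrite !D1_mult by assumption.
  unfold Cmult, Cplus; simpl. f_equal; ring.
Qed.

Lemma CD2_mult g h x y : csmooth g -> csmooth h ->
  CD2 (fun x y => (g x y * h x y)%C) x y
  = (CD2 g x y * h x y + g x y * CD2 h x y)%C.
Proof.
  intros [] []. unfold CD2; simpl.
  rewrite D2_minus, D2_plus by auto with smooth.
  rewrite !D2_mult by assumption.
  unfold Cmult, Cplus; simpl. f_equal; ring.
Qed.

Lemma DZ_const c x y : DZ (fun _ _ => c) x y = 0%C.
Proof. unfold DZ. rewrite CD1_const, CD2_const. ring. Qed.

Lemma DZ_plus g h x y : csmooth g -> csmooth h ->
  DZ (fun x y => (g x y + h x y)%C) x y = (DZ g x y + DZ h x y)%C.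
Proof. intros. unfold DZ. rewrite CD1_plus, CD2_plus by assumption. ring. Qed.

Lemma DZ_minus g h x y : csmooth g -> csmooth h ->
  DZ (fun x y => (g x y - h x y)%C) x y = (DZ g x y - DZ h x y)%C.
Proof. intros. unfold DZ. rewrite CD1_minus, CD2_minus by assumption. ring. Qed.

Lemma DZ_mult g h x y : csmooth g -> csmooth h ->
  DZ (fun x y => (g x y * h x y)%C) x y = (DZ g x y * h x y + g x y * DZ h x y)%C.
Proof. intros. unfold DZ. rewrite CD1_mult, CD2_mult by assumption. ring. Qed.

(** Liouville's theorem on the torus, for antiholomorphic functions. *)
Lemma DZ_zero_const G g : is_lattice G -> csmooth g -> cperiodic G g ->
  (forall x y, DZ g x y = 0%C) -> exists c, forall x y, g x y = c.
Proof.
  intros HG [S1 S2] [P1 P2] H. exists (g 0 0). intros x y.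
  destruct (cauchy_riemann_periodic_const G _ _ HG S1 S2 P1 P2) with x y as [E1 E2].
  - intros u v. specialize (H u v). apply (f_equal fst) in H. simpl in H. lra.
  - intros u v. specialize (H u v). apply (f_equal snd) in H. simpl in H. lra.
  - apply injective_projections; assumption.
Qed.

Section chain.
Local Open Scope C_scope.
(** Integers are spelled as sums of ones so that [ring] and [field] over [C] compute with them. *)
Notation two := (1 + 1).
Notation three := (1 + 1 + 1).
Notation four := (1 + 1 + 1 + 1).

(** The equations satisfied by the values [sum_k z ^ k * g_k] of an integral at
    the null momenta [p = z (1, - i)], where [H] vanishes. *)
Definition null_chain (Om : R -> R -> R) (g0 g1 g2 g3 g4 : R -> R -> C) : Prop :=
  (forall x y, DZ g0 x y = Ci * Om x y * g1 x y) /\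
  (forall x y, DZ g1 x y = two * (Ci * Om x y) * g2 x y) /\
  (forall x y, DZ g2 x y = three * (Ci * Om x y) * g3 x y) /\
  (forall x y, DZ g3 x y = four * (Ci * Om x y) * g4 x y) /\
  (forall x y, DZ g4 x y = 0).

(** A descending induction from [g4] to [g0]: subtracting from [g_k] the part of [P^(k)(u) / k!]
    already determined leaves a function with [DZ] zero, and its constant value is the next
    coefficient [c_k] of [P]. Powers of [u] are nested products, to which the product rule for [DZ]
    applies. *)
Lemma null_chain_polynomial G Om g0 g1 g2 g3 g4 u :
  is_lattice G ->
  csmooth g0 -> csmooth g1 -> csmooth g2 -> csmooth g3 -> csmooth g4 -> csmooth u ->
  cperiodic G g0 -> cperiodic G g1 -> cperiodic G g2 -> cperiodic G g3 ->
  cperiodic G g4 -> cperiodic G u ->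
  null_chain Om g0 g1 g2 g3 g4 -> (forall x y, DZ u x y = Ci * Om x y) ->
  exists c0 c1 c2 c3 c4 : C, forall x y,
    g4 x y = c4 /\
    g3 x y = four * c4 * u x y + c3 /\
    g2 x y = three * two * c4 * (u x y * u x y) + three * c3 * u x y + c2 /\
    g1 x y = four * c4 * (u x y * (u x y * u x y)) + three * c3 * (u x y * u x y)
             + two * c2 * u x y + c1 /\
    g0 x y = c4 * (u x y * (u x y * (u x y * u x y))) + c3 * (u x y * (u x y * u x y))
             + c2 * (u x y * u x y) + c1 * u x y + c0.
Proof.
  intros HG S0 S1 S2 S3 S4 Su P0 P1 P2 P3 P4 Pu [H0 [H1 [H2 [H3 H4]]]] Hu.
  destruct (DZ_zero_const G g4 HG S4 P4 H4) as [c4 E4].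
  destruct (DZ_zero_const G (fun x y => g3 x y - four * c4 * u x y) HG) as [c3 E3];
    [auto with smooth .. | |].
  { intros x y. rewrite DZ_minus, DZ_mult, DZ_const, H3, Hu, E4 by auto with smooth. ring. }
  assert (F3 : forall x y, g3 x y = four * c4 * u x y + c3).
  { intros x y. rewrite <- (E3 x y). ring. }
  destruct (DZ_zero_const G (fun x y => g2 x y
    - (three * two * c4 * (u x y * u x y) + three * c3 * u x y)) HG) as [c2 E2];
    [auto 10 with smooth .. | |].
  { intros x y. rewrite DZ_minus, DZ_plus, !DZ_mult, !DZ_const, H2, Hu, F3
      by auto 10 with smooth. ring. }
  assert (F2 : forall x y, g2 x y =
    three * two * c4 * (u x y * u x y) + three * c3 * u x y + c2).
  { intros x y. rewrite <- (E2 x y). ring. }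
  destruct (DZ_zero_const G (fun x y => g1 x y
    - (four * c4 * (u x y * (u x y * u x y)) + three * c3 * (u x y * u x y)
       + two * c2 * u x y)) HG) as [c1 E1];
    [auto 10 with smooth .. | |].
  { intros x y. rewrite DZ_minus, !DZ_plus, !DZ_mult, !DZ_const, H1, Hu, F2
      by auto 10 with smooth. ring. }
  assert (F1 : forall x y, g1 x y =
    four * c4 * (u x y * (u x y * u x y)) + three * c3 * (u x y * u x y)
       + two * c2 * u x y + c1).
  { intros x y. rewrite <- (E1 x y). ring. }
  destruct (DZ_zero_const G (fun x y => g0 x y
    - (c4 * (u x y * (u x y * (u x y * u x y))) + c3 * (u x y * (u x y * u x y))
             + c2 * (u x y * u x y) + c1 * u x y)) HG) as [c0 E0];
    [auto 10 with smooth .. | |].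
  { intros x y. rewrite DZ_minus, !DZ_plus, !DZ_mult, !DZ_const, H0, Hu, F1
      by auto 10 with smooth. ring. }
  exists c0, c1, c2, c3, c4. intros x y. repeat split; auto.
  rewrite <- (E0 x y). ring.
Qed.

Lemma C_nat_neq0 (r : R) (z : C) : z = RtoC r -> r <> 0%R -> z <> 0.
Proof. intros -> Hr E. apply Hr, RtoC_inj, E. Qed.

Lemma two_neq0 : two <> 0.
Proof. apply (C_nat_neq0 2); [rewrite <- !RtoC_plus; f_equal; ring | lra]. Qed.
Lemma three_neq0 : three <> 0.
Proof. apply (C_nat_neq0 3); [rewrite <- !RtoC_plus; f_equal; ring | lra]. Qed.
Lemma four_neq0 : four <> 0.
Proof. apply (C_nat_neq0 4); [rewrite <- !RtoC_plus; f_equal; ring | lra]. Qed.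

Lemma DZ_primitive g h Om (k c : C) : csmooth g -> k <> 0 -> c <> 0 ->
  (forall x y, DZ g x y = k * (Ci * RtoC (Om x y)) * h x y) -> (forall x y, h x y = c) ->
  forall x y, DZ (fun x y => / (k * c) * g x y) x y = Ci * Om x y.
Proof.
  intros Sg Hk Hc H Hh x y.
  rewrite DZ_mult, DZ_const, H, Hh by auto with smooth.
  field. split; assumption.
Qed.

Lemma null_chain_primitive G Om g0 g1 g2 g3 g4 :
  is_lattice G ->
  csmooth g0 -> csmooth g1 -> csmooth g2 -> csmooth g3 -> csmooth g4 ->
  cperiodic G g0 -> cperiodic G g1 -> cperiodic G g2 -> cperiodic G g3 ->
  cperiodic G g4 ->
  null_chain Om g0 g1 g2 g3 g4 ->
  (exists x y, g1 x y <> 0 \/ g2 x y <> 0 \/ g3 x y <> 0 \/ g4 x y <> 0) ->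
  exists u, csmooth u /\ cperiodic G u /\ forall x y, DZ u x y = Ci * Om x y.
Proof.
  intros HG S0 S1 S2 S3 S4 P0 P1 P2 P3 P4 [H0 [H1 [H2 [H3 H4]]]] Hne.
  assert (K : forall (k : C) g h (c : C), csmooth g -> cperiodic G g -> k <> 0 -> c <> 0 ->
    (forall x y, DZ g x y = k * (Ci * RtoC (Om x y)) * h x y) ->
    (forall x y, h x y = c) ->
    exists u, csmooth u /\ cperiodic G u /\ forall x y, DZ u x y = Ci * Om x y).
  { intros k g h c Sg Pg Hk Hc Hg Hh. exists (fun x y => / (k * c) * g x y).
    split; [auto with smooth|]. split; [auto with smooth|].
    exact (DZ_primitive g h Om k c Sg Hk Hc Hg Hh). }
  destruct (DZ_zero_const G g4 HG S4 P4 H4) as [c4 E4].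
  destruct (classic (c4 = 0)) as [-> | N4]; [|exact (K _ _ _ _ S3 P3 four_neq0 N4 H3 E4)].
  destruct (DZ_zero_const G g3 HG S3 P3) as [c3 E3].
  { intros x y. rewrite H3, E4. ring. }
  destruct (classic (c3 = 0)) as [-> | N3]; [|exact (K _ _ _ _ S2 P2 three_neq0 N3 H2 E3)].
  destruct (DZ_zero_const G g2 HG S2 P2) as [c2 E2].
  { intros x y. rewrite H2, E3. ring. }
  destruct (classic (c2 = 0)) as [-> | N2]; [|exact (K _ _ _ _ S1 P1 two_neq0 N2 H1 E2)].
  destruct (DZ_zero_const G g1 HG S1 P1) as [c1 E1].
  { intros x y. rewrite H1, E2. ring. }
  destruct (classic (c1 = 0)) as [-> | N1].
  - exfalso. destruct Hne as [x [y [A | [A | [A | A]]]]]; apply A; auto.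
  - apply (K 1 g0 g1 c1); auto.
    + intros Z. apply RtoC_inj in Z. lra.
    + intros x y. rewrite H0. ring.
Qed.

(** Differentiating [V g = 0] gives [DZ V * g + V * DZ g = 0], and one more factor [V] removes the
    first term. Carrying a multiplier [V] replaces restriction to the open set where [Om] is
    nonzero. *)
Lemma null_chain_vanishing V g h Om (k : C) : csmooth V -> csmooth g -> k <> 0 ->
  (forall x y, V x y * g x y = 0) ->
  (forall x y, DZ g x y = k * (Ci * RtoC (Om x y)) * h x y) ->
  forall x y, (V x y * V x y * Om x y) * h x y = 0.
Proof.
  intros SV Sg Hk Z Hg x y.
  assert (E : DZ (fun x y => V x y * g x y) x y = 0).
  { replace (fun x y => V x y * g x y) with (fun _ _ : R => RtoC 0).
    - apply DZ_const.
    - apply functional_extensionality; intros u. apply functional_extensionality; intros v.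
      symmetry; apply Z. }
  rewrite DZ_mult, Hg in E by assumption.
  assert (Ki : k * Ci <> 0).
  { apply Cmult_neq_0; [exact Hk|]. intros A. apply (f_equal snd) in A. simpl in A. lra. }
  assert (Q : (k * Ci) * ((V x y * V x y * Om x y) * h x y) = 0).
  { transitivity (V x y * (DZ V x y * g x y + V x y * (k * (Ci * RtoC (Om x y)) * h x y))
      - DZ V x y * (V x y * g x y)); [ring |].
    rewrite E, Z. ring. }
  apply NNPP; intros A. exact (Cmult_neq_0 _ _ Ki A Q).
Qed.

(** Ensures that [T] is not identically zero. If [g1] vanished everywhere, the chain would make
    [g2], [g3], [g4] vanish at a point where [Om] is nonzero; the polynomial formulas at that point
    then give [c4 = c3 = c2 = c1 = 0] in turn, so all [g_k] with [k >= 1] vanish identically. *)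
Lemma null_chain_g1_neq0 G Om g0 g1 g2 g3 g4 :
  is_lattice G -> smooth Om -> (exists x y, Om x y <> 0%R) ->
  csmooth g0 -> csmooth g1 -> csmooth g2 -> csmooth g3 -> csmooth g4 ->
  cperiodic G g0 -> cperiodic G g1 -> cperiodic G g2 -> cperiodic G g3 ->
  cperiodic G g4 ->
  null_chain Om g0 g1 g2 g3 g4 ->
  (exists x y, g1 x y <> 0 \/ g2 x y <> 0 \/ g3 x y <> 0 \/ g4 x y <> 0) ->
  exists x y, g1 x y <> 0.
Proof.
  intros HG SO [p [q Hpq]] S0 S1 S2 S3 S4 P0 P1 P2 P3 P4 Hch Hne.
  apply NNPP; intros N.
  assert (Z1 : forall x y, g1 x y = 0).
  { intros x y. apply NNPP; intros A. apply N. exists x, y; exact A. }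
  destruct (null_chain_primitive G Om g0 g1 g2 g3 g4) as [u [Su [Pu Hu]]]; auto.
  destruct (null_chain_polynomial G Om g0 g1 g2 g3 g4 u)
    as [c0 [c1 [c2 [c3 [c4 E]]]]]; auto.
  destruct Hch as [H0 [H1 [H2 [H3 H4]]]].
  assert (O : RtoC (Om p q) <> 0) by (intros A; apply Hpq, RtoC_inj, A).
  (* The shape [V * V * Om] that [null_chain_vanishing] produces from the multiplier [V = 1]. *)
  set (V2 := fun x y => 1 * 1 * RtoC (Om x y)).
  assert (SV2 : csmooth V2) by (unfold V2; auto with smooth).
  set (V3 := fun x y => V2 x y * V2 x y * RtoC (Om x y)).
  assert (SV3 : csmooth V3) by (unfold V3; auto with smooth).
  assert (Z2 : forall x y, V2 x y * g2 x y = 0).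
  { apply (null_chain_vanishing (fun _ _ => 1) g1 g2 Om two); auto with smooth.
    - exact two_neq0.
    - intros x y. rewrite Z1. ring. }
  assert (Z3 := null_chain_vanishing V2 g2 g3 Om three SV2 S2 three_neq0 Z2 H2).
  assert (Z4 := null_chain_vanishing V3 g3 g4 Om four SV3 S3 four_neq0 Z3 H3).
  assert (W2 : V2 p q <> 0) by (unfold V2; replace (1 * 1 * RtoC (Om p q))
    with (RtoC (Om p q)) by ring; exact O).
  assert (W3 : V3 p q <> 0) by exact (Cmult_neq_0 _ _ (Cmult_neq_0 _ _ W2 W2) O).
  assert (A2 : g2 p q = 0).
  { apply NNPP; intros A. exact (Cmult_neq_0 _ _ W2 A (Z2 p q)). }
  assert (A3 : g3 p q = 0).
  { apply NNPP; intros A. exact (Cmult_neq_0 _ _ W3 A (Z3 p q)). }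
  assert (A4 : g4 p q = 0).
  { apply NNPP; intros A. exact (Cmult_neq_0 _ _
    (Cmult_neq_0 _ _ (Cmult_neq_0 _ _ W3 W3) O) A (Z4 p q)). }
  destruct (E p q) as [E4 [E3 [E2 [E1 _]]]].
  rewrite A4 in E4. rewrite A3, <- E4 in E3.
  assert (C3 : c3 = 0) by (etransitivity; [|symmetry; exact E3]; ring).
  rewrite A2, <- E4, C3 in E2.
  assert (C2 : c2 = 0) by (etransitivity; [|symmetry; exact E2]; ring).
  rewrite Z1, <- E4, C3, C2 in E1.
  assert (C1 : c1 = 0) by (etransitivity; [|symmetry; exact E1]; ring).
  destruct Hne as [x [y Hne]]. destruct (E x y) as [F4 [F3 [F2 [F1 _]]]].
  rewrite F4, F3, F2, F1, <- E4, C3, C2, C1 in Hne.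
  destruct Hne as [A | [A | [A | A]]]; apply A; ring.
Qed.

(* [f = p(u)] and [g_1 = p'(u)]; since [grad f] is orthogonal to [T = (a, b)],
   [g_1 T(u) = T(f) = 0], so [u], and with it [g_1], is constant along [T]. *)
Lemma null_chain_transport G Om f a b g2 g3 g4 u :
  is_lattice G -> smooth f -> smooth a -> smooth b ->
  csmooth g2 -> csmooth g3 -> csmooth g4 -> csmooth u ->
  periodic G f -> periodic G a -> periodic G b ->
  cperiodic G g2 -> cperiodic G g3 -> cperiodic G g4 -> cperiodic G u ->
  null_chain Om (fun x y => RtoC (f x y)) (fun x y => (a x y, (- b x y)%R)) g2 g3 g4 ->
  (forall x y, DZ u x y = Ci * Om x y) ->
  forall x y, a x y * CD1 u x y + b x y * CD2 u x y = 0 /\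
    (a x y * D1 a x y + b x y * D2 a x y = 0)%R /\
    (a x y * D1 b x y + b x y * D2 b x y = 0)%R.
Proof.
  intros HG Sf Sa Sb S2 S3 S4 Su Pf Pa Pb P2 P3 P4 Pu Hch Hu x y.
  set (g1 := fun x y => (a x y, (- b x y)%R) : C) in *.
  assert (S1 : csmooth g1) by (split; simpl; auto with smooth).
  assert (P1 : cperiodic G g1) by (split; simpl; auto with smooth).
  destruct (null_chain_polynomial G Om (fun x y => RtoC (f x y)) g1 g2 g3 g4 u)
    as [c0 [c1 [c2 [c3 [c4 E]]]]]; auto with smooth.
  destruct Hch as [H0 _].
  (* As [f] is real, the single complex equation for [DZ f] determines both partial derivatives. *)
  assert (F1 : D1 f x y = (Om x y * b x y)%R).
  { specialize (H0 x y). unfold DZ in H0.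
    rewrite CD1_RtoC, CD2_RtoC in H0. unfold g1 in H0. apply (f_equal fst) in H0. simpl in H0. lra. }
  assert (F2 : D2 f x y = (- (Om x y * a x y))%R).
  { specialize (H0 x y). unfold DZ in H0.
    rewrite CD1_RtoC, CD2_RtoC in H0. unfold g1 in H0. apply (f_equal snd) in H0. simpl in H0. lra. }
  assert (Q0 : (fun x y => RtoC (f x y)) = (fun x y =>
    c4 * (u x y * (u x y * (u x y * u x y))) + c3 * (u x y * (u x y * u x y))
             + c2 * (u x y * u x y) + c1 * u x y + c0)).
  { apply functional_extensionality; intros v. apply functional_extensionality; intros w.
    apply E. }
  assert (Q1 : g1 = (fun x y =>
    four * c4 * (u x y * (u x y * u x y)) + three * c3 * (u x y * u x y)
             + two * c2 * u x y + c1)).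
  { apply functional_extensionality; intros v. apply functional_extensionality; intros w.
    apply E. }
  assert (X1 := f_equal (fun g => CD1 g x y) Q0). assert (X2 := f_equal (fun g => CD2 g x y) Q0).
  assert (Y1 := f_equal (fun g => CD1 g x y) Q1). assert (Y2 := f_equal (fun g => CD2 g x y) Q1).
  cbv beta in X1, X2, Y1, Y2.
  rewrite !CD1_plus, !CD1_mult, !CD1_const in X1 by auto 10 with smooth.
  rewrite !CD2_plus, !CD2_mult, !CD2_const in X2 by auto 10 with smooth.
  rewrite !CD1_plus, !CD1_mult, !CD1_const in Y1 by auto 10 with smooth.
  rewrite !CD2_plus, !CD2_mult, !CD2_const in Y2 by auto 10 with smooth.
  assert (T : a x y * CD1 u x y + b x y * CD2 u x y = 0).
  { destruct (classic (g1 x y = 0)) as [Z | Z].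
    - assert (A := f_equal fst Z). assert (B := f_equal snd Z). simpl in A, B.
      assert (B' : b x y = 0%R) by lra. rewrite A, B'. ring.
    - assert (W : g1 x y * (a x y * CD1 u x y + b x y * CD2 u x y) = 0).
      { transitivity (a x y * CD1 (fun x y => RtoC (f x y)) x y
                      + b x y * CD2 (fun x y => RtoC (f x y)) x y).
        - rewrite X1, X2, Q1. ring.
        - rewrite CD1_RtoC, CD2_RtoC, F1, F2. unfold g1.
          apply injective_projections; simpl; ring. }
      apply NNPP; intros A. exact (Cmult_neq_0 _ _ Z A W). }
  assert (T1 : a x y * CD1 g1 x y + b x y * CD2 g1 x y = 0).
  { rewrite Y1, Y2.
    transitivity ((four * c4 * (three * (u x y * u x y)) + three * c3 * (two * u x y)
      + two * c2) * (a x y * CD1 u x y + b x y * CD2 u x y)); [ring |].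
    rewrite T. ring. }
  split; [exact T|].
  assert (K1 : CD1 g1 x y = (D1 a x y, (- D1 b x y)%R))
    by (unfold CD1, g1; simpl; rewrite D1_opp; reflexivity).
  assert (K2 : CD2 g1 x y = (D2 a x y, (- D2 b x y)%R))
    by (unfold CD2, g1; simpl; rewrite D2_opp; reflexivity).
  rewrite K1, K2 in T1.
  assert (A := f_equal fst T1). assert (B := f_equal snd T1). simpl in A, B.
  split; lra.
Qed.
End chain.

(** * Invariant directions *)

(** When the divergence is zero, replacing [D1 a] by [- D2 b] turns the two hypotheses into the two
    conclusions. They say that the derivative of [T] in every direction is parallel to [T]. *)
Lemma self_parallel_field_parallel G a b :
  is_lattice G -> smooth a -> smooth b -> periodic G a -> periodic G b ->
  (forall x y, a x y * D1 a x y + b x y * D2 a x y = 0) ->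
  (forall x y, a x y * D1 b x y + b x y * D2 b x y = 0) ->
  forall x y, a x y * D1 b x y - b x y * D1 a x y = 0 /\
              a x y * D2 b x y - b x y * D2 a x y = 0.
Proof.
  intros HG Sa Sb Pa Pb Ta Tb x y.
  destruct (self_parallel_field_div_zero G a b HG Sa Sb Pa Pb Ta Tb x y) as [[-> ->] | Dv].
  - split; ring.
  - specialize (Ta x y); specialize (Tb x y).
    replace (D1 a x y) with (- D2 b x y) in * by lra. split; lra.
Qed.

(** The component orthogonal to the initial vector divided by the component [N] along it has zero
    derivative as long as [N] is nonzero, and it is 0 at the start. *)
Lemma parallel_curve_locally (A B A' B' : R -> R) :
  (forall t, is_derive A t (A' t)) -> (forall t, is_derive B t (B' t)) ->
  (forall t, A t * B' t - B t * A' t = 0) -> A 0 <> 0 \/ B 0 <> 0 ->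
  locally 0 (fun t => A 0 * B t - B 0 * A t = 0).
Proof.
  intros HA HB H H0.
  set (e1 := A 0) in *. set (e2 := B 0) in *.
  assert (P : 0 < e1 * e1 + e2 * e2) by nra.
  set (N := fun t => e1 * A t + e2 * B t).
  assert (dN : forall t, is_derive N t (e1 * A' t + e2 * B' t)).
  { intros t. apply (is_derive_plus (V := R_NormedModule) (fun t => e1 * A t) (fun t => e2 * B t));
      [apply (is_derive_scal A), HA | apply (is_derive_scal B), HB]. }
  assert (dM : forall t, is_derive (fun t => e1 * B t - e2 * A t) t (e1 * B' t - e2 * A' t)).
  { intros t. apply (is_derive_minus (V := R_NormedModule) (fun t => e1 * B t) (fun t => e2 * A t));
      [apply (is_derive_scal B), HB | apply (is_derive_scal A), HA]. }
  assert (CN : continuous N 0) by (apply (ex_derive_continuous N); eexists; apply dN).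
  assert (N0 : N 0 = e1 * e1 + e2 * e2) by reflexivity.
  destruct (proj1 (filterlim_locally N (N 0)) CN (mkposreal _ P)) as [d Hd].
  assert (Np : forall t, Rabs t < d -> N t <> 0).
  { intros t Ht. assert (K : ball (N 0) (mkposreal _ P) (N t)).
    { apply Hd. change (Rabs (t - 0) < d). rewrite Rminus_0_r. exact Ht. }
    change (Rabs (N t - N 0) < e1 * e1 + e2 * e2) in K. apply Rabs_def2 in K.
    rewrite N0 in K. lra. }
  set (W := fun t => (e1 * B t - e2 * A t) / N t).
  assert (dW : forall t, Rabs t < d -> is_derive W t 0).
  { intros t Ht.
    replace 0 with (((e1 * B' t - e2 * A' t) * N t
      - (e1 * B t - e2 * A t) * (e1 * A' t + e2 * B' t)) / (N t) ^ 2).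
    - apply (is_derive_div (fun t => e1 * B t - e2 * A t) N); auto.
    - unfold N at 1.
      replace ((e1 * B' t - e2 * A' t) * (e1 * A t + e2 * B t) -
       (e1 * B t - e2 * A t) * (e1 * A' t + e2 * B' t))
        with ((e1 * e1 + e2 * e2) * (A t * B' t - B t * A' t)) by ring.
      rewrite H. unfold Rdiv. ring. }
  assert (W0 : W 0 = 0) by (unfold W; fold e1 e2; unfold Rdiv; ring).
  exists d. intros t Ht. change (Rabs (t - 0) < d) in Ht. rewrite Rminus_0_r in Ht.
  assert (WZ : W t = 0).
  { rewrite <- W0. destruct (Rtotal_order 0 t) as [L | [<- | L]].
    - symmetry. apply (eq_is_derive W 0 t); [|exact L].
      intros s Hs. apply dW. rewrite Rabs_right in * by lra. lra.
    - reflexivity.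
    - apply (eq_is_derive W t 0); [|exact L].
      intros s Hs. apply dW. rewrite Rabs_left1 in * by lra. lra. }
  unfold W in WZ. apply (f_equal (fun r => r * N t)) in WZ.
  unfold Rdiv in WZ. rewrite Rmult_assoc, Rinv_l, Rmult_0_l, Rmult_1_r in WZ by (apply Np, Ht).
  exact WZ.
Qed.

(** On each line through [(x0, y0)] the direction is constant near the base point; there
    [e1 be - e2 al] vanishes, and being analytic in the line parameter it vanishes on the whole
    line, also beyond zeros of [T]. *)
Lemma self_parallel_analytic_direction G a b al be w x0 y0 :
  is_lattice G -> smooth a -> smooth b -> periodic G a -> periodic G b ->
  analytic al -> analytic be -> (forall x y, 0 < w x y) ->
  (forall x y, a x y = w x y * al x y) -> (forall x y, b x y = w x y * be x y) ->
  (forall x y, a x y * D1 a x y + b x y * D2 a x y = 0) ->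
  (forall x y, a x y * D1 b x y + b x y * D2 b x y = 0) ->
  a x0 y0 <> 0 \/ b x0 y0 <> 0 ->
  forall x y, a x0 y0 * b x y = b x0 y0 * a x y.
Proof.
  intros HG Sa Sb Pa Pb Aal Abe Hw Ea Eb Ta Tb Hne x y.
  set (e1 := a x0 y0) in *. set (e2 := b x0 y0) in *.
  set (h := x - x0). set (k := y - y0).
  assert (L := parallel_curve_locally
    (fun t => a (x0 + t * h) (y0 + t * k)) (fun t => b (x0 + t * h) (y0 + t * k))
    (fun t => h * D1 a (x0 + t * h) (y0 + t * k) + k * D2 a (x0 + t * h) (y0 + t * k))
    (fun t => h * D1 b (x0 + t * h) (y0 + t * k) + k * D2 b (x0 + t * h) (y0 + t * k))
    (fun t => is_derive_line a x0 y0 h k t Sa) (fun t => is_derive_line b x0 y0 h k t Sb)).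
  cbv beta in L. rewrite !Rmult_0_l, !Rplus_0_r in L. fold e1 e2 in L.
  assert (An : analytic1 (fun t => e1 * be (x0 + t * h) (y0 + t * k)
                                  + - e2 * al (x0 + t * h) (y0 + t * k))).
  { apply (analytic1_comb (fun t => be (x0 + t * h) (y0 + t * k))
      (fun t => al (x0 + t * h) (y0 + t * k))); apply analytic_line; assumption. }
  assert (Z := analytic1_locally_zero_eq _ 0 An).
  lapply Z; clear Z; [intros Z |].
  - specialize (Z 1). cbv beta in Z.
    replace (x0 + 1 * h) with x in Z by (unfold h; ring).
    replace (y0 + 1 * k) with y in Z by (unfold k; ring).
    rewrite Ea, Eb.
    replace (e1 * (w x y * be x y)) with
      (w x y * (e1 * be x y + - e2 * al x y) + e2 * (w x y * al x y)) by ring.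
    rewrite Z. ring.
  - lapply L; clear L; [intros L; specialize (L Hne) |].
    + revert L. apply filter_imp. intros t Ht. rewrite Ea, Eb in Ht.
      assert (P := Hw (x0 + t * h) (y0 + t * k)).
      apply (Rmult_eq_reg_l (w (x0 + t * h) (y0 + t * k))); lra.
    + intros t.
      destruct (self_parallel_field_parallel G a b HG Sa Sb Pa Pb Ta Tb
        (x0 + t * h) (y0 + t * k)) as [Q1 Q2].
      set (A := a (x0 + t * h) (y0 + t * k)) in *.
      set (B := b (x0 + t * h) (y0 + t * k)) in *.
      match goal with |- ?l = 0 => replace l with
        (h * (A * D1 b (x0 + t * h) (y0 + t * k) - B * D1 a (x0 + t * h) (y0 + t * k))
         + k * (A * D2 b (x0 + t * h) (y0 + t * k) - B * D2 a (x0 + t * h) (y0 + t * k)))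
        by ring end.
      rewrite Q1, Q2. ring.
Qed.

(** [T] is a multiple of [e], so the derivative of [f] along [e] vanishes wherever [e . T] does not.
    Up to the factor [w], this product is analytic on lines and nonzero at the base point, hence can
    be cancelled. *)
Lemma analytic_direction_invariant a b al be w x0 y0 f :
  analytic al -> analytic be -> (forall x y, 0 < w x y) ->
  (forall x y, a x y = w x y * al x y) -> (forall x y, b x y = w x y * be x y) ->
  a x0 y0 <> 0 \/ b x0 y0 <> 0 ->
  (forall x y, a x0 y0 * b x y = b x0 y0 * a x y) -> smooth f ->
  (forall x y, a x y * D1 f x y + b x y * D2 f x y = 0) ->
  forall x y, a x0 y0 * D1 f x y + b x0 y0 * D2 f x y = 0.
Proof.
  intros Aal Abe Hw Ea Eb Hne Hpar Sf Hf x y.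
  set (e1 := a x0 y0) in *. set (e2 := b x0 y0) in *.
  set (h := x - x0). set (k := y - y0).
  assert (Sg : smooth (fun x y => e1 * D1 f x y + e2 * D2 f x y)) by auto with smooth.
  assert (Z := analytic1_cancel
    (fun t => e1 * al (x0 + t * h) (y0 + t * k) + e2 * be (x0 + t * h) (y0 + t * k))
    (fun t => e1 * D1 f (x0 + t * h) (y0 + t * k) + e2 * D2 f (x0 + t * h) (y0 + t * k)) 0).
  lapply Z; clear Z; [intros Z |].
  2: { apply (analytic1_comb (fun t => al (x0 + t * h) (y0 + t * k))
      (fun t => be (x0 + t * h) (y0 + t * k))); apply analytic_line; assumption. }
  lapply Z; clear Z; [intros Z |].
  2: { rewrite !Rmult_0_l, !Rplus_0_r. intros E.
       assert (Q : e1 * e1 + e2 * e2 = 0).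
       { unfold e1 at 2, e2 at 2. rewrite Ea, Eb.
         replace (e1 * (w x0 y0 * al x0 y0) + e2 * (w x0 y0 * be x0 y0))
           with (w x0 y0 * (e1 * al x0 y0 + e2 * be x0 y0)) by ring.
         rewrite E. ring. }
       nra. }
  lapply Z; clear Z; [intros Z |].
  2: { intros t. exact (continuous_line _ x0 y0 h k t Sg). }
  lapply Z; clear Z; [intros Z |].
  - specialize (Z 1). cbv beta in Z.
    replace (x0 + 1 * h) with x in Z by (unfold h; ring).
    replace (y0 + 1 * k) with y in Z by (unfold k; ring). exact Z.
  - intros t. set (p := x0 + t * h). set (q := y0 + t * k).
    apply (Rmult_eq_reg_l (w p q)); [|apply Rgt_not_eq, Hw].
    specialize (Hf p q). specialize (Hpar p q).
    transitivity ((e1 * a p q + e2 * b p q) * (e1 * D1 f p q + e2 * D2 f p q)).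
    { rewrite Ea, Eb. ring. }
    transitivity ((e1 * e1 + e2 * e2) * (a p q * D1 f p q + b p q * D2 f p q)
      + (e1 * b p q - e2 * a p q) * (e2 * D1 f p q - e1 * D2 f p q)); [ring |].
    rewrite Hf, Hpar. ring.
Qed.

(** [A] is the real part of [(e1 - i e2) u]. Its gradient follows from the real and imaginary parts
    of the equation for [u] and the invariance of [u] along [e]; [Om], being a combination of
    derivatives of [u], inherits the invariance. *)
Lemma magnetic_potential G Om u e1 e2 :
  csmooth u -> cperiodic G u ->
  (forall x y, DZ u x y = (Ci * RtoC (Om x y))%C) ->
  (forall x y, e1 * D1 (fun x y => fst (u x y)) x y
               + e2 * D2 (fun x y => fst (u x y)) x y = 0) ->
  (forall x y, e1 * D1 (fun x y => snd (u x y)) x y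
               + e2 * D2 (fun x y => snd (u x y)) x y = 0) ->
  exists A, smooth A /\ periodic G A /\
    (forall x y, D1 A x y = Om x y * e2) /\ (forall x y, D2 A x y = - (Om x y * e1)) /\
    (forall x y, e1 * D1 Om x y + e2 * D2 Om x y = 0).
Proof.
  intros [S1 S2] [P1 P2] Hu H1 H2.
  set (u1 := fun x y => fst (u x y)) in *. set (u2 := fun x y => snd (u x y)) in *.
  assert (U1 : forall x y, D1 u1 x y + D2 u2 x y = 0).
  { intros x y. specialize (Hu x y). apply (f_equal fst) in Hu.
    unfold DZ, CD1, CD2 in Hu. fold u1 u2 in Hu. simpl in Hu. lra. }
  assert (U2 : forall x y, D1 u2 x y - D2 u1 x y = Om x y).
  { intros x y. specialize (Hu x y). apply (f_equal snd) in Hu.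
    unfold DZ, CD1, CD2 in Hu. fold u1 u2 in Hu. simpl in Hu. lra. }
  exists (fun x y => e1 * u1 x y + e2 * u2 x y).
  split; [auto with smooth|]. split; [auto with smooth|].
  rewrite D1_plus, D2_plus, !D1_scal, !D2_scal by auto with smooth.
  split; [|split].
  - intros x y. specialize (U1 x y); specialize (U2 x y); specialize (H1 x y);
      specialize (H2 x y). rewrite <- U2.
    replace (D1 u1 x y) with (- D2 u2 x y) in * by lra. lra.
  - intros x y. specialize (U1 x y); specialize (U2 x y); specialize (H1 x y);
      specialize (H2 x y). rewrite <- U2.
    replace (D2 u2 x y) with (- D1 u1 x y) in * by lra. lra.
  - intros x y.
    assert (EO : Om = fun x y => D1 u2 x y - D2 u1 x y)
      by (apply fun2_ext; intros; symmetry; apply U2).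
    rewrite EO. rewrite D1_minus, D2_minus by auto with smooth.
    assert (F1 : (fun x y => e1 * D1 u1 x y + e2 * D2 u1 x y) = fun _ _ => 0)
      by (apply fun2_ext; apply H1).
    assert (F2 : (fun x y => e1 * D1 u2 x y + e2 * D2 u2 x y) = fun _ _ => 0)
      by (apply fun2_ext; apply H2).
    assert (Q1 := f_equal (fun f => D2 f x y) F1). assert (Q2 := f_equal (fun f => D1 f x y) F2).
    cbv beta in Q1, Q2.
    rewrite D2_const, D2_plus, !D2_scal in Q1 by auto with smooth.
    rewrite D1_const, D1_plus, !D1_scal in Q2 by auto with smooth.
    rewrite (D1_D2 u1 S1). rewrite (D1_D2 u2 S2) in Q2. lra.
Qed.

(** * The bracket as a polynomial in the momenta *)

Definition momentum_poly (a : nat -> nat -> R -> R -> R) (x y p1 p2 : R) : R :=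
  sum_f_R0 (fun s =>
    sum_f_R0 (fun k => a s k x y * p1 ^ (s - k) * p2 ^ k) s) 4.

Definition torus_coefs (G : R -> R -> Prop) (a : nat -> nat -> R -> R -> R) : Prop :=
  forall s k, (k <= s <= 4)%nat -> smooth (a s k) /\ periodic G (a s k).

(** Nothing is known about [a s k] outside [k <= s <= 4], while the formula for the bracket also
    reads such indices; there they have to count as zero. *)
Definition coef (a : nat -> nat -> R -> R -> R) (s k : nat) (x y : R) : R :=
  if ((k <=? s) && (s <=? 4))%nat%bool then a s k x y else 0.

(** The coefficient of [p1 ^ (s - k) * p2 ^ k] in [Lam * {F, H}]. *)
Definition bracket_coef (Lam Om : R -> R -> R) (a : nat -> nat -> R -> R -> R)
    (x y : R) (s k : nat) : R :=
  let a' s k := coef a s k x y in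
  let ax s k := coef (fun s k => D1 (a s k)) s k x y in
  let ay s k := coef (fun s k => D2 (a s k)) s k x y in
  let slope r k := INR (S r - k) * a' (S r) k * D1 Lam x y
                   + INR (S k) * a' (S r) (S k) * D2 Lam x y in
  match s with
  | 0%nat => 0
  | S s' =>
      ax s' k + match k with 0%nat => 0 | S k' => ay s' k' end
      + match s' with
        | 0%nat => 0
        | S r => ((if (k <=? r)%nat then slope r k else 0)
                  + match k with S (S k'') => slope r k'' | _ => 0 end) / (2 * Lam x y)
        end
      + Om x y * (match k with 0%nat => 0 | S k' => INR (s - k') * a' s k' end
                  - INR (S k) * a' s (S k))
  end.

Lemma momentum_poly_expand a x y p1 p2 :
  momentum_poly a x y p1 p2 =
  a 0%nat 0%nat x y + (a 1%nat 0%nat x y * p1 + a 1%nat 1%nat x y * p2)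
  + (a 2%nat 0%nat x y * p1 ^ 2 + a 2%nat 1%nat x y * p1 * p2 + a 2%nat 2%nat x y * p2 ^ 2)
  + (a 3%nat 0%nat x y * p1 ^ 3 + a 3%nat 1%nat x y * p1 ^ 2 * p2
     + a 3%nat 2%nat x y * p1 * p2 ^ 2 + a 3%nat 3%nat x y * p2 ^ 3)
  + (a 4%nat 0%nat x y * p1 ^ 4 + a 4%nat 1%nat x y * p1 ^ 3 * p2
     + a 4%nat 2%nat x y * p1 ^ 2 * p2 ^ 2 + a 4%nat 3%nat x y * p1 * p2 ^ 3
     + a 4%nat 4%nat x y * p2 ^ 4).
Proof. unfold momentum_poly. simpl. ring. Qed.

Lemma is_derive_sum (f : nat -> R -> R) (f' : nat -> R) n t :
  (forall k, (k <= n)%nat -> is_derive (f k) t (f' k)) ->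
  is_derive (fun t => sum_f_R0 (fun k => f k t) n) t (sum_f_R0 f' n).
Proof.
  induction n as [|n IH]; intros H; simpl.
  - apply H; lia.
  - apply (is_derive_plus (V := R_NormedModule) (fun t => sum_f_R0 (fun k => f k t) n) (f (S n))).
    + apply IH. intros k Hk. apply H. lia.
    + apply H. lia.
Qed.

Lemma is_derive_poly_x G a x y p1 p2 : torus_coefs G a ->
  is_derive (fun t => momentum_poly a t y p1 p2) x
    (momentum_poly (fun s k => D1 (a s k)) x y p1 p2).
Proof.
  intros Ha. unfold momentum_poly.
  apply (is_derive_sum (fun s t => sum_f_R0 (fun k => a s k t y * p1 ^ (s - k) * p2 ^ k) s)
    (fun s => sum_f_R0 (fun k => D1 (a s k) x y * p1 ^ (s - k) * p2 ^ k) s)).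
  intros s Hs.
  apply (is_derive_sum (fun k t => a s k t y * p1 ^ (s - k) * p2 ^ k)
    (fun k => D1 (a s k) x y * p1 ^ (s - k) * p2 ^ k)).
  intros k Hk. apply is_derive_Reals.
  apply (derivable_pt_lim_scal_right (fun t => a s k t y * p1 ^ (s - k))).
  apply (derivable_pt_lim_scal_right (fun t => a s k t y)).
  apply is_derive_Reals, is_derive_D1, Ha. lia.
Qed.

Lemma is_derive_poly_y G a x y p1 p2 : torus_coefs G a ->
  is_derive (fun t => momentum_poly a x t p1 p2) y
    (momentum_poly (fun s k => D2 (a s k)) x y p1 p2).
Proof.
  intros Ha. unfold momentum_poly.
  apply (is_derive_sum (fun s t => sum_f_R0 (fun k => a s k x t * p1 ^ (s - k) * p2 ^ k) s)
    (fun s => sum_f_R0 (fun k => D2 (a s k) x y * p1 ^ (s - k) * p2 ^ k) s)).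
  intros s Hs.
  apply (is_derive_sum (fun k t => a s k x t * p1 ^ (s - k) * p2 ^ k)
    (fun k => D2 (a s k) x y * p1 ^ (s - k) * p2 ^ k)).
  intros k Hk. apply is_derive_Reals.
  apply (derivable_pt_lim_scal_right (fun t => a s k x t * p1 ^ (s - k))).
  apply (derivable_pt_lim_scal_right (fun t => a s k x t)).
  apply is_derive_Reals, is_derive_D2, Ha. lia.
Qed.

Definition poly_dp1 (a : nat -> nat -> R -> R -> R) (x y p1 p2 : R) : R :=
  a 1%nat 0%nat x y
  + (2 * a 2%nat 0%nat x y * p1 + a 2%nat 1%nat x y * p2)
  + (3 * a 3%nat 0%nat x y * p1 ^ 2 + 2 * a 3%nat 1%nat x y * p1 * p2
     + a 3%nat 2%nat x y * p2 ^ 2)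
  + (4 * a 4%nat 0%nat x y * p1 ^ 3 + 3 * a 4%nat 1%nat x y * p1 ^ 2 * p2
     + 2 * a 4%nat 2%nat x y * p1 * p2 ^ 2 + a 4%nat 3%nat x y * p2 ^ 3).

Definition poly_dp2 (a : nat -> nat -> R -> R -> R) (x y p1 p2 : R) : R :=
  a 1%nat 1%nat x y
  + (a 2%nat 1%nat x y * p1 + 2 * a 2%nat 2%nat x y * p2)
  + (a 3%nat 1%nat x y * p1 ^ 2 + 2 * a 3%nat 2%nat x y * p1 * p2
     + 3 * a 3%nat 3%nat x y * p2 ^ 2)
  + (a 4%nat 1%nat x y * p1 ^ 3 + 2 * a 4%nat 2%nat x y * p1 ^ 2 * p2
     + 3 * a 4%nat 3%nat x y * p1 * p2 ^ 2 + 4 * a 4%nat 4%nat x y * p2 ^ 3).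

Lemma is_derive_poly_p1 a x y p1 p2 :
  is_derive (fun t => momentum_poly a x y t p2) p1 (poly_dp1 a x y p1 p2).
Proof.
  apply (is_derive_ext _ _ _ _ (fun t => eq_sym (momentum_poly_expand a x y t p2))).
  unfold poly_dp1. auto_derive; [exact I | ring].
Qed.

Lemma is_derive_poly_p2 a x y p1 p2 :
  is_derive (fun t => momentum_poly a x y p1 t) p2 (poly_dp2 a x y p1 p2).
Proof.
  apply (is_derive_ext _ _ _ _ (fun t => eq_sym (momentum_poly_expand a x y p1 t))).
  unfold poly_dp2. auto_derive; [exact I | ring].
Qed.

Lemma is_derive_H_x Lam x y p1 p2 : smooth Lam -> 0 < Lam x y ->
  is_derive (fun t => hamiltonian Lam t y p1 p2) x
    (- (p1 ^ 2 + p2 ^ 2) * D1 Lam x y / (2 * Lam x y ^ 2)).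
Proof.
  intros SL PL. unfold hamiltonian.
  assert (E := is_derive_D1 Lam x y SL).
  auto_derive.
  - split; [eexists; exact E | split; [nra | exact I]].
  - change (Derive (fun t => Lam t y) x) with (D1 Lam x y). field. lra.
Qed.

Lemma is_derive_H_y Lam x y p1 p2 : smooth Lam -> 0 < Lam x y ->
  is_derive (fun t => hamiltonian Lam x t p1 p2) y
    (- (p1 ^ 2 + p2 ^ 2) * D2 Lam x y / (2 * Lam x y ^ 2)).
Proof.
  intros SL PL. unfold hamiltonian.
  assert (E := is_derive_D2 Lam x y SL).
  auto_derive.
  - split; [eexists; exact E | split; [nra | exact I]].
  - change (Derive (fun t => Lam x t) y) with (D2 Lam x y). field. lra.
Qed.

Lemma is_derive_H_p1 Lam x y p1 p2 : 0 < Lam x y ->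
  is_derive (fun t => hamiltonian Lam x y t p2) p1 (p1 / Lam x y).
Proof. intros PL. unfold hamiltonian. auto_derive; [exact I | field; lra]. Qed.

Lemma is_derive_H_p2 Lam x y p1 p2 : 0 < Lam x y ->
  is_derive (fun t => hamiltonian Lam x y p1 t) p2 (p2 / Lam x y).
Proof. intros PL. unfold hamiltonian. auto_derive; [exact I | field; lra]. Qed.

Lemma bracket_with_H Lam Om F x y p1 p2 : smooth Lam -> 0 < Lam x y ->
  Lam x y * magnetic_bracket Om F (hamiltonian Lam) x y p1 p2 =
  d_x F x y p1 p2 * p1 + d_y F x y p1 p2 * p2
  + (d_p1 F x y p1 p2 * D1 Lam x y + d_p2 F x y p1 p2 * D2 Lam x y)
    * (p1 ^ 2 + p2 ^ 2) / (2 * Lam x y)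
  + Om x y * (d_p1 F x y p1 p2 * p2 - d_p2 F x y p1 p2 * p1).
Proof.
  intros SL PL.
  assert (E1 : d_x (hamiltonian Lam) x y p1 p2
    = - (p1 ^ 2 + p2 ^ 2) * D1 Lam x y / (2 * Lam x y ^ 2))
    by (apply is_derive_unique, is_derive_H_x; assumption).
  assert (E2 : d_y (hamiltonian Lam) x y p1 p2
    = - (p1 ^ 2 + p2 ^ 2) * D2 Lam x y / (2 * Lam x y ^ 2))
    by (apply is_derive_unique, is_derive_H_y; assumption).
  assert (E3 : d_p1 (hamiltonian Lam) x y p1 p2 = p1 / Lam x y)
    by (apply is_derive_unique, is_derive_H_p1; assumption).
  assert (E4 : d_p2 (hamiltonian Lam) x y p1 p2 = p2 / Lam x y)
    by (apply is_derive_unique, is_derive_H_p2; assumption).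
  unfold magnetic_bracket. rewrite E1, E2, E3, E4. field. lra.
Qed.

Lemma bracket_expand G Lam Om a x y p1 p2 :
  torus_coefs G a -> smooth Lam -> 0 < Lam x y ->
  Lam x y * magnetic_bracket Om (momentum_poly a) (hamiltonian Lam) x y p1 p2 =
  sum_f_R0 (fun s =>
    sum_f_R0 (fun k => bracket_coef Lam Om a x y s k * p1 ^ (s - k) * p2 ^ k) s) 5.
Proof.
  intros Ha SL PL. rewrite bracket_with_H by assumption.
  assert (E1 : d_x (momentum_poly a) x y p1 p2
    = momentum_poly (fun s k => D1 (a s k)) x y p1 p2)
    by (exact (is_derive_unique _ _ _ (is_derive_poly_x G a x y p1 p2 Ha))).
  assert (E2 : d_y (momentum_poly a) x y p1 p2
    = momentum_poly (fun s k => D2 (a s k)) x y p1 p2)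
    by (exact (is_derive_unique _ _ _ (is_derive_poly_y G a x y p1 p2 Ha))).
  assert (E3 : d_p1 (momentum_poly a) x y p1 p2 = poly_dp1 a x y p1 p2)
    by (exact (is_derive_unique _ _ _ (is_derive_poly_p1 a x y p1 p2))).
  assert (E4 : d_p2 (momentum_poly a) x y p1 p2 = poly_dp2 a x y p1 p2)
    by (exact (is_derive_unique _ _ _ (is_derive_poly_p2 a x y p1 p2))).
  rewrite E1, E2, E3, E4, !momentum_poly_expand.
  unfold poly_dp1, poly_dp2, bracket_coef, coef.
  unfold Rdiv. generalize (/ (2 * Lam x y)). intros L. simpl. ring.
Qed.

(** * From three energy levels to the vanishing of all bracket coefficients *)

Lemma poly1_zero (c : nat -> R) :
  (forall t, sum_f_R0 (fun s => c s * t ^ s) 5 = 0) ->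
  forall s, (s <= 5)%nat -> c s = 0.
Proof.
  intros H s Hs.
  assert (H0 := H 0). assert (H1 := H 1). assert (H2 := H (-1)).
  assert (H3 := H 2). assert (H4 := H (-2)). assert (H5 := H 3).
  simpl in *. do 6 (destruct s as [|s]; [lra|]). lia.
Qed.

Lemma quadratic_three_roots c0 c1 c2 t1 t2 t3 :
  t1 <> t2 -> t1 <> t3 -> t2 <> t3 ->
  c0 + c1 * t1 + c2 * t1 ^ 2 = 0 -> c0 + c1 * t2 + c2 * t2 ^ 2 = 0 ->
  c0 + c1 * t3 + c2 * t3 ^ 2 = 0 -> c0 = 0 /\ c1 = 0 /\ c2 = 0.
Proof.
  intros N12 N13 N23 H1 H2 H3.
  assert (Q2 : c1 + c2 * (t1 + t2) = 0).
  { apply (Rmult_eq_reg_l (t1 - t2)); [|lra]. lra. }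
  assert (Q3 : c1 + c2 * (t1 + t3) = 0).
  { apply (Rmult_eq_reg_l (t1 - t3)); [|lra]. lra. }
  assert (Z2 : c2 = 0).
  { apply (Rmult_eq_reg_l (t2 - t3)); [|lra]. lra. }
  rewrite Z2 in *. assert (c1 = 0) by lra. repeat split; try lra; nra.
Qed.

(** On a fixed ray [t (1, p2)] both signs of [t] reach the same level, which separates the odd from
    the even degrees. Divided by [t], the odd part of degrees 1, 3, 5 is quadratic in [t ^ 2];
    divided by [t ^ 2], the even part of degrees 2, 4 is linear in it. Three energies give three
    distinct values of [t ^ 2]. *)
Lemma bracket_coef_zero G Lam Om a E1 E2 E3 :
  torus_coefs G a -> smooth Lam -> (forall x y, 0 < Lam x y) ->
  0 < E1 -> 0 < E2 -> 0 < E3 -> E1 <> E2 -> E1 <> E3 -> E2 <> E3 ->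
  first_integral_on_level Lam Om E1 (momentum_poly a) ->
  first_integral_on_level Lam Om E2 (momentum_poly a) ->
  first_integral_on_level Lam Om E3 (momentum_poly a) ->
  forall x y s k, (k <= s <= 5)%nat -> bracket_coef Lam Om a x y s k = 0.
Proof.
  intros Ha SL PL P1 P2 P3 N12 N13 N23 I1 I2 I3 x y.
  assert (L := PL x y).
  set (K := bracket_coef Lam Om a x y).
  set (Q := fun s p1 p2 => sum_f_R0 (fun k => K s k * p1 ^ (s - k) * p2 ^ k) s).
  assert (Hom : forall s t p1 p2, Q s (t * p1) (t * p2) = t ^ s * Q s p1 p2).
  { intros s t p1 p2. unfold Q. rewrite scal_sum. apply sum_eq. intros i Hi.
    rewrite !Rpow_mult_distr.
    replace (t ^ s) with (t ^ (s - i) * t ^ i) by (rewrite <- pow_add; f_equal; lia).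
    ring. }
  assert (Lev : forall E, first_integral_on_level Lam Om E (momentum_poly a) ->
    forall p1 p2, (p1 ^ 2 + p2 ^ 2) = 2 * Lam x y * E ->
    Q 1%nat p1 p2 + Q 2%nat p1 p2 + Q 3%nat p1 p2 + Q 4%nat p1 p2 + Q 5%nat p1 p2 = 0).
  { intros E HE p1 p2 Hp.
    assert (B := bracket_expand G Lam Om a x y p1 p2 Ha SL L).
    rewrite HE in B by (unfold hamiltonian; rewrite Hp; field; lra).
    rewrite Rmult_0_r in B. fold K in B.
    symmetry in B. change (sum_f_R0 (fun s => Q s p1 p2) 5 = 0) in B.
    rewrite <- B. simpl sum_f_R0 at 1.
    assert (Z : Q 0%nat p1 p2 = 0) by (unfold Q, K, bracket_coef; simpl; ring).
    rewrite Z. ring. }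
  assert (QZ : forall p2 s, (s <= 5)%nat -> Q s 1 p2 = 0).
  { intros p2.
    set (rho := 1 + p2 ^ 2).
    assert (Rho : 0 < rho) by (unfold rho; nra).
    assert (T : forall E, 0 < E -> first_integral_on_level Lam Om E (momentum_poly a) ->
      let tau := 2 * Lam x y * E / rho in
      Q 1%nat 1 p2 + Q 3%nat 1 p2 * tau + Q 5%nat 1 p2 * tau ^ 2 = 0 /\
      Q 2%nat 1 p2 + Q 4%nat 1 p2 * tau = 0).
    { intros E PE HE tau.
      assert (Tau : 0 < tau).
      { apply Rdiv_lt_0_compat; [apply Rmult_lt_0_compat; lra | exact Rho]. }
      set (t := sqrt tau).
      assert (Tt : t * t = tau) by (apply sqrt_sqrt; lra).
      assert (T0 : 0 < t) by (apply sqrt_lt_R0, Tau).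
      assert (A : (t * 1) ^ 2 + (t * p2) ^ 2 = 2 * Lam x y * E).
      { replace ((t * 1) ^ 2 + (t * p2) ^ 2) with (t * t * rho) by (unfold rho; ring).
        rewrite Tt. unfold tau. field. lra. }
      assert (B : (- t * 1) ^ 2 + (- t * p2) ^ 2 = 2 * Lam x y * E).
      { rewrite <- A. ring. }
      apply (Lev E HE) in A. apply (Lev E HE) in B. rewrite !Hom in A, B.
      rewrite <- Tt. split.
      - apply (Rmult_eq_reg_l (2 * t)); [|lra]. lra.
      - apply (Rmult_eq_reg_l (2 * (t * t))); [|nra]. lra. }
    destruct (T E1 P1 I1) as [A1 B1]. destruct (T E2 P2 I2) as [A2 B2].
    destruct (T E3 P3 I3) as [A3 B3].
    assert (W : forall E E', E <> E' -> 2 * Lam x y * E / rho <> 2 * Lam x y * E' / rho).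
    { intros E E' Ne Eq. apply Ne.
      apply (Rmult_eq_reg_l (2 * Lam x y / rho)).
      - unfold Rdiv in *. lra.
      - apply Rgt_not_eq, Rdiv_lt_0_compat; lra. }
    destruct (quadratic_three_roots _ _ _ _ _ _ (W _ _ N12) (W _ _ N13) (W _ _ N23) A1 A2 A3)
      as [Z1 [Z3 Z5]].
    (* The even part, regarded as a quadratic with zero leading coefficient. *)
    destruct (quadratic_three_roots (Q 2%nat 1 p2) (Q 4%nat 1 p2) 0
      _ _ _ (W _ _ N12) (W _ _ N13) (W _ _ N23)) as [Z2 [Z4 _]];
      [lra | lra | lra |].
    intros s Hs. destruct s as [|s].
    { unfold Q, K, bracket_coef; simpl; ring. }
    do 5 (destruct s as [|s]; [assumption|]). lia. }
  intros s k Hk.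
  (* Padding with zeros above [s] lets the degree 5 lemma serve every [s]. *)
  set (c := fun k => if (k <=? s)%nat then K s k else 0).
  assert (C : forall j, (j <= 5)%nat -> c j = 0).
  { apply poly1_zero. intros t.
    rewrite <- (QZ t s) by lia. unfold Q, c.
    do 6 (destruct s as [|s]; [simpl; ring|]). lia. }
  specialize (C k ltac:(lia)). unfold c in C.
  rewrite (proj2 (Nat.leb_le k s)) in C by lia. exact C.
Qed.

(** [null_k] is the coefficient [sum_j a_(k,j) (- i) ^ j] of [z ^ k] in the value
    of the polynomial with coefficients [a] at [p = z (1, - i)]. *)
Definition null0 (a : nat -> nat -> R -> R -> R) (x y : R) : C :=
  RtoC (a 0%nat 0%nat x y).
Definition null1 (a : nat -> nat -> R -> R -> R) (x y : R) : C :=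
  (a 1%nat 0%nat x y, - a 1%nat 1%nat x y).
Definition null2 (a : nat -> nat -> R -> R -> R) (x y : R) : C :=
  (a 2%nat 0%nat x y - a 2%nat 2%nat x y, - a 2%nat 1%nat x y).
Definition null3 (a : nat -> nat -> R -> R -> R) (x y : R) : C :=
  (a 3%nat 0%nat x y - a 3%nat 2%nat x y, a 3%nat 3%nat x y - a 3%nat 1%nat x y).
Definition null4 (a : nat -> nat -> R -> R -> R) (x y : R) : C :=
  (a 4%nat 0%nat x y - a 4%nat 2%nat x y + a 4%nat 4%nat x y,
   a 4%nat 3%nat x y - a 4%nat 1%nat x y).

Lemma torus_coefs_null G a : torus_coefs G a ->
  (csmooth (null0 a) /\ csmooth (null1 a) /\ csmooth (null2 a) /\
   csmooth (null3 a) /\ csmooth (null4 a)) /\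
  (cperiodic G (null0 a) /\ cperiodic G (null1 a) /\ cperiodic G (null2 a) /\
   cperiodic G (null3 a) /\ cperiodic G (null4 a)).
Proof.
  intros Ha.
  assert (S : forall s k, (k <= s <= 4)%nat -> smooth (a s k)) by (intros; apply Ha; assumption).
  assert (P : forall s k, (k <= s <= 4)%nat -> periodic G (a s k))
    by (intros; apply Ha; assumption).
  split; repeat split;
    unfold null0, null1, null2, null3, null4; simpl;
    repeat first [apply smooth_plus | apply smooth_minus | apply smooth_opp
      | apply periodic_plus | apply periodic_minus | apply periodic_opp
      | exact (smooth_const 0) | exact (periodic_const G 0)
      | (apply S; lia) | (apply P; lia)].
Qed.

Lemma DZ_pair (r s : R -> R -> R) x y :
  DZ (fun x y => (r x y, s x y)) x y
  = (D1 r x y + D2 s x y, D1 s x y - D2 r x y).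
Proof.
  unfold DZ, CD1, CD2; simpl. apply injective_projections; simpl;
    change (fun x y => r x y) with r; change (fun x y => s x y) with s; ring.
Qed.

(** Each equation is the sum over [k] of [(- i) ^ k] times the bracket coefficients of one degree,
    in which the derivatives of [Lam] cancel. *)
Lemma null_chain_of_bracket G Lam Om a :
  torus_coefs G a ->
  (forall x y s k, (k <= s <= 5)%nat -> bracket_coef Lam Om a x y s k = 0) ->
  null_chain Om (null0 a) (null1 a) (null2 a) (null3 a) (null4 a).
Proof.
  intros Ha HK.
  assert (S : forall s k, (k <= s <= 4)%nat -> smooth (a s k)) by (intros; apply Ha; assumption).
  assert (S10 := S 1%nat 0%nat ltac:(lia)). assert (S11 := S 1%nat 1%nat ltac:(lia)).
  assert (S20 := S 2%nat 0%nat ltac:(lia)). assert (S21 := S 2%nat 1%nat ltac:(lia)).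
  assert (S22 := S 2%nat 2%nat ltac:(lia)). assert (S30 := S 3%nat 0%nat ltac:(lia)).
  assert (S31 := S 3%nat 1%nat ltac:(lia)). assert (S32 := S 3%nat 2%nat ltac:(lia)).
  assert (S33 := S 3%nat 3%nat ltac:(lia)). assert (S40 := S 4%nat 0%nat ltac:(lia)).
  assert (S41 := S 4%nat 1%nat ltac:(lia)). assert (S42 := S 4%nat 2%nat ltac:(lia)).
  assert (S43 := S 4%nat 3%nat ltac:(lia)). assert (S44 := S 4%nat 4%nat ltac:(lia)).
  assert (HK' : forall x y s k, (k <= s <= 5)%nat ->
    bracket_coef Lam Om a x y s k = 0) by exact HK. clear HK.
  unfold bracket_coef, coef, Rdiv in HK'.
  repeat split; intros x y; assert (E := HK' x y); clear HK';
    generalize dependent (/ (2 * Lam x y)); intros L E.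
  - assert (E0 := E 1%nat 0%nat ltac:(lia)). assert (E1 := E 1%nat 1%nat ltac:(lia)).
    simpl in E0, E1.
    etransitivity; [apply (DZ_pair (a 0%nat 0%nat) (fun _ _ => 0)) |].
    rewrite D1_const, D2_const.
    apply injective_projections; simpl; lra.
  - assert (E0 := E 2%nat 0%nat ltac:(lia)). assert (E1 := E 2%nat 1%nat ltac:(lia)).
    assert (E2 := E 2%nat 2%nat ltac:(lia)). simpl in E0, E1, E2.
    etransitivity; [apply (DZ_pair (a 1%nat 0%nat) (fun x y => - a 1%nat 1%nat x y)) |].
    rewrite D1_opp, D2_opp.
    apply injective_projections; simpl; lra.
  - assert (E0 := E 3%nat 0%nat ltac:(lia)). assert (E1 := E 3%nat 1%nat ltac:(lia)).
    assert (E2 := E 3%nat 2%nat ltac:(lia)). assert (E3 := E 3%nat 3%nat ltac:(lia)).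
    simpl in E0, E1, E2, E3.
    etransitivity; [apply (DZ_pair (fun x y => a 2%nat 0%nat x y - a 2%nat 2%nat x y)
      (fun x y => - a 2%nat 1%nat x y)) |].
    rewrite D1_opp, D2_opp, D1_minus, D2_minus by assumption.
    apply injective_projections; simpl; lra.
  - assert (E0 := E 4%nat 0%nat ltac:(lia)). assert (E1 := E 4%nat 1%nat ltac:(lia)).
    assert (E2 := E 4%nat 2%nat ltac:(lia)). assert (E3 := E 4%nat 3%nat ltac:(lia)).
    assert (E4 := E 4%nat 4%nat ltac:(lia)). simpl in E0, E1, E2, E3, E4.
    etransitivity; [apply (DZ_pair (fun x y => a 3%nat 0%nat x y - a 3%nat 2%nat x y)
      (fun x y => a 3%nat 3%nat x y - a 3%nat 1%nat x y)) |].
    rewrite !D1_minus, !D2_minus by assumption.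
    apply injective_projections; simpl; lra.
  - assert (E0 := E 5%nat 0%nat ltac:(lia)). assert (E1 := E 5%nat 1%nat ltac:(lia)).
    assert (E2 := E 5%nat 2%nat ltac:(lia)). assert (E3 := E 5%nat 3%nat ltac:(lia)).
    assert (E4 := E 5%nat 4%nat ltac:(lia)). assert (E5 := E 5%nat 5%nat ltac:(lia)).
    simpl in E0, E1, E2, E3, E4, E5.
    etransitivity; [apply (DZ_pair
      (fun x y => a 4%nat 0%nat x y - a 4%nat 2%nat x y + a 4%nat 4%nat x y)
      (fun x y => a 4%nat 3%nat x y - a 4%nat 1%nat x y)) |].
    rewrite D1_plus, D2_plus by auto with smooth.
    rewrite !D1_minus, !D2_minus by assumption.
    apply injective_projections; simpl; lra.
Qed.

(** This is [div (Lam T) = 0]. In the sum of the coefficients of [p1 ^ 2] and [p2 ^ 2] the two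
    magnetic terms [Om * a 2 1] cancel. *)
Lemma div_of_bracket G Lam Om a :
  torus_coefs G a -> (forall x y, 0 < Lam x y) ->
  (forall x y s k, (k <= s <= 5)%nat -> bracket_coef Lam Om a x y s k = 0) ->
  forall x y,
    a 1%nat 0%nat x y * D1 Lam x y + a 1%nat 1%nat x y * D2 Lam x y
    + Lam x y * (D1 (a 1%nat 0%nat) x y + D2 (a 1%nat 1%nat) x y) = 0.
Proof.
  intros Ha PL HK x y.
  assert (E0 := HK x y 2%nat 0%nat ltac:(lia)). assert (E2 := HK x y 2%nat 2%nat ltac:(lia)).
  unfold bracket_coef, coef in E0, E2. simpl in E0, E2.
  assert (P := PL x y).
  assert (E := f_equal2 Rplus E0 E2). apply (f_equal (fun r => Lam x y * r)) in E.
  match type of E with ?l = _ => transitivity l; [field; lra | rewrite E; ring] end.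
Qed.

(** By the intermediate value theorem on a segment, [A] takes five equally spaced values, too many
    roots for a nonzero quartic. *)
Lemma polynomial_vanishing_on_range A (s0 s1 s2 s3 s4 : R) x1 y1 x2 y2 :
  smooth A -> A x1 y1 <> A x2 y2 ->
  (forall x y, s4 * A x y ^ 4 + s3 * A x y ^ 3 + s2 * A x y ^ 2 + s1 * A x y + s0 = 0) ->
  s4 = 0 /\ s3 = 0 /\ s2 = 0 /\ s1 = 0 /\ s0 = 0.
Proof.
  intros SA Hne H.
  set (g := fun t => A (x1 + t * (x2 - x1)) (y1 + t * (y2 - y1))).
  assert (Cg : continuity g).
  { intros t. apply continuity_pt_filterlim.
    exact (continuous_line A x1 y1 (x2 - x1) (y2 - y1) t SA). }
  assert (g0 : g 0 = A x1 y1) by (unfold g; f_equal; ring).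
  assert (g1 : g 1 = A x2 y2) by (unfold g; f_equal; ring).
  set (d := (A x2 y2 - A x1 y1) / 4).
  assert (D : d <> 0) by (unfold d; lra).
  assert (Hv : forall j, 0 <= j <= 4 -> let v := A x1 y1 + j * d in
    s4 * v ^ 4 + s3 * v ^ 3 + s2 * v ^ 2 + s1 * v + s0 = 0).
  { intros j Hj v. destruct (IVT_gen g 0 1 v Cg) as [t [_ Ht]].
    - rewrite g0, g1. unfold v, d, Rmin, Rmax.
      destruct (Rle_dec (A x1 y1) (A x2 y2)); split; nra.
    - rewrite <- Ht. apply H. }
  set (v := A x1 y1) in *.
  assert (V0 := Hv 0 ltac:(lra)). assert (V1 := Hv 1 ltac:(lra)).
  assert (V2 := Hv 2 ltac:(lra)). assert (V3 := Hv 3 ltac:(lra)).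
  assert (V4 := Hv 4 ltac:(lra)). cbv zeta in *. clear Hv.
  assert (D2 : d ^ 2 <> 0) by (apply pow_nonzero, D).
  assert (D3 : d ^ 3 <> 0) by (apply pow_nonzero, D).
  assert (D4 : d ^ 4 <> 0) by (apply pow_nonzero, D).
  (* The fourth difference of the five equations is [24 d ^ 4 s4]; after that, lower differences
     give [6 d ^ 3 s3], [2 d ^ 2 s2] and [d s1]. *)
  assert (Z4 : s4 = 0).
  { apply (Rmult_eq_reg_r (24 * d ^ 4)); [lra | lra]. }
  subst s4.
  assert (Z3 : s3 = 0).
  { apply (Rmult_eq_reg_r (6 * d ^ 3)); [lra | lra]. }
  subst s3.
  assert (Z2 : s2 = 0).
  { apply (Rmult_eq_reg_r (2 * d ^ 2)); [lra | lra]. }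
  subst s2.
  assert (Z1 : s1 = 0).
  { apply (Rmult_eq_reg_r d); [lra | exact D]. }
  subst s1. repeat split; lra.
Qed.

(** * Division by the Hamiltonian *)

Definition has_partials (F : R -> R -> R -> R -> R) : Prop :=
  forall x y p1 p2,
    ex_derive (fun t => F t y p1 p2) x /\ ex_derive (fun t => F x t p1 p2) y /\
    ex_derive (fun t => F x y t p2) p1 /\ ex_derive (fun t => F x y p1 t) p2.

Lemma has_partials_momentum_poly G a : torus_coefs G a -> has_partials (momentum_poly a).
Proof.
  intros Ha x y p1 p2. repeat split; eexists.
  - apply (is_derive_poly_x G), Ha.
  - apply (is_derive_poly_y G), Ha.
  - apply is_derive_poly_p1.
  - apply is_derive_poly_p2.
Qed.

Lemma Derive_comp_plus_mult (q dq f h g : R -> R) t :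
  (forall X, is_derive q X (dq X)) -> ex_derive f t -> ex_derive h t -> ex_derive g t ->
  Derive (fun t => q (f t) + h t * g t) t
  = dq (f t) * Derive f t + Derive h t * g t + h t * Derive g t.
Proof.
  intros Hq Hf Hh Hg.
  rewrite (Derive_plus (fun t => q (f t)) (fun t => h t * g t)).
  - rewrite Derive_mult by assumption.
    rewrite (Derive_comp q f) by (auto; eexists; apply Hq).
    rewrite (is_derive_unique _ _ _ (Hq (f t))). ring.
  - apply (ex_derive_comp q f); [eexists; apply Hq | exact Hf].
  - apply ex_derive_mult; assumption.
Qed.

(** By the Leibniz and chain rules, [H {F', H} = {F, H} - q'(F1) {F1, H} = 0]. Where [H] is zero
    both real momenta are zero, and every term of the bracket with [H] contains a momentum. *)
Lemma quotient_first_integral Lam Om F F1 F' q dq :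
  smooth Lam -> (forall x y, 0 < Lam x y) -> (forall X, is_derive q X (dq X)) ->
  has_partials F1 -> has_partials F' ->
  (forall x y p1 p2, F x y p1 p2
    = q (F1 x y p1 p2) + hamiltonian Lam x y p1 p2 * F' x y p1 p2) ->
  first_integral Lam Om F1 -> first_integral Lam Om F -> first_integral Lam Om F'.
Proof.
  intros SL PL Hq D1' D' HF I1 IF x y p1 p2. assert (L := PL x y).
  destruct (Req_dec (hamiltonian Lam x y p1 p2) 0) as [Z | Z].
  - assert (P : p1 = 0 /\ p2 = 0).
    { unfold hamiltonian in Z. apply (f_equal (fun r => r * (2 * Lam x y))) in Z.
      unfold Rdiv in Z. rewrite Rmult_assoc, Rinv_l, Rmult_1_r, Rmult_0_l in Z by lra.
      split; nra. }
    destruct P as [-> ->].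
    apply (Rmult_eq_reg_l (Lam x y)); [|lra].
    rewrite bracket_with_H by assumption. field. lra.
  - assert (EF : F = fun x y p1 p2 =>
      q (F1 x y p1 p2) + hamiltonian Lam x y p1 p2 * F' x y p1 p2).
    { do 4 (apply functional_extensionality; intro). apply HF. }
    specialize (I1 x y p1 p2). specialize (IF x y p1 p2).
    destruct (D1' x y p1 p2) as [A1 [A2 [A3 A4]]].
    destruct (D' x y p1 p2) as [B1 [B2 [B3 B4]]].
    assert (H1 : ex_derive (fun t => hamiltonian Lam t y p1 p2) x)
      by (eexists; apply is_derive_H_x; assumption).
    assert (H2 : ex_derive (fun t => hamiltonian Lam x t p1 p2) y)
      by (eexists; apply is_derive_H_y; assumption).
    assert (H3 : ex_derive (fun t => hamiltonian Lam x y t p2) p1)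
      by (eexists; apply is_derive_H_p1; assumption).
    assert (H4 : ex_derive (fun t => hamiltonian Lam x y p1 t) p2)
      by (eexists; apply is_derive_H_p2; assumption).
    set (X := F1 x y p1 p2). set (H := hamiltonian Lam) in *. set (Y := F' x y p1 p2).
    assert (E1 : d_x F x y p1 p2 = dq X * d_x F1 x y p1 p2 + d_x H x y p1 p2 * Y
      + H x y p1 p2 * d_x F' x y p1 p2)
      by (rewrite EF; exact (Derive_comp_plus_mult q dq _ _ _ x Hq A1 H1 B1)).
    assert (E2 : d_y F x y p1 p2 = dq X * d_y F1 x y p1 p2 + d_y H x y p1 p2 * Y
      + H x y p1 p2 * d_y F' x y p1 p2)
      by (rewrite EF; exact (Derive_comp_plus_mult q dq _ _ _ y Hq A2 H2 B2)).
    assert (E3 : d_p1 F x y p1 p2 = dq X * d_p1 F1 x y p1 p2 + d_p1 H x y p1 p2 * Y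
      + H x y p1 p2 * d_p1 F' x y p1 p2)
      by (rewrite EF; exact (Derive_comp_plus_mult q dq _ _ _ p1 Hq A3 H3 B3)).
    assert (E4 : d_p2 F x y p1 p2 = dq X * d_p2 F1 x y p1 p2 + d_p2 H x y p1 p2 * Y
      + H x y p1 p2 * d_p2 F' x y p1 p2)
      by (rewrite EF; exact (Derive_comp_plus_mult q dq _ _ _ p2 Hq A4 H4 B4)).
    apply (Rmult_eq_reg_l (H x y p1 p2)); [|exact Z].
    transitivity (magnetic_bracket Om F H x y p1 p2
      - dq X * magnetic_bracket Om F1 H x y p1 p2).
    + unfold magnetic_bracket. rewrite E1, E2, E3, E4. ring.
    + rewrite I1, IF. ring.
Qed.

Definition linear_momentum (e1 e2 : R) (A : R -> R -> R) (x y p1 p2 : R) : R :=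
  e1 * p1 + e2 * p2 + A x y.

Lemma linear_momentum_partials e1 e2 A x y p1 p2 : smooth A ->
  is_derive (fun t => linear_momentum e1 e2 A t y p1 p2) x (D1 A x y) /\
  is_derive (fun t => linear_momentum e1 e2 A x t p1 p2) y (D2 A x y) /\
  is_derive (fun t => linear_momentum e1 e2 A x y t p2) p1 e1 /\
  is_derive (fun t => linear_momentum e1 e2 A x y p1 t) p2 e2.
Proof.
  intros SA. unfold linear_momentum. split; [|split; [|split]].
  - replace (D1 A x y) with (0 + D1 A x y) by ring.
    apply (is_derive_plus (V := R_NormedModule) (fun _ => e1 * p1 + e2 * p2) (fun t => A t y)).
    + apply (is_derive_const (V := R_NormedModule)).
    + apply is_derive_D1, SA.
  - replace (D2 A x y) with (0 + D2 A x y) by ring.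
    apply (is_derive_plus (V := R_NormedModule) (fun _ => e1 * p1 + e2 * p2) (fun t => A x t)).
    + apply (is_derive_const (V := R_NormedModule)).
    + apply is_derive_D2, SA.
  - auto_derive; [exact I | ring].
  - auto_derive; [exact I | ring].
Qed.

Lemma has_partials_linear_momentum e1 e2 A : smooth A ->
  has_partials (linear_momentum e1 e2 A).
Proof.
  intros SA x y p1 p2.
  destruct (linear_momentum_partials e1 e2 A x y p1 p2 SA) as [? [? [? ?]]].
  repeat split; eexists; eassumption.
Qed.

Lemma linear_momentum_first_integral Lam Om e1 e2 A :
  smooth Lam -> (forall x y, 0 < Lam x y) -> smooth A ->
  (forall x y, D1 A x y = Om x y * e2) -> (forall x y, D2 A x y = - (Om x y * e1)) ->
  (forall x y, e1 * D1 Lam x y + e2 * D2 Lam x y = 0) ->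
  first_integral Lam Om (linear_momentum e1 e2 A).
Proof.
  intros SL PL SA HA1 HA2 HL x y p1 p2. assert (L := PL x y).
  apply (Rmult_eq_reg_l (Lam x y)); [|lra].
  rewrite bracket_with_H by assumption.
  destruct (linear_momentum_partials e1 e2 A x y p1 p2 SA) as [K1 [K2 [K3 K4]]].
  assert (E1 : d_x (linear_momentum e1 e2 A) x y p1 p2 = D1 A x y)
    by exact (is_derive_unique _ _ _ K1).
  assert (E2 : d_y (linear_momentum e1 e2 A) x y p1 p2 = D2 A x y)
    by exact (is_derive_unique _ _ _ K2).
  assert (E3 : d_p1 (linear_momentum e1 e2 A) x y p1 p2 = e1)
    by exact (is_derive_unique _ _ _ K3).
  assert (E4 : d_p2 (linear_momentum e1 e2 A) x y p1 p2 = e2)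
    by exact (is_derive_unique _ _ _ K4).
  rewrite E1, E2, E3, E4, HL, HA1, HA2. field. lra.
Qed.

(** The quotient by [H] of the integral with coefficients [a] minus
    [Q(e1 p1 + e2 p2 + A)], where [q2], [q3], [q4] are the values at [A] of
    [Q'' / 2!], [Q''' / 3!], [Q'''' / 4!]. *)
Definition quotient_coefs (Lam : R -> R -> R) (a : nat -> nat -> R -> R -> R)
    (e1 e2 : R) (q2 q3 q4 : R -> R -> R) (s k : nat) : R -> R -> R :=
  match s, k with
  | 0%nat, 0%nat => fun x y => 2 * Lam x y * (a 2%nat 0%nat x y - q2 x y * e1 ^ 2)
  | 1%nat, 0%nat => fun x y => 2 * Lam x y * (a 3%nat 0%nat x y - q3 x y * e1 ^ 3)
  | 1%nat, 1%nat =>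
      fun x y => 2 * Lam x y * (a 3%nat 1%nat x y - q3 x y * (3 * e1 ^ 2 * e2))
  | 2%nat, 0%nat => fun x y => 2 * Lam x y * (a 4%nat 0%nat x y - q4 x y * e1 ^ 4)
  | 2%nat, 1%nat =>
      fun x y => 2 * Lam x y * (a 4%nat 1%nat x y - q4 x y * (4 * e1 ^ 3 * e2))
  | 2%nat, 2%nat => fun x y => 2 * Lam x y * (a 4%nat 4%nat x y - q4 x y * e2 ^ 4)
  | _, _ => fun _ _ => 0
  end.

Lemma quotient_torus_coefs G Lam a e1 e2 q2 q3 q4 :
  smooth Lam -> periodic G Lam -> torus_coefs G a ->
  smooth q2 -> smooth q3 -> smooth q4 ->
  periodic G q2 -> periodic G q3 -> periodic G q4 ->
  torus_coefs G (quotient_coefs Lam a e1 e2 q2 q3 q4).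
Proof.
  intros SL PL Ha S2 S3 S4 P2 P3 P4 s k _.
  assert (S : forall s k, (k <= s <= 4)%nat -> smooth (a s k)) by (intros; apply Ha; assumption).
  assert (P : forall s k, (k <= s <= 4)%nat -> periodic G (a s k))
    by (intros; apply Ha; assumption).
  assert (M : forall f c s' k', (k' <= s' <= 4)%nat -> smooth f -> periodic G f ->
    smooth (fun x y => 2 * Lam x y * (a s' k' x y - f x y * c)) /\
    periodic G (fun x y => 2 * Lam x y * (a s' k' x y - f x y * c))).
  { intros f c s' k' H Sf Pf. specialize (S s' k' H). specialize (P s' k' H).
    split; auto 10 with smooth. }
  destruct s as [|[|[|s]]]; destruct k as [|[|[|k]]]; simpl quotient_coefs;
    first [ apply M; [lia | assumption | assumption]
          | split; [exact (smooth_const 0) | exact (periodic_const G 0)] ].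
Qed.

Definition quartic (r0 r1 r2 r3 r4 X : R) : R :=
  r4 * X ^ 4 + r3 * X ^ 3 + r2 * X ^ 2 + r1 * X + r0.
(** [quartic1], [quartic2] and [quartic3] are the Taylor coefficients [Q' / 1!], [Q'' / 2!] and
    [Q''' / 3!] of [Q = quartic]. *)
Definition quartic1 (r1 r2 r3 r4 X : R) : R :=
  4 * r4 * X ^ 3 + 3 * r3 * X ^ 2 + 2 * r2 * X + r1.
Definition quartic2 (r2 r3 r4 X : R) : R := 6 * r4 * X ^ 2 + 3 * r3 * X + r2.
Definition quartic3 (r3 r4 X : R) : R := 4 * r4 * X + r3.

(** Agreement with [Q(e . p + A)] at null momenta: [eps] is the value of [e . p] at [p = (1, - i)],
    and [Q(z eps + A)] has the coefficients [eps ^ k Q^(k)(A) / k!]. *)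
Definition null_matches (a : nat -> nat -> R -> R -> R) (A : R -> R -> R)
    (e1 e2 r0 r1 r2 r3 r4 : R) : Prop :=
  forall x y,
    let eps := (e1, - e2) : C in let X := A x y in
    null0 a x y = RtoC (quartic r0 r1 r2 r3 r4 X) /\
    null1 a x y = (eps * RtoC (quartic1 r1 r2 r3 r4 X))%C /\
    null2 a x y = (eps * (eps * RtoC (quartic2 r2 r3 r4 X)))%C /\
    null3 a x y = (eps * (eps * (eps * RtoC (quartic3 r3 r4 X))))%C /\
    null4 a x y = (eps * (eps * (eps * (eps * RtoC r4))))%C.

(** A real polynomial that vanishes at the null momenta is divisible by [p1 ^ 2 + p2 ^ 2]. The
    quotient can be read off from few coefficients of the difference, in degree 4 those of [p1 ^ 4],
    [p1 ^ 3 p2] and [p2 ^ 4]. *)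
Lemma division_by_H Lam a A e1 e2 r0 r1 r2 r3 r4 x y p1 p2 :
  0 < Lam x y -> null_matches a A e1 e2 r0 r1 r2 r3 r4 ->
  momentum_poly a x y p1 p2 =
  quartic r0 r1 r2 r3 r4 (linear_momentum e1 e2 A x y p1 p2)
  + hamiltonian Lam x y p1 p2
    * momentum_poly (quotient_coefs Lam a e1 e2 (fun x y => quartic2 r2 r3 r4 (A x y))
        (fun x y => quartic3 r3 r4 (A x y)) (fun _ _ => r4)) x y p1 p2.
Proof.
  intros L HN. destruct (HN x y) as [N0 [N1 [N2 [N3 N4]]]].
  assert (M0 := f_equal fst N0). assert (M1 := f_equal fst N1). assert (M1' := f_equal snd N1).
  assert (M2 := f_equal fst N2). assert (M2' := f_equal snd N2).
  assert (M3 := f_equal fst N3). assert (M3' := f_equal snd N3).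
  assert (M4 := f_equal fst N4). assert (M4' := f_equal snd N4).
  simpl in M0, M1, M1', M2, M2', M3, M3', M4, M4'.
  rewrite !momentum_poly_expand. unfold quotient_coefs, linear_momentum, hamiltonian.
  set (X := A x y) in *.
  set (Q2 := quartic2 r2 r3 r4 X) in *. set (Q3 := quartic3 r3 r4 X) in *.
  set (Q1 := quartic1 r1 r2 r3 r4 X) in *. set (Q0 := quartic r0 r1 r2 r3 r4 X) in *.
  assert (T : quartic r0 r1 r2 r3 r4 (e1 * p1 + e2 * p2 + X)
    = r4 * (e1 * p1 + e2 * p2) ^ 4 + Q3 * (e1 * p1 + e2 * p2) ^ 3
      + Q2 * (e1 * p1 + e2 * p2) ^ 2 + Q1 * (e1 * p1 + e2 * p2) + Q0).
  { unfold Q0, Q1, Q2, Q3, quartic, quartic1, quartic2, quartic3. ring. }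
  rewrite T. clear T.
  clearbody Q0 Q1 Q2 Q3 X.
  rewrite M0.
  (* The matching conditions are solved for the coefficients that the quotient does not read. *)
  replace (a 1%nat 0%nat x y) with (e1 * Q1) by lra.
  replace (a 1%nat 1%nat x y) with (e2 * Q1) by lra.
  replace (a 2%nat 2%nat x y) with (a 2%nat 0%nat x y - (e1 ^ 2 - e2 ^ 2) * Q2) by lra.
  replace (a 2%nat 1%nat x y) with (2 * e1 * e2 * Q2) by lra.
  replace (a 3%nat 2%nat x y)
    with (a 3%nat 0%nat x y - (e1 ^ 3 - 3 * e1 * e2 ^ 2) * Q3) by lra.
  replace (a 3%nat 3%nat x y)
    with (a 3%nat 1%nat x y + (e2 ^ 3 - 3 * e1 ^ 2 * e2) * Q3) by lra.
  replace (a 4%nat 2%nat x y) with (a 4%nat 0%nat x y + a 4%nat 4%nat x y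
    - (e1 ^ 4 - 6 * e1 ^ 2 * e2 ^ 2 + e2 ^ 4) * r4) by lra.
  replace (a 4%nat 3%nat x y)
    with (a 4%nat 1%nat x y + (4 * e1 * e2 ^ 3 - 4 * e1 ^ 3 * e2) * r4) by lra.
  field. lra.
Qed.

(** One step of the descent. The quotient is presented again as a [momentum_poly], with zeros in
    degrees 3 and 4, so that the same lemmas apply to it. *)
Lemma reduction G Lam Om a A e1 e2 r0 r1 r2 r3 r4 :
  smooth Lam -> periodic G Lam -> (forall x y, 0 < Lam x y) ->
  torus_coefs G a -> smooth A -> periodic G A ->
  null_matches a A e1 e2 r0 r1 r2 r3 r4 ->
  first_integral Lam Om (linear_momentum e1 e2 A) ->
  first_integral Lam Om (momentum_poly a) ->
  let a' := quotient_coefs Lam a e1 e2 (fun x y => quartic2 r2 r3 r4 (A x y))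
        (fun x y => quartic3 r3 r4 (A x y)) (fun _ _ => r4) in
  torus_coefs G a' /\ first_integral Lam Om (momentum_poly a') /\
  forall x y p1 p2, momentum_poly a x y p1 p2
    = quartic r0 r1 r2 r3 r4 (linear_momentum e1 e2 A x y p1 p2)
      + hamiltonian Lam x y p1 p2 * momentum_poly a' x y p1 p2.
Proof.
  intros SL PerL PL Ha SA PA HN I1 IF a'.
  assert (Ha' : torus_coefs G a').
  { apply quotient_torus_coefs; auto; unfold quartic2, quartic3; auto 10 with smooth. }
  assert (E : forall x y p1 p2, momentum_poly a x y p1 p2
    = quartic r0 r1 r2 r3 r4 (linear_momentum e1 e2 A x y p1 p2)
      + hamiltonian Lam x y p1 p2 * momentum_poly a' x y p1 p2).
  { intros x y p1 p2. apply division_by_H; [apply PL | exact HN]. }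
  split; [exact Ha'|]. split; [|exact E].
  apply (quotient_first_integral Lam Om (momentum_poly a) (linear_momentum e1 e2 A)
    (momentum_poly a') (quartic r0 r1 r2 r3 r4) (quartic1 r1 r2 r3 r4)); auto.
  - intros X. unfold quartic, quartic1. auto_derive; [exact I | ring].
  - apply has_partials_linear_momentum, SA.
  - apply (has_partials_momentum_poly G), Ha'.
Qed.

Lemma momentum_free_integral_const G Lam Om a :
  smooth Lam -> (forall x y, 0 < Lam x y) -> torus_coefs G a ->
  (forall s k x y, (1 <= s <= 4)%nat -> a s k x y = 0) ->
  first_integral Lam Om (momentum_poly a) ->
  exists c, forall x y p1 p2, momentum_poly a x y p1 p2 = c.
Proof.
  intros SL PL Ha Z IF. exists (a 0%nat 0%nat 0 0).
  assert (E : forall x y p1 p2, momentum_poly a x y p1 p2 = a 0%nat 0%nat x y).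
  { intros. rewrite momentum_poly_expand, !(Z 1%nat), !(Z 2%nat), !(Z 3%nat), !(Z 4%nat) by lia. ring. }
  assert (S0 : smooth (a 0%nat 0%nat)) by (apply Ha; lia).
  assert (Q : forall x y p1 p2, D1 (a 0%nat 0%nat) x y * p1 + D2 (a 0%nat 0%nat) x y * p2 = 0).
  { intros x y p1 p2. assert (B := bracket_with_H Lam Om (momentum_poly a) x y p1 p2 SL (PL x y)).
    rewrite IF, Rmult_0_r in B.
    assert (E1 : d_x (momentum_poly a) x y p1 p2 = D1 (a 0%nat 0%nat) x y)
      by (apply Derive_ext; intros; apply E).
    assert (E2 : d_y (momentum_poly a) x y p1 p2 = D2 (a 0%nat 0%nat) x y)
      by (apply Derive_ext; intros; apply E).
    assert (E3 : d_p1 (momentum_poly a) x y p1 p2 = 0).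
    { unfold d_p1. rewrite (Derive_ext _ (fun _ => a 0%nat 0%nat x y)).
      - apply Derive_const.
      - intros; apply E. }
    assert (E4 : d_p2 (momentum_poly a) x y p1 p2 = 0).
    { unfold d_p2. rewrite (Derive_ext _ (fun _ => a 0%nat 0%nat x y)).
      - apply Derive_const.
      - intros; apply E. }
    rewrite E1, E2, E3, E4 in B. rewrite B. unfold Rdiv. ring. }
  intros x y p1 p2. rewrite E. apply grad_zero_const; [exact S0 | |]; intros u v.
  - specialize (Q u v 1 0). lra.
  - specialize (Q u v 0 1). lra.
Qed.

Lemma bracket_coef_zero_of_integral G Lam Om a :
  torus_coefs G a -> smooth Lam -> (forall x y, 0 < Lam x y) ->
  first_integral Lam Om (momentum_poly a) ->
  forall x y s k, (k <= s <= 5)%nat -> bracket_coef Lam Om a x y s k = 0.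
Proof.
  intros Ha SL PL HI.
  (* Any three distinct positive energies would do. *)
  apply (bracket_coef_zero G Lam Om a 1 2 3); auto; try lra; intros x y p1 p2 _; apply HI.
Qed.

(** * Values at null momenta: matching polynomials and the symmetry direction *)

Section null.
Local Open Scope C_scope.

(** Here [u = A / eps] solves the equation of the primitive, so the chain is given by a polynomial
    in [u]. Rescaling its coefficients by powers of [eps] makes it a polynomial in the real function
    [A] with real values. As [Om] and [e] are nonzero, [A] is not constant, and hence the rescaled
    coefficients are real. *)
Lemma null_matches_exists G Lam Om a A (e1 e2 : R) :
  is_lattice G -> smooth Lam -> (forall x y, (0 < Lam x y)%R) ->
  (exists x y, Om x y <> 0%R) -> torus_coefs G a ->
  first_integral Lam Om (momentum_poly a) ->
  (e1 <> 0 \/ e2 <> 0)%R -> smooth A -> periodic G A ->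
  (forall x y, D1 A x y = (Om x y * e2)%R) ->
  (forall x y, D2 A x y = (- (Om x y * e1))%R) ->
  exists r0 r1 r2 r3 r4 : R, null_matches a A e1 e2 r0 r1 r2 r3 r4.
Proof.
  intros HG SL PL [p [q Hpq]] Ha HI He SA PA HA1 HA2.
  set (eps := (e1, (- e2)%R) : C).
  assert (Heps : eps <> 0).
  { intros Z. assert (Z1 := f_equal fst Z). assert (Z2 := f_equal snd Z). simpl in Z1, Z2.
    destruct He; lra. }
  assert (Hne : exists x1 y1 x2 y2, A x1 y1 <> A x2 y2).
  { apply NNPP; intros N.
    assert (E : A = fun _ _ => A 0%R 0%R).
    { apply fun2_ext; intros x y. apply NNPP; intros Ne. apply N. exists x, y, 0%R, 0%R. exact Ne. }
    assert (K1 := HA1 p q). assert (K2 := HA2 p q).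
    rewrite E, D1_const in K1. rewrite E, D2_const in K2.
    destruct He as [He | He]; [apply (Rmult_integral_contrapositive_currified _ _ Hpq He)
      | apply (Rmult_integral_contrapositive_currified _ _ Hpq He)]; lra. }
  destruct Hne as [x1 [y1 [x2 [y2 Hne]]]].
  set (u := fun x y => / eps * RtoC (A x y)).
  assert (Su : csmooth u) by (unfold u; auto with smooth).
  assert (Pu : cperiodic G u) by (unfold u; auto with smooth).
  assert (Hu : forall x y, DZ u x y = Ci * Om x y).
  { intros x y. unfold u. rewrite DZ_mult, DZ_const by auto with smooth.
    unfold DZ. rewrite CD1_RtoC, CD2_RtoC, HA1, HA2.
    transitivity (/ eps * (Ci * RtoC (Om x y) * eps)).
    - replace (RtoC (Om x y * e2) - Ci * RtoC (- (Om x y * e1)))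
        with (Ci * RtoC (Om x y) * eps).
      + ring.
      + unfold eps. apply injective_projections; simpl; ring.
    - field. exact Heps. }
  destruct (torus_coefs_null G a Ha) as [[S0 [S1 [S2 [S3 S4]]]] [P0 [P1 [P2 [P3 P4]]]]].
  assert (Hch := null_chain_of_bracket G Lam Om a Ha
    (bracket_coef_zero_of_integral G Lam Om a Ha SL PL HI)).
  destruct (null_chain_polynomial G Om _ _ _ _ _ u HG S0 S1 S2 S3 S4 Su P0 P1 P2 P3 P4 Pu Hch Hu)
    as [c0 [c1 [c2 [c3 [c4 E]]]]].
  set (R1 := c1 / eps). set (R2 := c2 / (eps * eps)).
  set (R3 := c3 / (eps * (eps * eps))). set (R4 := c4 / (eps * (eps * (eps * eps)))).
  assert (Q1 : c1 = R1 * eps) by (unfold R1; field; exact Heps).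
  assert (Q2 : c2 = R2 * (eps * eps)) by (unfold R2; field; exact Heps).
  assert (Q3 : c3 = R3 * (eps * (eps * eps))) by (unfold R3; field; exact Heps).
  assert (Q4 : c4 = R4 * (eps * (eps * (eps * eps)))) by (unfold R4; field; exact Heps).
  clearbody R1 R2 R3 R4.
  assert (E0 : forall x y, null0 a x y =
    R4 * (RtoC (A x y) * (RtoC (A x y) * (RtoC (A x y) * RtoC (A x y))))
    + R3 * (RtoC (A x y) * (RtoC (A x y) * RtoC (A x y)))
    + R2 * (RtoC (A x y) * RtoC (A x y)) + R1 * RtoC (A x y) + c0).
  { intros x y. destruct (E x y) as [_ [_ [_ [_ ->]]]].
    rewrite Q1, Q2, Q3, Q4. unfold u. field. exact Heps. }
  destruct (polynomial_vanishing_on_range A (snd c0) (snd R1) (snd R2) (snd R3) (snd R4)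
    x1 y1 x2 y2 SA Hne) as [Z4 [Z3 [Z2 [Z1 Z0]]]].
  { intros x y. assert (K := f_equal snd (E0 x y)). simpl in K. lra. }
  assert (Real : forall z : C, snd z = 0%R -> z = RtoC (fst z))
    by (intros z Hz; apply injective_projections; [reflexivity | exact Hz]).
  apply Real in Z0, Z1, Z2, Z3, Z4.
  exists (fst c0), (fst R1), (fst R2), (fst R3), (fst R4).
  set (r0 := fst c0) in *. set (r1 := fst R1) in *. set (r2 := fst R2) in *.
  set (r3 := fst R3) in *. set (r4 := fst R4) in *.
  clearbody r0 r1 r2 r3 r4. rewrite Z1 in Q1. rewrite Z2 in Q2. rewrite Z3 in Q3.
  rewrite Z4 in Q4.
  intros x y eps' X. change eps' with eps. clear eps'.
  destruct (E x y) as [F4 [F3 [F2 [F1 _]]]].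
  split; [|split; [|split; [|split]]].
  - rewrite E0, Z0, Z1, Z2, Z3, Z4. unfold quartic. fold X.
    apply injective_projections; simpl; ring.
  - rewrite F1, Q1, Q2, Q3, Q4. unfold u. fold X.
    replace (RtoC (quartic1 r1 r2 r3 r4 X)) with
      ((1 + 1 + 1 + 1) * RtoC r4 * (RtoC X * (RtoC X * RtoC X))
       + (1 + 1 + 1) * RtoC r3 * (RtoC X * RtoC X) + (1 + 1) * RtoC r2 * RtoC X + RtoC r1)
      by (unfold quartic1; apply injective_projections; simpl; ring).
    field. exact Heps.
  - rewrite F2, Q2, Q3, Q4. unfold u. fold X.
    replace (RtoC (quartic2 r2 r3 r4 X)) with
      ((1 + 1 + 1) * (1 + 1) * RtoC r4 * (RtoC X * RtoC X)
       + (1 + 1 + 1) * RtoC r3 * RtoC X + RtoC r2)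
      by (unfold quartic2; apply injective_projections; simpl; ring).
    field. exact Heps.
  - rewrite F3, Q3, Q4. unfold u. fold X.
    replace (RtoC (quartic3 r3 r4 X)) with ((1 + 1 + 1 + 1) * RtoC r4 * RtoC X + RtoC r3)
      by (unfold quartic3; apply injective_projections; simpl; ring).
    field. exact Heps.
  - rewrite F4, Q4. ring.
Qed.

Lemma symmetry_of_nontrivial_null_chain G Lam Om a al be w :
  is_lattice G -> smooth Lam -> (forall x y, (0 < Lam x y)%R) ->
  smooth Om -> (exists x y, Om x y <> 0%R) -> torus_coefs G a ->
  first_integral Lam Om (momentum_poly a) ->
  analytic al -> analytic be -> (forall x y, (0 < w x y)%R) ->
  (forall x y, a 1%nat 0%nat x y = (w x y * al x y)%R) ->
  (forall x y, a 1%nat 1%nat x y = (w x y * be x y)%R) ->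
  (exists x y, null1 a x y <> 0 \/ null2 a x y <> 0 \/ null3 a x y <> 0 \/ null4 a x y <> 0) ->
  exists (e1 e2 : R) A, (e1 <> 0 \/ e2 <> 0)%R /\ smooth A /\ periodic G A /\
    (forall x y, D1 A x y = (Om x y * e2)%R) /\
    (forall x y, D2 A x y = (- (Om x y * e1))%R) /\
    (forall x y, (e1 * D1 Om x y + e2 * D2 Om x y = 0)%R) /\
    (forall x y, (e1 * D1 Lam x y + e2 * D2 Lam x y = 0)%R).
Proof.
  intros HG SL PL SO HO Ha HI Aal Abe Hw Eal Ebe Hne.
  destruct (torus_coefs_null G a Ha) as [[S0 [S1 [S2 [S3 S4]]]] [P0 [P1 [P2 [P3 P4]]]]].
  assert (HK := bracket_coef_zero_of_integral G Lam Om a Ha SL PL HI).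
  assert (Hch := null_chain_of_bracket G Lam Om a Ha HK).
  assert (Hdiv := div_of_bracket G Lam Om a Ha PL HK).
  destruct (null_chain_primitive G Om _ _ _ _ _ HG S0 S1 S2 S3 S4 P0 P1 P2 P3 P4 Hch Hne)
    as [u [Su [Pu Hu]]].
  destruct (null_chain_g1_neq0 G Om _ _ _ _ _ HG SO HO S0 S1 S2 S3 S4 P0 P1 P2 P3 P4 Hch Hne)
    as [x0 [y0 H0]].
  assert (Sf : smooth (a 0%nat 0%nat)) by (apply Ha; lia).
  assert (Pf : periodic G (a 0%nat 0%nat)) by (apply Ha; lia).
  assert (Sa : smooth (a 1%nat 0%nat)) by (apply Ha; lia).
  assert (Pa : periodic G (a 1%nat 0%nat)) by (apply Ha; lia).
  assert (Sb : smooth (a 1%nat 1%nat)) by (apply Ha; lia).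
  assert (Pb : periodic G (a 1%nat 1%nat)) by (apply Ha; lia).
  assert (T := null_chain_transport G Om _ _ _ _ _ _ u HG Sf Sa Sb S2 S3 S4 Su Pf Pa Pb
    P2 P3 P4 Pu Hch Hu).
  assert (Ta : forall x y, (a 1%nat 0%nat x y * D1 (a 1%nat 0%nat) x y
    + a 1%nat 1%nat x y * D2 (a 1%nat 0%nat) x y = 0)%R) by (intros; apply T).
  assert (Tb : forall x y, (a 1%nat 0%nat x y * D1 (a 1%nat 1%nat) x y
    + a 1%nat 1%nat x y * D2 (a 1%nat 1%nat) x y = 0)%R) by (intros; apply T).
  assert (Hne0 : (a 1%nat 0%nat x0 y0 <> 0 \/ a 1%nat 1%nat x0 y0 <> 0)%R).
  { apply NNPP; intros N. apply H0. unfold null1.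
    apply not_or_and in N. destruct N as [N1 N2]. apply NNPP in N1, N2.
    rewrite N1, N2. apply injective_projections; simpl; ring. }
  assert (Par := self_parallel_analytic_direction G _ _ al be w x0 y0 HG Sa Sb Pa Pb
    Aal Abe Hw Eal Ebe Ta Tb Hne0).
  assert (Inv := fun f => analytic_direction_invariant _ _ al be w x0 y0 f Aal Abe Hw
    Eal Ebe Hne0 Par).
  set (e1 := a 1%nat 0%nat x0 y0) in *. set (e2 := a 1%nat 1%nat x0 y0) in *.
  assert (ILam : forall x y, (e1 * D1 Lam x y + e2 * D2 Lam x y = 0)%R).
  { apply Inv; [exact SL|]. intros x y.
    (* At a zero of [T] there is nothing to prove; elsewhere [div T = 0] and [div (Lam T) = 0] leave
       [T(Lam) = 0]. *)
    destruct (self_parallel_field_div_zero G _ _ HG Sa Sb Pa Pb Ta Tb x y) as [[-> ->] | Dv].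
    - ring.
    - specialize (Hdiv x y). rewrite Dv in Hdiv. lra. }
  destruct Su as [Su1 Su2].
  assert (IU : forall x y, (a 1%nat 0%nat x y * D1 (fun x y => fst (u x y)) x y
      + a 1%nat 1%nat x y * D2 (fun x y => fst (u x y)) x y = 0)%R /\
    (a 1%nat 0%nat x y * D1 (fun x y => snd (u x y)) x y
      + a 1%nat 1%nat x y * D2 (fun x y => snd (u x y)) x y = 0)%R).
  { intros x y. destruct (T x y) as [Tu _]. unfold CD1, CD2 in Tu.
    assert (K1 := f_equal fst Tu). assert (K2 := f_equal snd Tu). simpl in K1, K2.
    split; lra. }
  destruct (magnetic_potential G Om u e1 e2 (conj Su1 Su2) Pu Hu
    (Inv _ Su1 (fun x y => proj1 (IU x y))) (Inv _ Su2 (fun x y => proj2 (IU x y))))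
    as [A [SA [PA [HA1 [HA2 IOm]]]]].
  exists e1, e2, A. repeat (split; [assumption|]). exact ILam.
Qed.
End null.

(** The degenerate match with [e = 0] and [A = 0], whose linear integral is zero: it allows
    [reduction] to divide [F - c] by [H] before any symmetry is known. *)
Lemma null_matches_const G Lam Om a :
  is_lattice G -> smooth Lam -> (forall x y, 0 < Lam x y) -> torus_coefs G a ->
  first_integral Lam Om (momentum_poly a) ->
  ~ (exists x y, null1 a x y <> 0%C \/ null2 a x y <> 0%C \/ null3 a x y <> 0%C
                 \/ null4 a x y <> 0%C) ->
  exists c, null_matches a (fun _ _ => 0) 0 0 c 0 0 0 0.
Proof.
  intros HG SL PL Ha HI N.
  assert (Z : forall x y, null1 a x y = 0%C /\ null2 a x y = 0%C /\ null3 a x y = 0%C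
                          /\ null4 a x y = 0%C).
  { intros x y. repeat split; apply NNPP; intros A; apply N; exists x, y; tauto. }
  destruct (torus_coefs_null G a Ha) as [[S0 _] [P0 _]].
  assert (Hch := null_chain_of_bracket G Lam Om a Ha
    (bracket_coef_zero_of_integral G Lam Om a Ha SL PL HI)).
  destruct (DZ_zero_const G (null0 a) HG S0 P0) as [c Hc].
  { intros x y. rewrite (proj1 Hch). rewrite (proj1 (Z x y)). ring. }
  exists (fst c). intros x y eps X. destruct (Z x y) as [-> [-> [-> ->]]].
  split; [|repeat split].
  - assert (E := Hc x y). unfold null0 in E. rewrite <- E. unfold null0. simpl.
    f_equal. unfold quartic. ring.
  - unfold eps, quartic1. apply injective_projections; simpl; ring.
  - unfold eps, quartic2. apply injective_projections; simpl; ring.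
  - unfold eps, quartic3. apply injective_projections; simpl; ring.
  - unfold eps. apply injective_projections; simpl; ring.
Qed.

Lemma zero_momentum_first_integral Lam Om :
  smooth Lam -> (forall x y, 0 < Lam x y) ->
  first_integral Lam Om (linear_momentum 0 0 (fun _ _ => 0)).
Proof.
  intros SL PL. apply linear_momentum_first_integral; auto with smooth.
  - intros; rewrite D1_const; ring.
  - intros; rewrite D2_const; ring.
  - intros; ring.
Qed.

Lemma quotient_coefs_high Lam a e1 e2 q2 q3 q4 s k x y :
  (3 <= s)%nat -> quotient_coefs Lam a e1 e2 q2 q3 q4 s k x y = 0.
Proof. intros Hs. do 3 (destruct s as [|s]; [lia|]). reflexivity. Qed.

Lemma quotient_coefs_quadratic Lam a e1 e2 q2 q3 q4 s k x y :
  (forall s k x y, (3 <= s)%nat -> a s k x y = 0) -> q3 x y = 0 -> q4 x y = 0 ->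
  (1 <= s)%nat -> quotient_coefs Lam a e1 e2 q2 q3 q4 s k x y = 0.
Proof.
  intros Hz H3 H4 Hs. destruct s as [|[|[|s]]]; [lia | | |]; destruct k as [|[|[|k]]];
    simpl; rewrite ?Hz, ?H3, ?H4 by lia; try reflexivity; ring.
Qed.

(** Needed for the descent to end: with [r3 = r4 = 0] the quotient of a quadratic integral is free
    of momenta. *)
Lemma null_matches_quadratic a A e1 e2 r0 r1 r2 r3 r4 :
  e1 <> 0 \/ e2 <> 0 -> (forall s k x y, (3 <= s)%nat -> a s k x y = 0) ->
  null_matches a A e1 e2 r0 r1 r2 r3 r4 -> r3 = 0 /\ r4 = 0.
Proof.
  intros He Hz HN. destruct (HN 0 0) as [_ [_ [_ [N3 N4]]]].
  set (eps := (e1, - e2) : C) in *.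
  assert (Heps : eps <> 0%C).
  { intros Z. assert (Z1 := f_equal fst Z). assert (Z2 := f_equal snd Z). simpl in Z1, Z2.
    destruct He; lra. }
  assert (K : forall z : C, (eps * z)%C = 0%C -> z = 0%C).
  { intros z Hzz. apply NNPP; intros A0. exact (Cmult_neq_0 _ _ Heps A0 Hzz). }
  assert (Z4 : null4 a 0 0 = 0%C).
  { unfold null4. rewrite !Hz by lia. apply injective_projections; simpl; ring. }
  assert (Z3 : null3 a 0 0 = 0%C).
  { unfold null3. rewrite !Hz by lia. apply injective_projections; simpl; ring. }
  rewrite Z4 in N4. rewrite Z3 in N3.
  symmetry in N4, N3. do 4 apply K in N4. do 3 apply K in N3.
  apply RtoC_inj in N4. apply RtoC_inj in N3. unfold quartic3 in N3. rewrite N4 in N3.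
  split; [lra | exact N4].
Qed.

(** * The symmetry of the flow and the expression of the integral *)

Lemma first_integral_of_levels G Lam Om a E1 E2 E3 :
  torus_coefs G a -> smooth Lam -> (forall x y, 0 < Lam x y) ->
  0 < E1 -> 0 < E2 -> 0 < E3 -> E1 <> E2 -> E1 <> E3 -> E2 <> E3 ->
  first_integral_on_level Lam Om E1 (momentum_poly a) ->
  first_integral_on_level Lam Om E2 (momentum_poly a) ->
  first_integral_on_level Lam Om E3 (momentum_poly a) ->
  first_integral Lam Om (momentum_poly a).
Proof.
  intros Ha SL PL P1 P2 P3 N12 N13 N23 I1 I2 I3 x y p1 p2.
  assert (L := PL x y).
  apply (Rmult_eq_reg_l (Lam x y)); [|lra].
  rewrite (bracket_expand G) by assumption. rewrite Rmult_0_r.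
  assert (K := bracket_coef_zero G Lam Om a E1 E2 E3 Ha SL PL P1 P2 P3 N12 N13 N23 I1 I2 I3 x y).
  rewrite (sum_eq _ (fun _ => 0)).
  - rewrite sum_cte. ring.
  - intros s Hs. rewrite (sum_eq _ (fun _ => 0)).
    + rewrite sum_cte. ring.
    + intros k Hk. rewrite K by lia. ring.
Qed.

(** At most one division is required. If both [F] and its quotient were trivial at null momenta,
    then [F = c + H (c' + H c'')] would be constant on the level. *)
Lemma symmetry_of_integral G Lam Om a E :
  is_lattice G -> smooth Lam -> periodic G Lam -> (forall x y, 0 < Lam x y) ->
  smooth Om -> (exists x y, Om x y <> 0) -> torus_coefs G a ->
  (forall s k, (k <= s <= 4)%nat -> analytic (a s k)) ->
  first_integral Lam Om (momentum_poly a) ->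
  ~ constant_on_level Lam E (momentum_poly a) ->
  exists (e1 e2 : R) A, (e1 <> 0 \/ e2 <> 0) /\ smooth A /\ periodic G A /\
    (forall x y, D1 A x y = Om x y * e2) /\
    (forall x y, D2 A x y = - (Om x y * e1)) /\
    (forall x y, e1 * D1 Om x y + e2 * D2 Om x y = 0) /\
    (forall x y, e1 * D1 Lam x y + e2 * D2 Lam x y = 0).
Proof.
  intros HG SL PerL PL SO HO Ha HA HI Hnc.
  set (nontrivial := fun a => exists x y, null1 a x y <> 0%C \/ null2 a x y <> 0%C \/
    null3 a x y <> 0%C \/ null4 a x y <> 0%C).
  assert (I0 := zero_momentum_first_integral Lam Om SL PL).
  destruct (classic (nontrivial a)) as [N | N].
  - apply (symmetry_of_nontrivial_null_chain G Lam Om a (a 1%nat 0%nat) (a 1%nat 1%nat)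
      (fun _ _ => 1)); auto; intros; try lra; apply HA; lia.
  - destruct (null_matches_const G Lam Om a HG SL PL Ha HI N) as [c Hc].
    destruct (reduction G Lam Om a _ 0 0 c 0 0 0 0 SL PerL PL Ha (smooth_const 0)
      (periodic_const G 0) Hc I0 HI) as [Ha' [HI' HE]].
    match type of Ha' with torus_coefs G ?t => set (a' := t) in * end.
    assert (High : forall s k x y, (3 <= s)%nat -> a' s k x y = 0)
      by (intros; apply quotient_coefs_high; assumption).
    destruct (classic (nontrivial a')) as [N' | N'].
    (* The matching polynomial being constant, the linear part of the quotient is [2 Lam] times the
       analytic coefficients [a 3 0], [a 3 1], which is the case [w = 2 Lam]. *)
    + apply (symmetry_of_nontrivial_null_chain G Lam Om a' (a 3%nat 0%nat) (a 3%nat 1%nat)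
        (fun x y => 2 * Lam x y)); auto; try (apply HA; lia).
      * intros x y. specialize (PL x y). lra.
      * intros x y. unfold a', quotient_coefs. ring.
      * intros x y. unfold a', quotient_coefs. ring.
    + destruct (null_matches_const G Lam Om a' HG SL PL Ha' HI' N') as [c' Hc'].
      destruct (reduction G Lam Om a' _ 0 0 c' 0 0 0 0 SL PerL PL Ha' (smooth_const 0)
        (periodic_const G 0) Hc' I0 HI') as [Ha'' [HI'' HE']].
      match type of Ha'' with torus_coefs G ?t => set (a'' := t) in * end.
      destruct (momentum_free_integral_const G Lam Om a'' SL PL Ha'') as [c'' Hc''].
      { intros s k x y Hs. apply quotient_coefs_quadratic; auto; [unfold quartic3; ring | lia]. }
      { exact HI''. }
      exfalso. apply Hnc. exists (c + E * (c' + E * c'')). intros x y p1 p2 HH.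
      rewrite HE, HE', Hc'', HH. unfold quartic, linear_momentum. ring.
Qed.

Lemma integral_function_of_linear G Lam Om a A e1 e2 :
  is_lattice G -> smooth Lam -> periodic G Lam -> (forall x y, 0 < Lam x y) ->
  (exists x y, Om x y <> 0) -> torus_coefs G a ->
  first_integral Lam Om (momentum_poly a) -> e1 <> 0 \/ e2 <> 0 ->
  smooth A -> periodic G A ->
  (forall x y, D1 A x y = Om x y * e2) -> (forall x y, D2 A x y = - (Om x y * e1)) ->
  first_integral Lam Om (linear_momentum e1 e2 A) ->
  exists phi, forall x y p1 p2, momentum_poly a x y p1 p2
    = phi (linear_momentum e1 e2 A x y p1 p2) (hamiltonian Lam x y p1 p2).
Proof.
  intros HG SL PerL PL HO Ha HI He SA PA HA1 HA2 I1.
  destruct (null_matches_exists G Lam Om a A e1 e2) as [r0 [r1 [r2 [r3 [r4 HN]]]]]; auto.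
  destruct (reduction G Lam Om a A e1 e2 r0 r1 r2 r3 r4 SL PerL PL Ha SA PA HN I1 HI)
    as [Ha' [HI' HE]].
  match type of Ha' with torus_coefs G ?t => set (a' := t) in * end.
  assert (High : forall s k x y, (3 <= s)%nat -> a' s k x y = 0)
    by (intros; apply quotient_coefs_high; assumption).
  destruct (null_matches_exists G Lam Om a' A e1 e2) as [s0 [s1 [s2 [s3 [s4 HN']]]]]; auto.
  destruct (null_matches_quadratic _ _ _ _ _ _ _ _ _ He High HN') as [-> ->].
  destruct (reduction G Lam Om a' A e1 e2 s0 s1 s2 0 0 SL PerL PL Ha' SA PA HN' I1 HI')
    as [Ha'' [HI'' HE']].
  match type of Ha'' with torus_coefs G ?t => set (a'' := t) in * end.
  destruct (momentum_free_integral_const G Lam Om a'' SL PL Ha'') as [c Hc].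
  { intros s k x y Hs. apply quotient_coefs_quadratic; auto; [unfold quartic3; ring | lia]. }
  { exact HI''. }
  exists (fun X h => quartic r0 r1 r2 r3 r4 X + h * (quartic s0 s1 s2 0 0 X + h * c)).
  intros x y p1 p2. rewrite HE, HE', Hc. reflexivity.
Qed.

Lemma polynomial_linear_momentum G e1 e2 A :
  e1 <> 0 \/ e2 <> 0 -> smooth A -> periodic G A ->
  polynomial_in_momenta G smooth 1 (linear_momentum e1 e2 A).
Proof.
  intros He SA PA.
  exists (fun s k => match s, k with
    | 0%nat, _ => A | _, 0%nat => fun _ _ => e1 | _, _ => fun _ _ => e2 end).
  split; [|split].
  - intros s k _. destruct s, k; auto with smooth.
  - destruct He as [He | He]; [exists 0%nat | exists 1%nat]; (split; [lia|]);
      exists 0, 0; exact He.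
  - intros x y p1 p2. unfold linear_momentum. simpl. ring.
Qed.

Theorem theorem2
  (G : R -> R -> Prop) (Lam Om : R -> R -> R)
  (F : R -> R -> R -> R -> R) (E1 E2 E3 : R)
  (HG : is_lattice G)
  (HLam_smooth : smooth Lam) (HLam_per : periodic G Lam)
  (HLam_pos : forall x y : R, 0 < Lam x y)
  (HOm_smooth : smooth Om) (HOm_per : periodic G Om)
  (HOm_nz : exists x y : R, Om x y <> 0)
  (HE1 : 0 < E1) (HE2 : 0 < E2) (HE3 : 0 < E3)
  (HE12 : E1 <> E2) (HE13 : E1 <> E3) (HE23 : E2 <> E3)
  (HF : polynomial_in_momenta G analytic 4 F)
  (HF_int : forall E : R, E = E1 \/ E = E2 \/ E = E3 ->
     first_integral_on_level Lam Om E F /\ ~ constant_on_level Lam E F) :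
  (exists al be : R, (al <> 0 \/ be <> 0) /\
     depends_only_on al be Om /\ depends_only_on al be Lam) /\
  (exists F1 : R -> R -> R -> R -> R,
     polynomial_in_momenta G smooth 1 F1 /\
     first_integral Lam Om F1 /\
     exists phi : R -> R -> R, forall x y p1 p2 : R,
       F x y p1 p2 = phi (F1 x y p1 p2) (hamiltonian Lam x y p1 p2)).
Proof.
  destruct HF as [a [Hreg [_ HFa]]].
  assert (EF : F = momentum_poly a).
  { do 4 (apply functional_extensionality; intro). apply HFa. }
  subst F. clear HFa.
  assert (Ha : torus_coefs G a).
  { intros s k H. destruct (Hreg s k H). split; [apply analytic_smooth|]; assumption. }
  assert (HI : first_integral Lam Om (momentum_poly a)).
  { apply (first_integral_of_levels G Lam Om a E1 E2 E3); auto; apply HF_int; auto. }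
  destruct (symmetry_of_integral G Lam Om a E1)
    as [e1 [e2 [A [He [SA [PA [HA1 [HA2 [IOm ILam]]]]]]]]]; auto.
  { intros s k H. apply Hreg, H. }
  { apply HF_int; auto. }
  assert (I1 := linear_momentum_first_integral Lam Om e1 e2 A HLam_smooth HLam_pos SA
    HA1 HA2 ILam).
  split.
  (* Functions invariant along [e] depend only on the coordinate orthogonal to [e]. *)
  - exists (- e2), e1. split; [destruct He; [right | left]; lra|].
    split; apply invariant_depends_only; assumption.
  - exists (linear_momentum e1 e2 A).
    split; [apply polynomial_linear_momentum; assumption|]. split; [exact I1|].
    apply (integral_function_of_linear G Lam Om); assumption.
Qed.
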